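(* Let $V$ be the rank one fermion vertex operator superalgebra with generating fermion $\psi$, let $n$ be even and let $g=1$ or $g=\sigma$ (the parity automorphism). Then $$G_n(g;z_1,\dots,z_n;\tau)=\mathrm{Pf}(\mathbf P)\,Z_V(g,\tau),$$ where $\mathbf P$ is the antisymmetric $n\times n$ matrix with entries $$\mathbf P(i,j)=P_1\!\left[\begin{array}{c}\theta\\ -1\end{array}\right](z_i-z_j,\tau)\qquad(1\le i\ne j\le n),$$ with $\theta=1$ for $g=1$ and $\theta=-1$ for $g=\sigma$.
   Context: The rank one fermion VOSA $V=V(H,\mathbb Z+\frac12)$, $H=\mathbb C\psi$, is generated by an odd vector $\psi$ with $Y(\psi,z)=\sum_{n\in\mathbb Z}\psi(n)z^{-n-1}$, $\psi(m)\psi(n)+\psi(n)\psi(m)=\delta_{m+n+1,0}$, $\psi(k)\mathbf 1=0$ for $k\ge0$, with basis $\psi(-k_1)\cdots\psi(-k_m)\mathbf 1$, $1\le k_1<\dots<k_m$. The conformal vector is $\omega=\frac12\psi(-2)\psi(-1)\mathbf 1$, central charge $c=\frac12$; the basis vector has $L(0)$-weight $\sum_i(k_i-\frac12)$, so $wt(\psi)=\frac12$. $\sigma a=(-1)^{p(a)}a$ where $p$ is parity; $\mathrm{STr}_V(X)=\mathrm{Tr}_{V_{\bar0}}(X)-\mathrm{Tr}_{V_{\bar1}}(X)$. With $\tau$ in the upper half plane, $q=e^{2\pi i\tau}$, $q_i=e^{z_i}$, $q_i^{L(0)}=\exp(z_iL(0))$, $$F_V(g;(v_1,z_1),\dots,(v_n,z_n);\tau)=\mathrm{STr}_V\!\left(g\,Y(q_1^{L(0)}v_1,q_1)\cdots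 Y(q_n^{L(0)}v_n,q_n)\,q^{L(0)-1/48}\right),$$ $Z_V(g,\tau)=\mathrm{STr}_V(g\,q^{L(0)-1/48})$, and $G_n(g;z_1,\dots,z_n;\tau)=F_V(g;(\psi,z_1),\dots,(\psi,z_n);\tau)$. These functions of the $z_i$ are the traces for $|q_1|>\dots>|q_n|>|q\,q_1|$, continued meromorphically. Twisted Weierstrass function: for $(\theta,\phi)\in U(1)\times U(1)$, $\phi=e^{2\pi i\lambda}$, $0\le\lambda<1$, $(\theta,\phi)\neq(1,1)$, $$P_1\!\left[\begin{array}{c}\theta\\ \phi\end{array}\right](z,\tau)=-\sum_{n\in\mathbb Z+\lambda}\frac{e^{nz}}{1-\theta^{-1}q^{n}}$$ for $|q|<|e^z|<1$, where $q^n=e^{2\pi i n\tau}$, continued meromorphically to $z\in\mathbb C$. The Pfaffian of an antisymmetric $2m\times2m$ matrix is $\mathrm{Pf}(\mathbf M)=\sum_\Pi\varepsilon_{i_1j_1\dots i_mj_m}M(i_1,j_1)\cdots M(i_m,j_m)$, summed over partitions $\Pi$ of $\{1,\dots,2m\}$ into pairs $\{(i_1,j_1),\dots,(i_m,j_m)\}$ with $i_k<j_k$, $i_1<\dots<i_m$, where $\varepsilon$ is the Levi-Civita symbol. *)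

(* Defs.v *)
From HB Require Import structures.
From mathcomp Require Import all_boot all_order all_fingroup all_algebra.
From mathcomp Require Import finmap complex.
From mathcomp Require Import boolp classical_sets fsbigop reals.
From mathcomp Require Import sequences exp trigo.
Set Implicit Arguments.
Unset Strict Implicit.
Unset Printing Implicit Defensive.
Import Order.TTheory GRing.Theory Num.Theory.
Local Open Scope ring_scope.
Local Open Scope complex_scope.

Definition cexp (R : realType) (z : R[i]) : R[i] :=
  (expR (complex.Re z) * cos (complex.Im z))
    +i* (expR (complex.Re z) * sin (complex.Im z)).

Definition two_pi_i (R : realType) : R[i] := 0 +i* (2 * pi).

Definition has_sum (R : realType) (I : choiceType) (f : I -> R[i]) (s : R[i]) : Prop :=
  forall eps : R, 0 < eps ->
    exists A : {fset I}, forall B : {fset I}, fsubset A B ->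
      `|\sum_(i <- B) f i - s| < eps%:C.

(* Defaults to 0 when the family has no sum. *)
Definition tsum (R : realType) (I : choiceType) (f : I -> R[i]) : R[i] :=
  xget 0 [set s | has_sum f s]%classic.

Definition polydisc (R : realType) (n : nat) (a : 'I_n -> R[i]) (r : R)
    (z : 'I_n -> R[i]) : Prop :=
  forall i, `|z i - a i| < r%:C.

Definition analytic_at (R : realType) (n : nat) (F : ('I_n -> R[i]) -> R[i])
    (a : 'I_n -> R[i]) : Prop :=
  exists (r : R) (c : {ffun 'I_n -> nat} -> R[i]), 0 < r /\
    forall z, polydisc a r z ->
      has_sum (fun k : {ffun 'I_n -> nat} =>
                 c k * \prod_(i < n) (z i - a i) ^+ k i) (F z).

(* A meromorphic function is represented by a total function that is locally a
   quotient of analytic functions; its values on the zeros of the denominator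
   are irrelevant. *)
Definition meromorphic (R : realType) (n : nat) (F : ('I_n -> R[i]) -> R[i]) : Prop :=
  forall a, exists (r : R) (f h : ('I_n -> R[i]) -> R[i]),
    [/\ 0 < r,
        forall z, polydisc a r z -> analytic_at f z /\ analytic_at h z,
        exists2 z, polydisc a r z & h z != 0 &
        forall z, polydisc a r z -> h z != 0 -> F z = f z / h z].

Definition analytic1_at (R : realType) (F : R[i] -> R[i]) (a : R[i]) : Prop :=
  analytic_at (fun z : 'I_1 -> R[i] => F (z ord0)) (fun=> a).

Definition meromorphic1 (R : realType) (F : R[i] -> R[i]) : Prop :=
  meromorphic (fun z : 'I_1 -> R[i] => F (z ord0)).

(* [twisted_weierstrass theta phi tau P]: P is the function
   P_1[theta; phi](-, tau), i.e. the meromorphic continuation to the whole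
   plane of the series on the annulus |q| < |e^z| < 1. *)
Definition twisted_weierstrass (R : realType) (theta phi tau : R[i])
    (P : R[i] -> R[i]) : Prop :=
  meromorphic1 P /\
  exists lam : R,
    [/\ 0 <= lam < 1,
        phi = cexp (two_pi_i R * lam%:C) &
        forall z, `|cexp (two_pi_i R * tau)| < `|cexp z| < 1 ->
          P z = - tsum (fun m : int =>
            let x := m%:~R + lam%:C in
            cexp (x * z) / (1 - theta^-1 * cexp (two_pi_i R * tau * x)))].

Record vosa_data (R : realType) := VosaData {
  vosa_space :> lmodType R[i];
  sector : bool -> vosa_space -> Prop; (* even part (false), odd part (true) *)
  vmode : vosa_space -> int -> vosa_space -> vosa_space;
    (* Y(a,z) b is the sum over n of vmode a n b z^(-n-1) *)
  vac : vosa_space;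
  conf : vosa_space;
  ccharge : R[i]
}.
Arguments sector {R} V : rename.
Arguments vmode {R} V : rename.
Arguments vac {R} V : rename.
Arguments conf {R} V : rename.
Arguments ccharge {R} V : rename.

Definition Lmode (R : realType) (V : vosa_data R) (n : int) (v : V) : V :=
  vmode V (conf V) (n + 1) v.

Definition binz (R : realType) (x : int) (j : nat) : R[i] :=
  (\prod_(i < j) (x%:~R - i%:R)) / j`!%:R.

Record is_vosa (R : realType) (V : vosa_data R) : Prop := IsVosa {
  sector_linear : forall s (k : R[i]) (u v : V),
    sector V s u -> sector V s v -> sector V s (k *: u + v);
  sector_span : forall v : V, exists u w : V,
    [/\ sector V false u, sector V true w & v = u + w];
  sector_direct : forall v : V, sector V false v -> sector V true v -> v = 0;
  vmode_linearl : forall (k : R[i]) (a b : V) n (u : V),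
    vmode V (k *: a + b) n u = k *: vmode V a n u + vmode V b n u;
  vmode_linearr : forall (a : V) n (k : R[i]) (u v : V),
    vmode V a n (k *: u + v) = k *: vmode V a n u + vmode V a n v;
  vmode_sector : forall s t (a b : V) n,
    sector V s a -> sector V t b -> sector V (s (+) t) (vmode V a n b);
  vmode_trunc : forall a b : V, exists N : int, forall n, N <= n -> vmode V a n b = 0;
  vac_even : sector V false (vac V);
  vac_mode : forall n (v : V), vmode V (vac V) n v = (n == -1)%:R *: v;
  creation : forall a : V, vmode V a (-1) (vac V) = a;
  creation_ge0 : forall (a : V) n, 0 <= n -> vmode V a n (vac V) = 0;
  (* the Jacobi identity in components; both sums have finitely many nonzero
     terms, hence the bound N *)
  borcherds : forall s t (a b u : V) (l m n : int),
    sector V s a -> sector V t b ->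
    exists N : nat, forall M : nat, (N <= M)%N ->
      \sum_(j < M) binz R m j *: vmode V (vmode V a (l + j%:Z) b) (m + n - j%:Z) u
      = \sum_(j < M) ((-1) ^+ j * binz R l j) *:
          (vmode V a (l + m - j%:Z) (vmode V b (n + j%:Z) u)
           - ((-1) ^+ (s && t) * (-1) ^ l) *:
               vmode V b (l + n - j%:Z) (vmode V a (m + j%:Z) u));
  conf_even : sector V false (conf V);
  virasoro : forall (m n : int) (v : V),
    Lmode m (Lmode n v) - Lmode n (Lmode m v)
    = (m - n)%:~R *: Lmode (m + n) v
      + ((m + n == 0)%:R * (m%:~R ^+ 3 - m%:~R) / 12%:R * ccharge V) *: v;
  translation : forall (a : V) n (u : V),
    vmode V (Lmode (-1) a) n u = (- n%:~R) *: vmode V a (n - 1) u;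
  weight_span : forall s (v : V), sector V s v ->
    exists (d : nat) (w : 'I_d -> V) (r : 'I_d -> R),
      v = \sum_(i < d) w i
      /\ forall i, sector V s (w i) /\ Lmode 0 (w i) = (r i)%:C *: w i;
  weight_bounded : exists r0 : R, forall (r : R) (v : V),
    r < r0 -> Lmode 0 v = r%:C *: v -> v = 0;
  weight_findim : forall r : R, exists (d : nat) (w : 'I_d -> V),
    forall v : V, Lmode 0 v = r%:C *: v ->
      exists x : 'I_d -> R[i], v = \sum_(i < d) x i *: w i
}.

Record hbasis (R : realType) (V : vosa_data R) (I : choiceType) := HBasis {
  bvec : I -> V;
  coord : I -> V -> R[i];
  bpar : I -> bool;
  bwt : I -> R;
  coord_linear : forall i (k : R[i]) (u v : V),
    coord i (k *: u + v) = k * coord i u + coord i v;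
  coord_bvec : forall i j, coord i (bvec j) = (i == j)%:R;
  coord_span : forall v, exists A : {fset I}, v = \sum_(i <- A) coord i v *: bvec i;
  bparP : forall i, sector V (bpar i) (bvec i);
  bwtP : forall i, Lmode 0 (bvec i) = (bwt i)%:C *: bvec i
}.

Definition parity_automorphism (R : realType) (V : vosa_data R)
    (g : {linear V -> V}) : Prop :=
  forall s (v : V), sector V s v -> g v = (-1) ^+ s *: v.

Section Traces.
Variables (R : realType) (V : vosa_data R) (I : choiceType) (B : hbasis V I).

(* exp (z L(0)) *)
Definition expL0 (z : R[i]) (v : V) : V :=
  (\sum_(i \in @setT I)
     (cexp (z * (bwt B i)%:C) * coord B i v) *: bvec B i)%R.

(* Supertrace of the operator whose diagonal matrix entries in the basis B are
   given by d. *)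
Definition STr (d : I -> R[i]) : R[i] :=
  tsum (fun i => (-1) ^+ bpar B i * d i).

(* q^(L(0) - c/24) acts on the i-th basis vector by this scalar *)
Definition qL0 (tau : R[i]) (i : I) : R[i] :=
  cexp (two_pi_i R * tau * ((bwt B i)%:C - ccharge V / 24%:R)).

(* The coefficient of the i-th basis vector in
   g Y(q_1^L(0) v_1, q_1) ... Y(q_n^L(0) v_n, q_n) applied to that same basis
   vector: the sum over all choices of one mode k_j in each vertex operator, the
   mode k_j coming with q_j^(-k_j-1). *)
Definition vertex_entry (g : V -> V) (n : nat) (v : 'I_n -> V) (z : 'I_n -> R[i])
    (i : I) : R[i] :=
  tsum (fun k : {ffun 'I_n -> int} =>
    (\prod_(j < n) cexp ((- k j - 1)%:~R * z j))
    * coord B i (g (foldr (fun j w => vmode V (expL0 (z j) (v j)) (k j) w)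
                          (bvec B i) (enum 'I_n)))).

Definition F_V (g : V -> V) (n : nat) (v : 'I_n -> V) (z : 'I_n -> R[i])
    (tau : R[i]) : R[i] :=
  STr (fun i => vertex_entry g v z i * qL0 tau i).

Definition Z_V (g : V -> V) (tau : R[i]) : R[i] :=
  STr (fun i => coord B i (g (bvec B i)) * qL0 tau i).

(* |q_1| > ... > |q_n| > |q q_1|, where q_j = e^(z_j). *)
Definition trace_domain (n : nat) (tau : R[i]) (z : 'I_n -> R[i]) : Prop :=
  (forall i j : 'I_n, (i < j)%N -> `|cexp (z j)| < `|cexp (z i)|) /\
  (forall i j : 'I_n, i = 0%N :> nat -> j = n.-1 :> nat ->
     `|cexp (two_pi_i R * tau) * cexp (z i)| < `|cexp (z j)|).

(* G is the meromorphic continuation to C^n of the trace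
   F_V(g; (psi,z_1), ..., (psi,z_n); tau). *)
Definition is_G (g : V -> V) (psi : V) (n : nat) (tau : R[i])
    (G : ('I_n -> R[i]) -> R[i]) : Prop :=
  meromorphic G /\
  forall z, trace_domain tau z -> G z = F_V g (fun=> psi) z tau.

End Traces.

(* Strictly increasing sequences 1 <= k_1 < ... < k_m. *)
Definition fock_index : choiceType := {s : seq nat | path ltn 0%N s}.

Record rank_one_fermion (R : realType) (V : vosa_data R) (psi : V)
    (B : hbasis V fock_index) : Prop := RankOneFermion {
  psi_odd : sector V true psi;
  psi_anticomm : forall (m n : int) (v : V),
    vmode V psi m (vmode V psi n v) + vmode V psi n (vmode V psi m v)
    = (m + n + 1 == 0)%:R *: v;
  psi_vac : forall k : int, 0 <= k -> vmode V psi k (vac V) = 0;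
  psi_basis : forall s : fock_index,
    bvec B s = foldr (fun k w => vmode V psi (- k%:Z) w) (vac V) (val s);
  conf_psi : conf V = 2^-1 *: vmode V psi (-2) (vmode V psi (-1) (vac V));
  ccharge_psi : ccharge V = 2^-1
}.

(* A partition of the indices into pairs {i_k, j_k}, i_k < j_k, i_1 < ... < i_m,
   is encoded by the permutation whose successive values are
   i_1, j_1, ..., i_m, j_m (positions are numbered from 0). *)
Definition pairing (n : nat) (s : 'S_n) : bool :=
  [forall i : 'I_n, forall j : 'I_n,
     (~~ odd i && ((j == i.+1 :> nat) || (j == i.+2 :> nat))) ==> (s i < s j)%N].

Definition pfaffian (R : realType) (n : nat) (M : 'M[R[i]]_n) : R[i] :=
  \sum_(s : 'S_n | pairing s) (-1) ^+ s *
    \prod_(p : 'I_n * 'I_n | ~~ odd p.1 && (p.2 == p.1.+1 :> nat)) M (s p.1) (s p.2).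

Definition PP (R : realType) (n : nat) (P1 : R[i] -> R[i]) (z : 'I_n -> R[i]) : 'M[R[i]]_n :=
  \matrix_(i < n, j < n) if i == j then 0 else P1 (z i - z j).

(* Main.v *)
(* Trace cyclicity together with the anticommutators of the modes of [psi] gives a
   recursion for the (super)trace of [psi(k_1) ... psi(k_n) q^L(0)]: moving [psi(k_1)]
   around the trace costs [- theta q^(k_1 + 1/2)], and moving it through the other modes
   produces the contractions [k_1 + k_j + 1 = 0].  This is the expansion of a Pfaffian
   along its first row, with entries whose generating series is that of [P_1].  All sums
   are rearranged with the help of one estimate: a matrix entry of a word is labelled by
   the states [s_1, ..., s_n] through which it passes, and on the domain of the trace the
   corresponding term is at most a product of [r_j ^ wt(s_j)] with [r_j < 1].

   The series only give [P_1] on the strip [-2 pi Im(tau) < Re z < 0].  Multiplied by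
   [e^(z/2) - e^(-z/2)] they continue to an even function across [Re z = 0], whence [P_1]
   is odd.  The identity theorem for meromorphic functions of several variables, proved
   along real segments, then extends the Pfaffian formula from the domain of the trace to
   every point at which both sides are analytic. *)
Require Import Defs.
From HB Require Import structures.
From mathcomp Require Import all_boot all_order all_fingroup all_algebra.
From mathcomp Require Import complex reals.
From mathcomp Require Import finmap boolp classical_sets fsbigop.
From mathcomp Require Import topology normedtype sequences exp trigo.
From mathcomp Require Import ring lra zify.
Set Implicit Arguments.
Unset Strict Implicit.
Unset Printing Implicit Defensive.
Import Order.TTheory GRing.Theory Num.Theory.
Import numFieldNormedType.Exports.
Local Open Scope ring_scope.
Local Open Scope complex_scope.

(** * Unconditional summation *)

(** Sums are unconditional, and their order is the first obstacle: the trace sums over states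
    outside and modes inside, whereas the recursion produces, for each choice of modes, a sum over
    states. Joint summability over pairs of a state and a mode sequence links the two. On the trace
    domain the series of [P_1] converges at [z_j - z_i] for [i < j], never at [z_i - z_j]. The
    recursion therefore yields entries [- P1 (z_j - z_i)], and oddness is needed to reach the stated
    matrix; it cannot be seen termwise, because the series never converges at both [w] and [- w]. A
    meromorphic function is arbitrary on the zeros of its local denominators. What is propagated is
    vanishing off the zeros of some denominator, and a value is recovered only at a point of
    analyticity. The supertrace sign and [g] together act on a state with [m] parts as
    [(- theta)^m], so both cases are treated at once. *)

Notation nc := (@Normc.normc _).

Section Modulus.
Variable R : realType.
Local Notation C := R[i].
Implicit Types x y z : C.

Lemma norm_nc x : `|x| = (nc x)%:C. Proof. by []. Qed.

Lemma nc_ge0 x : 0 <= nc x.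
Proof. by case: x => a b /=; exact: sqrtr_ge0. Qed.

Lemma ncM x y : nc (x * y) = nc x * nc y. Proof. exact: Normc.normcM. Qed.
Lemma ncN x : nc (- x) = nc x. Proof. exact: normcN. Qed.
Lemma ncV x : nc x^-1 = (nc x)^-1. Proof. exact: Normc.normcV. Qed.
Lemma nc0 : nc (0 : C) = 0. Proof. exact: Normc.normc0. Qed.
Lemma nc1 : nc (1 : C) = 1. Proof. exact: Normc.normc1. Qed.
Lemma ncD x y : nc (x + y) <= nc x + nc y. Proof. exact: le_normcD. Qed.
Lemma ncB x y : nc (x - y) <= nc x + nc y.
Proof. by rewrite -[in leRHS](ncN y); exact: ncD. Qed.
Lemma ncBC x y : nc (x - y) = nc (y - x).
Proof. by rewrite -ncN opprB. Qed.
Lemma nc_eq0 x : (nc x == 0) = (x == 0).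
Proof.
apply/eqP/eqP => [|->]; [exact: Normc.eq0_normc | exact: nc0].
Qed.
Lemma nc_gt0 x : (0 < nc x) = (x != 0).
Proof. by rewrite lt0r nc_ge0 andbT nc_eq0. Qed.
Lemma ncX x n : nc (x ^+ n) = nc x ^+ n.
Proof. by elim: n => [|n IH]; rewrite ?expr0 ?nc1 // !exprS ncM IH. Qed.
Lemma nc_real (a : R) : nc a%:C = `|a|.
Proof. by rewrite /= expr0n addr0 sqrtr_sqr. Qed.
Lemma nc_nat n : nc (n%:R : C) = n%:R.
Proof. by rewrite -(rmorph_nat (real_complex R)) nc_real ger0_norm. Qed.
Lemma nc_sum (I : Type) (s : seq I) (P : pred I) (f : I -> C) :
  nc (\sum_(i <- s | P i) f i) <= \sum_(i <- s | P i) nc (f i).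
Proof.
elim/big_rec2: _ => [|i x y _ h]; first by rewrite nc0.
by apply: (le_trans (ncD _ _)); rewrite lerD2l.
Qed.
Lemma nc_prod (I : Type) (s : seq I) (P : pred I) (f : I -> C) :
  nc (\prod_(i <- s | P i) f i) = \prod_(i <- s | P i) nc (f i).
Proof. by elim/big_rec2: _ => [|i x y _ h]; rewrite ?nc1 // ncM h. Qed.
Lemma ncR_le x : `|complex.Re x| <= nc x.
Proof. by have := normc_ge_Re x; rewrite norm_nc lecR. Qed.
Lemma ncI_le x : `|complex.Im x| <= nc x.
Proof.
case: x => a b /=; rewrite -sqrtr_sqr ler_sqrt ?lerDr ?sqr_ge0 //.
by rewrite addr_ge0 ?sqr_ge0.
Qed.
Lemma nc_le_RI x : nc x <= `|complex.Re x| + `|complex.Im x|.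
Proof.
rewrite {1}[x]complexE; apply: (le_trans (ncD _ _)).
by rewrite ncM !nc_real /= expr0n expr1n add0r sqrtr1 mul1r.
Qed.
Lemma nc_triangle x y z : nc (x - z) <= nc (x - y) + nc (y - z).
Proof. by rewrite (_ : x - z = (x - y) + (y - z)) ?ncD // addrA subrK. Qed.
End Modulus.

Section Sums.
Variable R : realType.
Local Notation C := R[i].

(* For nonnegative [f], which is the only case in use, this is summability. *)
Definition bsums (I : choiceType) (f : I -> R) : Prop :=
  exists M, forall A : {fset I}, \sum_(i <- A) f i <= M.

Lemma ler_sum_uniq (I : eqType) (f : I -> R) (s t : seq I) :
  (forall i, 0 <= f i) -> uniq s -> uniq t -> {subset s <= t} ->
  \sum_(i <- s) f i <= \sum_(i <- t) f i.
Proof.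
move=> f0 us ut st.
have pt : perm_eq t (s ++ [seq x <- t | x \notin s]).
  apply: uniq_perm => //.
    rewrite cat_uniq us filter_uniq // andbT; apply/hasPn => x.
    by rewrite mem_filter => /andP[].
  move=> x; rewrite mem_cat mem_filter /=.
  by case: (boolP (x \in s)) => //= /st.
by rewrite (perm_big _ pt) big_cat /= lerDl sumr_ge0.
Qed.

Lemma in_fset_of_seq (I : choiceType) (s : seq I) x :
  (x \in [fset y in s]%fset) = (x \in s).
Proof. by rewrite inE. Qed.

Lemma sum_fset_seq (T : nmodType) (I : choiceType) (f : I -> T) (s : seq I) :
  uniq s -> \sum_(i <- [fset x in s]%fset) f i = \sum_(i <- s) f i.
Proof.
move=> us; apply: perm_big; apply: uniq_perm; rewrite ?fset_uniq //.
by move=> x; rewrite inE.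
Qed.

Lemma bsums_le (I : choiceType) (f g : I -> R) :
  (forall i, f i <= g i) -> bsums g -> bsums f.
Proof.
by move=> fg [M gM]; exists M => A; apply: le_trans (gM A); apply: ler_sum.
Qed.

Lemma bsumsZ (I : choiceType) (f : I -> R) (k : R) :
  0 <= k -> bsums f -> bsums (fun i => k * f i).
Proof.
by move=> k0 [M gM]; exists (k * M) => A; rewrite -mulr_sumr ler_wpM2l.
Qed.

Lemma bsumsD (I : choiceType) (f g : I -> R) :
  bsums f -> bsums g -> bsums (fun i => f i + g i).
Proof.
by move=> [M fM] [N gN]; exists (M + N) => A; rewrite big_split /= lerD.
Qed.

(** Injectivity and the bound are required only where [f] is positive, so vanishing terms need no
    label; this reduces summability over mode sequences to summability over paths of states. *)
Lemma bsums_inj (I J : choiceType) (f : I -> R) (g : J -> R) (h : I -> J) :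
  (forall j, 0 <= g j) ->
  {in [pred i | 0 < f i] &, injective h} ->
  (forall i, 0 < f i -> f i <= g (h i)) -> bsums g -> bsums f.
Proof.
move=> g0 hI fg [M gM]; exists M => A.
pose s := [seq i <- A | 0 < f i].
have us : uniq [seq h i | i <- s].
  rewrite map_inj_in_uniq ?filter_uniq ?fset_uniq // => x y.
  rewrite !mem_filter => /andP[fx _] /andP[fy _]; exact: hI.
rewrite (bigID (fun i => 0 < f i)) /= -[leRHS]addr0; apply: lerD; last first.
  by apply: sumr_le0 => i; rewrite -leNgt.
rewrite -big_filter -/s.
apply: le_trans (gM [fset x in [seq h i | i <- s]]%fset).
rewrite sum_fset_seq // big_map big_seq [leRHS]big_seq.
by apply: ler_sum => i; rewrite mem_filter => /andP[/fg].
Qed.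

Lemma bsums_dep (I J : choiceType) (f : I * J -> R) (g : I -> R) :
  (forall p, 0 <= f p) ->
  (forall i (B : {fset J}), \sum_(j <- B) f (i, j) <= g i) -> bsums g -> bsums f.
Proof.
move=> f0 fg [M gM]; exists M => A.
pose A1 : {fset I} := [fset p.1 | p in A]%fset.
pose A2 : {fset J} := [fset p.2 | p in A]%fset.
apply: le_trans (gM A1).
apply: (@le_trans _ _ (\sum_(p <- [seq (i, j) | i <- A1, j <- A2]) f p)).
  apply: ler_sum_uniq; rewrite ?fset_uniq //.
  - by apply: allpairs_uniq; rewrite ?fset_uniq // => -[? ?] [? ?].
  - move=> [i j] pA; apply/allpairsP; exists (i, j); split => //=.
      by apply/imfsetP; exists (i, j).
    by apply/imfsetP; exists (i, j).
by rewrite big_allpairs_dep /=; apply: ler_sum.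
Qed.

Lemma bsums_prod (I J : choiceType) (f : I -> R) (g : J -> R) :
  (forall i, 0 <= f i) -> (forall j, 0 <= g j) -> bsums f -> bsums g ->
  bsums (fun p : I * J => f p.1 * g p.2).
Proof.
move=> f0 g0 [M fM] [N gN].
apply: (@bsums_dep _ _ _ (fun i => f i * N)) => [p|i A|]; first by rewrite mulr_ge0.
  by rewrite /= -mulr_sumr ler_wpM2l.
exists (M * N) => A; rewrite -mulr_suml ler_wpM2r //.
by have := gN fset0; rewrite big_seq_fset0.
Qed.

Lemma sum_le_support (I : choiceType) (f : I -> R) (A B : {fset I}) :
  (forall i, 0 <= f i) -> (forall i, i \notin A -> f i = 0) ->
  \sum_(i <- B) f i <= \sum_(i <- A) f i.
Proof.
move=> f0 fA; rewrite (bigID (mem A)) /= [X in _ + X]big1; last by move=> i; exact: fA.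
rewrite addr0 -big_filter ler_sum_uniq ?filter_uniq ?fset_uniq //.
by move=> x; rewrite mem_filter => /andP[].
Qed.

Lemma has_sumP (I : choiceType) (f : I -> C) (s : C) :
  has_sum f s <-> forall eps : R, 0 < eps -> exists A : {fset I},
    forall B : {fset I}, fsubset A B -> nc (\sum_(i <- B) f i - s) < eps.
Proof.
by split=> h eps e0; have [A hA] := h eps e0; exists A => B /hA;
  rewrite norm_nc ltcR.
Qed.

Lemma le_eps (x : R) : (forall e, 0 < e -> x <= e) -> x <= 0.
Proof.
move=> h; rewrite leNgt; apply/negP => x0.
by have := h (x / 2) (divr_gt0 x0 (ltr0Sn _ _)); lra.
Qed.

Lemma has_sum_uniq (I : choiceType) (f : I -> C) (s t : C) :
  has_sum f s -> has_sum f t -> s = t.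
Proof.
move=> /has_sumP hs /has_sumP ht; apply/eqP; rewrite -subr_eq0 -nc_eq0.
rewrite eq_le nc_ge0 andbT; apply: le_eps => e e0.
have e2 : 0 < e / 2 by lra.
have [A hA] := hs _ e2; have [B hB] := ht _ e2.
have := hA (A `|` B)%fset (fsubsetUl _ _).
have := hB (A `|` B)%fset (fsubsetUr _ _).
set x := \sum_(i <- _) _ => h1 h2.
by have := nc_triangle s x t; rewrite (ncBC s x); lra.
Qed.

Lemma tsum_eq (I : choiceType) (f : I -> C) (s : C) :
  has_sum f s -> tsum f = s.
Proof. by move=> fs; apply: xget_unique => // t ft; apply: (has_sum_uniq ft fs). Qed.

Lemma has_sum_ext (I : choiceType) (f g : I -> C) (s : C) :
  (forall i, f i = g i) -> has_sum f s -> has_sum g s.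
Proof. by move=> /funext ->. Qed.

Lemma has_sumD (I : choiceType) (f g : I -> C) (s t : C) :
  has_sum f s -> has_sum g t -> has_sum (fun i => f i + g i) (s + t).
Proof.
move=> /has_sumP hs /has_sumP ht; apply/has_sumP => e e0.
have e2 : 0 < e / 2 by lra.
have [A hA] := hs _ e2; have [B hB] := ht _ e2.
exists (A `|` B)%fset => D ABD.
have := hA D (fsubset_trans (fsubsetUl _ _) ABD).
have := hB D (fsubset_trans (fsubsetUr _ _) ABD).
rewrite big_split /= => h1 h2.
rewrite (_ : _ - _ = (\sum_(i <- D) f i - s) + (\sum_(i <- D) g i - t)); last by ring.
by apply: (le_lt_trans (ncD _ _)); lra.
Qed.

Lemma has_sumZ (I : choiceType) (f : I -> C) (s k : C) :
  has_sum f s -> has_sum (fun i => k * f i) (k * s).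
Proof.
move=> /has_sumP hs; apply/has_sumP => e e0.
have k0 : 0 < nc k + 1 by rewrite ltr_wpDl ?nc_ge0.
have [A hA] := hs (e / (nc k + 1)) (divr_gt0 e0 k0).
exists A => B /hA h; rewrite -mulr_sumr -mulrBr ncM.
apply: (@le_lt_trans _ _ ((nc k + 1) * nc (\sum_(i <- B) f i - s))).
  by rewrite ler_wpM2r ?nc_ge0 // lerDl.
by rewrite mulrC -ltr_pdivlMr.
Qed.

Lemma has_sumN (I : choiceType) (f : I -> C) (s : C) :
  has_sum f s -> has_sum (fun i => - f i) (- s).
Proof.
move=> h; rewrite -mulN1r; apply: has_sum_ext (has_sumZ (-1) h) => i.
by rewrite mulN1r.
Qed.

Lemma has_sum0 (I : choiceType) : has_sum (fun _ : I => 0 : C) 0.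
Proof.
apply/has_sumP => e e0; exists fset0 => B _.
by rewrite big1 // subr0 nc0.
Qed.

Lemma has_sum_sum (I : choiceType) (J : Type) (r : seq J) (P : pred J)
    (f : J -> I -> C) (s : J -> C) :
  (forall j, P j -> has_sum (f j) (s j)) ->
  has_sum (fun i => \sum_(j <- r | P j) f j i) (\sum_(j <- r | P j) s j).
Proof.
move=> h; elim: r => [|j r IH].
  by rewrite big_nil; apply: has_sum_ext (has_sum0 I) => i; rewrite big_nil.
rewrite big_cons; case: ifP => Pj.
  by apply: has_sum_ext (has_sumD (h j Pj) IH) => i; rewrite big_cons Pj.
by apply: has_sum_ext IH => i; rewrite big_cons Pj.
Qed.

Lemma has_sum_fin (I : choiceType) (f : I -> C) (A : {fset I}) :
  (forall i, i \notin A -> f i = 0) -> has_sum f (\sum_(i <- A) f i).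
Proof.
move=> fA; apply/has_sumP => e e0; exists A => B AB.
by rewrite -(big_fset_incl _ AB) ?subrr ?nc0 // => x _; exact: fA.
Qed.

(** Finite sums over sets containing some [A] stay within 1 of [s], and enlarging [D] by [A] changes
    the sum by terms of [A] only, so all finite sums are bounded by one [M]. Applied to the indices
    where the real or imaginary part has a fixed sign, this bounds the sums of absolute values. *)
Lemma has_sum_bsums (I : choiceType) (f : I -> C) (s : C) :
  has_sum f s -> bsums (fun i => nc (f i)).
Proof.
move=> /has_sumP /(_ 1 ltr01) [A hA].
pose M := nc s + 1 + \sum_(i <- A) nc (f i).
have hM (D : {fset I}) : nc (\sum_(i <- D) f i) <= M.
  have e1 : \sum_(i <- D) f i =
      \sum_(i <- (A `|` D)%fset) f i - \sum_(i <- (A `\` D)%fset) f i.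
    apply/eqP; rewrite -subr_eq opprK; apply/eqP.
    rewrite [RHS](big_fsetID _ (mem D)) /=; congr (_ + _).
      by apply: eq_fbigl => x; rewrite !inE /= andb_orl andbb;
         case: (x \in D); rewrite ?orbT ?andbF.
    by apply: eq_fbigl => x; rewrite !inE /=; case: (x \in D);
      rewrite ?orbF ?andbT ?andbF.
  rewrite e1; apply: (le_trans (ncB _ _)); rewrite /M; apply: lerD.
    have := hA (A `|` D)%fset (fsubsetUl _ _); set x := \sum_(i <- _) _ => h.
    have := ncD (x - s) s; rewrite subrK => h'; lra.
  apply: (le_trans (nc_sum _ _ _)); apply: ler_sum_uniq; rewrite ?fset_uniq //.
    by move=> i; exact: nc_ge0.
  by move=> x; rewrite !inE => /andP[].
have part (r : C -> R) : (forall x, `|r x| <= nc x) -> additive r ->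
    forall D : {fset I}, \sum_(i <- D) `|r (f i)| <= 2 * M.
  move=> rnc rB D.
  have r0 : r 0 = 0 by rewrite -[X in r X](subrr 0) rB subrr.
  have rD x y : r (x + y) = r x + r y.
    by rewrite -{1}[y]opprK rB -[in r (- y)]sub0r rB r0 sub0r opprK.
  have rsum (E : {fset I}) : \sum_(i <- E) r (f i) <= M /\ - M <= \sum_(i <- E) r (f i).
    have : `|r (\sum_(i <- E) f i)| <= M by apply: le_trans (rnc _) (hM E).
    by rewrite (big_morph r rD r0) ler_norml => /andP[].
  rewrite (big_fsetID _ (fun i => 0 <= r (f i))) /=.
  have [h1 _] := rsum [fset x in D | 0 <= r (f x)]%fset.
  have [_ h2] := rsum [fset x in D | ~~ (0 <= r (f x))]%fset.
  rewrite (_ : 2 * M = M + M); last by ring.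
  apply: lerD.
    apply: le_trans h1; rewrite big_seq [leRHS]big_seq; apply: ler_sum => i.
    by rewrite !inE /= => /andP[_ ri]; rewrite ger0_norm.
  rewrite lerNl in h2; apply: le_trans h2; rewrite -sumrN.
  rewrite big_seq [leRHS]big_seq; apply: ler_sum => i.
  by rewrite !inE /= -ltNge => /andP[_ ri]; rewrite ltr0_norm.
exists (2 * M + 2 * M) => D.
apply: (@le_trans _ _ (\sum_(i <- D) (`|complex.Re (f i)| + `|complex.Im (f i)|))).
  by apply: ler_sum => i _; exact: nc_le_RI.
rewrite big_split /=; apply: lerD; apply: part.
- exact: ncR_le.
- by move=> [a b] [c d].
- exact: ncI_le.
- by move=> [a b] [c d].
Qed.

Lemma has_sum_nonneg (I : choiceType) (f : I -> R) :
  (forall i, 0 <= f i) -> bsums f -> exists s : R, has_sum (fun i => (f i)%:C) s%:C.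
Proof.
move=> f0 [M fM].
pose S := [set x | exists A : {fset I}, x = \sum_(i <- A) f i]%classic.
have supS : has_sup S.
  split; first by exists 0, fset0; rewrite big_seq_fset0.
  by exists M => _ [A ->].
exists (sup S); apply/has_sumP => e e0.
have [_ [A ->] hA] := sup_adherent e0 supS.
exists A => B AB; rewrite -rmorph_sum -rmorphB nc_real.
have hB : \sum_(i <- B) f i <= sup S by apply: sup_upper_bound => //; exists B.
have hAB : \sum_(i <- A) f i <= \sum_(i <- B) f i.
  by apply: ler_sum_uniq; rewrite ?fset_uniq //; exact/fsubsetP.
rewrite ler0_norm; lra.
Qed.

(** A real family [r] is the difference of [|r| + r] and [|r|], both nonnegative and summable, and
    this is applied to the real and the imaginary part. *)
Lemma bsums_has_sum (I : choiceType) (f : I -> C) :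
  bsums (fun i => nc (f i)) -> exists s, has_sum f s.
Proof.
move=> hf.
have part (r : C -> R) : (forall x, `|r x| <= nc x) ->
    exists s : C, has_sum (fun i => (r (f i))%:C) s.
  move=> rnc.
  have [| |s1 h1] := @has_sum_nonneg I (fun i => `|r (f i)| + r (f i)).
  - by move=> i; have := ler_norm (- r (f i)); rewrite normrN; lra.
  - apply: bsums_le (bsumsD hf hf) => i; apply: lerD => //.
    exact: le_trans (ler_norm _) (rnc _).
  have [| |s2 h2] := @has_sum_nonneg I (fun i => `|r (f i)|).
  - by move=> i; exact: normr_ge0.
  - by apply: bsums_le hf.
  exists (s1%:C - s2%:C); apply: has_sum_ext (has_sumD h1 (has_sumN h2)) => i.
  by rewrite rmorphD /= addrC addKr.
have [s1 h1] := part _ (@ncR_le R); have [s2 h2] := part _ (@ncI_le R).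
exists (s1 + 'i%C * s2); apply: has_sum_ext (has_sumD h1 (has_sumZ _ h2)) => i.
by rewrite -complexE.
Qed.

Lemma has_sum_inj (I J : choiceType) (h : I -> J) (f : J -> C) (s : C) :
  injective h -> (forall j, f j != 0 -> exists i, j = h i) ->
  has_sum f s <-> has_sum (fun i => f (h i)) s.
Proof.
move=> hI hf.
have key (D : {fset I}) :
    \sum_(j <- [fset h i | i in D]%fset) f j = \sum_(i <- D) f (h i).
  by rewrite big_imfset //= => x y _ _; exact: hI.
have pre (A : {fset J}) : exists D : {fset I}, forall i, (i \in D) = (h i \in A).
  have hch (j : J) : exists D : {fset I}, forall i, (i \in D) = (h i == j).
    have [[i ->]|hn] := pselect (exists i, j = h i).
      by exists [fset i]%fset => k; rewrite inE (inj_eq hI).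
    exists fset0 => k; rewrite inE; apply/esym/eqP => e; apply: hn.
    by exists k.
  have [D hD] := choice hch.
  exists (\bigcup_(j <- A) D j)%fset => i; apply/bigfcupP/idP.
    by move=> [j /andP[jA _]]; rewrite hD => /eqP ->.
  by move=> hA; exists (h i); rewrite ?hA // hD.
split=> /has_sumP hs; apply/has_sumP => e e0.
  have [A hA] := hs e e0; have [D hD] := pre A; exists D => E DE.
  rewrite -key (big_fset_incl _ (fsubsetUl [fset h i | i in E]%fset A)).
    by apply: hA; exact: fsubsetUr.
  move=> j; rewrite inE => /orP[-> //|jA nj]; apply/eqP; apply: contraNT nj => fj.
  have [i ji] := hf j fj; subst j; apply/imfsetP; exists i => //.
  by apply: (fsubsetP DE); rewrite hD.
have [A hA] := hs e e0; exists [fset h i | i in A]%fset => B AB.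
have [D hD] := pre B.
have -> : \sum_(j <- B) f j = \sum_(i <- D) f (h i).
  rewrite -key; apply/esym; apply: big_fset_incl.
    by apply/fsubsetP => j /imfsetP[i /= iD ->]; rewrite -hD.
  move=> j jB nj; apply/eqP; apply: contraNT nj => fj.
  have [i ji] := hf j fj; subst j; apply/imfsetP; exists i => //.
  by rewrite hD.
apply: hA; apply/fsubsetP => i iA; rewrite hD; apply: (fsubsetP AB).
by apply/imfsetP; exists i.
Qed.

Lemma has_sum_pull (I J : choiceType) (h : I -> J) (f : J -> C) (s : C) :
  injective h -> (forall j, f j != 0 -> exists i, j = h i) ->
  has_sum f s -> has_sum (fun i => f (h i)) s.
Proof. by move=> hI hf; case: (has_sum_inj s hI hf). Qed.

Lemma has_sum_push (I J : choiceType) (h : I -> J) (f : J -> C) (s : C) :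
  injective h -> (forall j, f j != 0 -> exists i, j = h i) ->
  has_sum (fun i => f (h i)) s -> has_sum f s.
Proof. by move=> hI hf; case: (has_sum_inj s hI hf). Qed.

(** Regrouping along the fibres of [p]. The fibre sums are only asserted to exist and are identified
    afterwards by uniqueness of sums; Fubini, the Cauchy product and the grouping of multi-indices
    by degree all come from here. *)
Lemma has_sum_fibre (I J : choiceType) (p : I -> J) (f : I -> C) (s : C) :
  has_sum f s ->
  exists g : J -> C,
    (forall j, has_sum (fun i => if p i == j then f i else 0) (g j)) /\ has_sum g s.
Proof.
move=> fs; have bf := has_sum_bsums fs.
have /choice[g hg] j : exists t, has_sum (fun i => if p i == j then f i else 0) t.
  by apply: bsums_has_sum; apply: bsums_le bf => i; case: ifP; rewrite ?nc0 ?nc_ge0.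
exists g; split => //; apply/has_sumP => e e0; move/has_sumP: fs => fs.
have e2 : 0 < e / 2 by lra.
have [A hA] := fs _ e2; exists [fset p i | i in A]%fset => B AB.
have hB : has_sum (fun i => if p i \in B then f i else 0) (\sum_(j <- B) g j).
  apply: has_sum_ext (@has_sum_sum _ _ B xpredT _ _ (fun j _ => hg j)) => i.
  case: ifP => pB.
    by rewrite (big_fsetD1 _ pB) /= eqxx big1_fset ?addr0 // => j;
       rewrite !inE => /andP[/negPf]; rewrite eq_sym => ->.
  by rewrite big_seq big1 // => j jB; case: eqP => // pj; rewrite -pj pB in jB.
move/has_sumP: hB => /(_ _ e2) [D hD].
have h2 := hD (A `|` D)%fset (fsubsetUr _ _).
rewrite -big_mkcond big_fset_condE /= in h2.
have h1 := hA [fset i in (A `|` D)%fset | p i \in B]%fset.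
set x := bigop.body _ _ _ in h1; set y := \sum_(j <- B) _.
have {}h1 : nc (x - s) < e / 2.
  apply: h1; apply/fsubsetP => i iA; rewrite !inE /= iA /=.
  by apply: (fsubsetP AB); apply/imfsetP; exists i.
by have := nc_triangle y x s; rewrite -/x -/y in h2 *; rewrite (ncBC y x); lra.
Qed.

Lemma has_sum_prod (I J : choiceType) (f : I -> C) (g : J -> C) (s t : C) :
  has_sum f s -> has_sum g t -> has_sum (fun p : I * J => f p.1 * g p.2) (s * t).
Proof.
move=> hf hg.
have : bsums (fun p : I * J => nc (f p.1 * g p.2)).
  apply: bsums_le (bsums_prod _ _ (has_sum_bsums hf) (has_sum_bsums hg)) => *;
    by rewrite ?nc_ge0 ?ncM.
move=> /bsums_has_sum [u hu].
have [v [h1 h2]] := has_sum_fibre (fun p : I * J => p.1) hu.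
have vE i : v i = f i * t.
  apply: (has_sum_uniq (h1 i)); apply: (@has_sum_push J _ (fun j => (i, j))) => /=.
  - by move=> a b [].
  - by move=> [a b] /=; case: (a =P i) => [-> _|]; [exists b | rewrite eqxx].
  - by apply: has_sum_ext (has_sumZ (f i) hg) => j; rewrite eqxx.
suff -> : s * t = u by [].
apply: has_sum_uniq h2; rewrite mulrC.
by apply: has_sum_ext (has_sumZ t hf) => i; rewrite vE mulrC.
Qed.

Lemma has_sum_fubini (I J : choiceType) (f : I * J -> C) (s : C) :
  has_sum f s -> exists g : I -> C,
    (forall i, has_sum (fun j => f (i, j)) (g i)) /\ has_sum g s.
Proof.
move=> /(has_sum_fibre (fun p : I * J => p.1)) [g [h1 h2]].
exists g; split => // i.
apply: has_sum_ext (@has_sum_pull J _ (fun j => (i, j)) _ _ _ _ (h1 i)) => [j /=||].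
- by rewrite eqxx.
- by move=> a b [].
- by move=> [a b] /=; case: (a =P i) => [-> _|]; [exists b | rewrite eqxx].
Qed.

Lemma has_sum_diag (f : nat * nat -> C) (s : C) :
  has_sum f s -> has_sum (fun k => \sum_(l < k.+1) f ((k - l)%N, val l)) s.
Proof.
move=> hf; have [g [h1 h2]] := has_sum_fibre (fun p => (p.1 + p.2)%N) hf.
apply: has_sum_ext h2 => k; apply: (has_sum_uniq (h1 k)).
pose diag := [seq ((k - l)%N, l) | l <- iota 0 k.+1].
have diagE p : (p \in diag) = (p.1 + p.2 == k)%N.
  apply/mapP/eqP => [[l]|<-].
    by rewrite mem_iota add0n ltnS => /= lk ->; rewrite subnK.
  exists p.2; first by rewrite mem_iota /= add0n ltnS leq_addl.
  by rewrite addnK -surjective_pairing.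
have diagU : uniq diag by rewrite map_inj_uniq ?iota_uniq // => l l' [].
have := @has_sum_fin _ (fun p => if (p.1 + p.2 == k)%N then f p else 0)
  [fset p in diag]%fset.
rewrite sum_fset_seq //.
have -> : \sum_(p <- diag) (if (p.1 + p.2 == k)%N then f p else 0) =
    \sum_(l < k.+1) f ((k - l)%N, val l).
  rewrite -(big_mkord xpredT (fun l => f ((k - l)%N, l))) /index_iota subn0.
  rewrite big_map big_seq [RHS]big_seq; apply: eq_bigr => l.
  by rewrite mem_iota add0n ltnS => /= lk; rewrite subnK // eqxx.
by apply => p; rewrite (in_fset_of_seq diag) diagE => /negPf ->.
Qed.

Lemma has_sum_le (I : choiceType) (f : I -> C) (g : I -> R) (s : C) (M : R) :
  has_sum f s -> (forall i, nc (f i) <= g i) ->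
  (forall A : {fset I}, \sum_(i <- A) g i <= M) -> nc s <= M.
Proof.
move=> /has_sumP hs fg gM; rewrite -subr_le0; apply: le_eps => e e0.
have [A hA] := hs e e0; have := hA A (fsubset_refl _) => h.
have : nc (\sum_(i <- A) f i) <= M.
  by apply: le_trans (nc_sum _ _ _) _; apply: le_trans (gM A); apply: ler_sum.
have := nc_triangle s (\sum_(i <- A) f i) 0; rewrite !subr0 ncBC; lra.
Qed.
End Sums.

(** * Analytic functions of several variables *)

Section Analytic.
Variable R : realType.
Local Notation C := R[i].

Lemma polydiscP n (a : 'I_n -> C) r z :
  polydisc a r z <-> forall i, nc (z i - a i) < r.
Proof. by split=> h i; have := h i; rewrite norm_nc ltcR. Qed.

Lemma polydisc_center n (a : 'I_n -> C) r : 0 < r -> polydisc a r a.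
Proof. by move=> r0; apply/polydiscP => i; rewrite subrr nc0. Qed.

Lemma polydisc_le n (a : 'I_n -> C) r s z : r <= s -> polydisc a r z -> polydisc a s z.
Proof.
by move=> rs /polydiscP h; apply/polydiscP => i; apply: lt_le_trans (h i) rs.
Qed.

Lemma fin_lt_bound n (f : 'I_n -> R) r : 0 < r -> (forall i, f i < r) ->
  exists2 s, 0 < s & forall i, f i + s <= r.
Proof.
elim: n f => [|n IH] f r0 fr; first by exists r => // -[].
have [s s0 hs] := IH (fun i => f (lift ord0 i)) r0 (fun i => fr _).
exists (Num.min s (r - f ord0)); first by rewrite lt_min s0 subr_gt0 fr.
move=> i; case: (unliftP ord0 i) => [j|] ->.
  by apply: le_trans (hs j); rewrite lerD2l ge_min lexx.
by rewrite -lerBrDl ge_min lexx orbT.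
Qed.

Lemma polydisc_open n (a : 'I_n -> C) r b : 0 < r -> polydisc a r b ->
  exists2 s, 0 < s & forall z, polydisc b s z -> polydisc a r z.
Proof.
move=> r0 /polydiscP /(fin_lt_bound r0)[s s0 hs]; exists s => // z /polydiscP hz.
apply/polydiscP => i; apply: le_lt_trans (nc_triangle _ (b i) _) _.
by apply: lt_le_trans (hs i); rewrite addrC ltrD2l.
Qed.

Definition mon n (u : 'I_n -> C) (k : {ffun 'I_n -> nat}) : C :=
  \prod_(i < n) u i ^+ k i.

Definition kadd n (k l : {ffun 'I_n -> nat}) : {ffun 'I_n -> nat} :=
  [ffun i => (k i + l i)%N].

Definition kdeg n (k : {ffun 'I_n -> nat}) : nat := (\sum_i k i)%N.

Lemma mon_add n (u : 'I_n -> C) k l : mon u (kadd k l) = mon u k * mon u l.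
Proof.
by rewrite /mon -big_split; apply: eq_bigr => i _; rewrite ffunE exprD.
Qed.

Lemma mon_scale n (u : 'I_n -> C) (t : C) k :
  mon (fun i => t * u i) k = t ^+ kdeg k * mon u k.
Proof.
rewrite /mon /kdeg (eq_bigr (fun i => t ^+ k i * u i ^+ k i)) => [|i _].
  by rewrite big_split expr_sum.
exact: exprMn.
Qed.

Lemma mon_neq0 n (u : 'I_n -> C) k : (forall i, u i != 0) -> mon u k != 0.
Proof. by move=> h; apply/prodf_neq0 => i _; rewrite expf_neq0. Qed.

Lemma nc_mon n (u : 'I_n -> C) k : nc (mon u k) = \prod_(i < n) nc (u i) ^+ k i.
Proof. by rewrite nc_prod; apply: eq_bigr => i _; rewrite ncX. Qed.

Lemma analyticP n (F : ('I_n -> C) -> C) (a : 'I_n -> C) :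
  analytic_at F a <-> exists (r : R) (c : {ffun 'I_n -> nat} -> C), 0 < r /\
    forall u : 'I_n -> C, (forall i, nc (u i) < r) ->
      has_sum (fun k => c k * mon u k) (F (fun i => a i + u i)).
Proof.
split=> -[r [c [r0 h]]]; exists r, c; split => //.
  move=> u hu; apply: has_sum_ext (h (fun i => a i + u i) _) => [k|].
    by congr (_ * _); apply: eq_bigr => i _; rewrite addrC addKr.
  by apply/polydiscP => i; rewrite addrC addKr.
move=> z /polydiscP hz; rewrite (_ : z = fun i => a i + (z i - a i)).
  by apply: has_sum_ext (h _ _) => [k|i]; rewrite ?[a i + _]addrC ?subrK //;
     congr (_ * _); apply: eq_bigr => i _; rewrite [a i + _]addrC subrK.
by apply/funext => i; rewrite addrC subrK.
Qed.

Lemma analytic_const n (b : C) (a : 'I_n -> C) : analytic_at (fun=> b) a.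
Proof.
apply/analyticP; pose k0 : {ffun 'I_n -> nat} := [ffun=> 0%N].
exists 1, (fun k => if k == k0 then b else 0); split => // u _.
have := @has_sum_fin R _ (fun k => (if k == k0 then b else 0) * mon u k) [fset k0]%fset.
rewrite big_seq_fset1 eqxx /mon big1; last by move=> i _; rewrite ffunE expr0.
by rewrite mulr1; apply => k; rewrite inE => /negPf ->; rewrite mul0r.
Qed.

Lemma analyticD n (F G : ('I_n -> C) -> C) (a : 'I_n -> C) :
  analytic_at F a -> analytic_at G a -> analytic_at (fun z => F z + G z) a.
Proof.
move=> /analyticP[r [c [r0 hc]]] /analyticP[s [d [s0 hd]]]; apply/analyticP.
exists (Num.min r s), (fun k => c k + d k); split; first by rewrite lt_min r0.
move=> u hu; have [h1 h2] : (forall i, nc (u i) < r) /\ (forall i, nc (u i) < s).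
  by split=> i; apply: lt_le_trans (hu i) _; rewrite ge_min lexx ?orbT.
by apply: has_sum_ext (has_sumD (hc u h1) (hd u h2)) => k; rewrite mulrDl.
Qed.

Lemma analyticM n (F G : ('I_n -> C) -> C) (a : 'I_n -> C) :
  analytic_at F a -> analytic_at G a -> analytic_at (fun z => F z * G z) a.
Proof.
move=> /analyticP[r [c [r0 hc]]] /analyticP[s [d [s0 hd]]]; apply/analyticP.
pose t := Num.min r s; have t0 : 0 < t by rewrite lt_min r0.
have prod (u : 'I_n -> C) : (forall i, nc (u i) < t) ->
    has_sum (fun p : {ffun 'I_n -> nat} * {ffun 'I_n -> nat} =>
       c p.1 * d p.2 * mon u (kadd p.1 p.2))
      (F (fun i => a i + u i) * G (fun i => a i + u i)).
  move=> hu; have [h1 h2] : (forall i, nc (u i) < r) /\ (forall i, nc (u i) < s).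
    by split=> i; apply: lt_le_trans (hu i) _; rewrite ge_min lexx ?orbT.
  apply: has_sum_ext (has_sum_prod (hc u h1) (hd u h2)) => p /=.
  by rewrite mon_add; ring.
(* The Taylor coefficients of the product are read off at one point [u0] with nonzero coordinates,
   as fibre sums divided by the monomial; no finite antidiagonal of multi-indices has to be
   described. *)
pose u0 (i : 'I_n) : C := (t / 2)%:C.
have t2 : 0 < t / 2 by lra.
have u00 i : u0 i != 0 by rewrite -nc_gt0 nc_real gtr0_norm.
have hu0 i : nc (u0 i) < t by rewrite nc_real gtr0_norm //; lra.
have [g [h1 _]] := has_sum_fibre (fun p => kadd p.1 p.2) (prod u0 hu0).
pose e k := g k / mon u0 k.
have he k : has_sum (fun p : {ffun 'I_n -> nat} * {ffun 'I_n -> nat} =>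
    if kadd p.1 p.2 == k then c p.1 * d p.2 else 0) (e k).
  rewrite /e mulrC; apply: has_sum_ext (has_sumZ (mon u0 k)^-1 (h1 k)) => p /=.
  case: eqP => [->|]; last by rewrite mulr0.
  by rewrite mulrC mulfK ?mon_neq0.
exists t, e; split => // u hu.
have [f [k1 k2]] := has_sum_fibre (fun p => kadd p.1 p.2) (prod u hu).
apply: has_sum_ext k2 => k; apply: (has_sum_uniq (k1 k)).
rewrite mulrC; apply: has_sum_ext (has_sumZ (mon u k) (he k)) => p /=.
by case: eqP => [->|]; rewrite ?mulr0 // mulrC.
Qed.

Lemma analyticZ n (b : C) (F : ('I_n -> C) -> C) (a : 'I_n -> C) :
  analytic_at F a -> analytic_at (fun z => b * F z) a.
Proof. exact: analyticM (analytic_const b a). Qed.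

Lemma analytic_sum n (J : Type) (s : seq J) (P : pred J)
    (F : J -> ('I_n -> C) -> C) (a : 'I_n -> C) :
  (forall j, P j -> analytic_at (F j) a) ->
  analytic_at (fun z => \sum_(j <- s | P j) F j z) a.
Proof.
move=> h; elim: s => [|j s IH].
  by rewrite (_ : (fun _ => _) = fun=> 0); [exact: analytic_const|
    apply/funext => z; rewrite big_nil].
rewrite (_ : (fun _ => _) = fun z => (if P j then F j z else 0) +
    \sum_(j <- s | P j) F j z); last first.
  by apply/funext => z; rewrite big_cons; case: (P j); rewrite ?add0r.
apply: analyticD => //; case: (boolP (P j)) => [/h//|_]; exact: analytic_const.
Qed.

Lemma analytic_prod n (J : Type) (s : seq J) (P : pred J)
    (F : J -> ('I_n -> C) -> C) (a : 'I_n -> C) :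
  (forall j, P j -> analytic_at (F j) a) ->
  analytic_at (fun z => \prod_(j <- s | P j) F j z) a.
Proof.
move=> h; elim: s => [|j s IH].
  by rewrite (_ : (fun _ => _) = fun=> 1); [exact: analytic_const|
    apply/funext => z; rewrite big_nil].
rewrite (_ : (fun _ => _) = fun z => (if P j then F j z else 1) *
    \prod_(j <- s | P j) F j z); last first.
  by apply/funext => z; rewrite big_cons; case: (P j); rewrite ?mul1r.
apply: analyticM => //; case: (boolP (P j)) => [/h//|_]; exact: analytic_const.
Qed.

Lemma analytic1P (F : C -> C) (a : C) :
  analytic1_at F a <-> exists (r : R) (c : nat -> C), 0 < r /\
    forall u : C, nc u < r -> has_sum (fun k => c k * u ^+ k) (F (a + u)).
Proof.
pose h (k : nat) : {ffun 'I_1 -> nat} := [ffun=> k].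
have hI : injective h by move=> x y /ffunP /(_ ord0); rewrite !ffunE.
have hS (k : {ffun 'I_1 -> nat}) : k = h (k ord0) by apply/ffunP => i; rewrite ffunE (ord1 i).
rewrite /analytic1_at analyticP; split=> -[r [c [r0 hc]]].
  exists r, (c \o h); split => // u hu.
  apply: has_sum_ext (has_sum_pull hI _ (hc (fun=> u) (fun=> hu))) => [k|k _] /=.
    by rewrite /mon big_ord1 ffunE.
  by exists (k ord0).
exists r, (fun k => c (k ord0)); split => // u hu.
apply: (has_sum_push hI) => [k _|]; first by exists (k ord0).
by apply: has_sum_ext (hc (u ord0) (hu ord0)) => k; rewrite /mon big_ord1 ffunE.
Qed.

(* Expand [c_k (u_i - u_j)^k] binomially; the double series in the two exponents
   converges absolutely when [|u_i|, |u_j| < r / 2]. *)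
Lemma analytic_comp_sub n (F : C -> C) (i j : 'I_n) (a : 'I_n -> C) :
  i != j -> analytic1_at F (a i - a j) ->
  analytic_at (fun z => F (z i - z j)) a.
Proof.
move=> ij /analytic1P[r [c [r0 hc]]]; apply/analyticP.
pose h (p : nat * nat) : {ffun 'I_n -> nat} :=
  [ffun l => if l == i then p.1 else if l == j then p.2 else 0%N].
have hi p : h p i = p.1 by rewrite ffunE eqxx.
have hj p : h p j = p.2 by rewrite ffunE eq_sym (negPf ij) eqxx.
have hI : injective h.
  move=> [x y] [x' y'] e; congr (_, _).
    by have := hi (x, y); rewrite e hi.
  by have := hj (x, y); rewrite e hj.
pose e (p : nat * nat) : C := c (p.1 + p.2)%N * 'C(p.1 + p.2, p.2)%:R * (-1) ^+ p.2.
(* The test [k == h (k i, k j)] says that [k] has no exponent outside [i] and [j]. *)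
pose d (k : {ffun 'I_n -> nat}) := if k == h (k i, k j) then e (k i, k j) else 0.
exists (r / 2), d; split; first by lra.
move=> u hu; set x := u i; set y := u j.
apply: (has_sum_push hI) => [k|].
  by rewrite /d; case: ifP => [/eqP e' _|]; [exists (k i, k j) | rewrite mul0r eqxx].
apply: (@has_sum_ext _ _ (fun p => e p * (x ^+ p.1 * y ^+ p.2))).
  move=> p; rewrite /d hi hj -surjective_pairing eqxx; congr (_ * _).
  rewrite /mon (bigD1 i) //= (bigD1 j) 1?eq_sym //= hi hj big1 ?mulr1 // => l.
  by move=> /andP[li lj]; rewrite ffunE (negPf li) (negPf lj) expr0.
have hxy : nc x + nc y < r by have := hu i; have := hu j; rewrite -/x -/y; lra.
have xy0 : 0 <= nc x + nc y by rewrite addr_ge0 ?nc_ge0.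
have bX : bsums (fun k => nc (c k) * (nc x + nc y) ^+ k).
  have := @hc (nc x + nc y)%:C; rewrite nc_real ger0_norm // => /(_ hxy).
  move/has_sum_bsums; apply: bsums_le => k.
  by rewrite ncM ncX nc_real ger0_norm.
have bB : bsums (fun p => nc (e p * (x ^+ p.1 * y ^+ p.2))).
  pose w (q : nat * nat) : R :=
    nc (c q.1) * ((nc x ^+ (q.1 - q.2) * nc y ^+ q.2) *+ 'C(q.1, q.2)).
  have w0 q : 0 <= w q by rewrite mulr_ge0 ?mulrn_wge0 ?mulr_ge0 ?exprn_ge0 ?nc_ge0.
  apply: (@bsums_inj _ _ _ _ w (fun p => ((p.1 + p.2)%N, p.2))) => //.
  - by move=> [a1 a2] [b1 b2] _ _ /= [ab bb]; congr (_, _) => //; lia.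
  - move=> p _; rewrite /w addnK /e !ncM !ncX ncN nc1 expr1n mulr1 nc_nat.
    by rewrite -mulrA mulr_natl lexx.
  apply: bsums_dep bX => // k A.
  apply: le_trans (sum_le_support (A := [fset l in iota 0 k.+1]%fset) A _ _) _ => //.
    move=> l; rewrite in_fset_of_seq mem_iota /= add0n ltnS -ltnNge => kl.
    by rewrite /w /= bin_small // mulr0n mulr0.
  rewrite sum_fset_seq ?iota_uniq // -[iota 0 k.+1]/(index_iota 0 (k.+1 - 0)) subn0.
  by rewrite big_mkord /w /= -mulr_sumr exprDn.
have [S hS] := bsums_has_sum bB.
suff <- : S = F (a i + x - (a j + y)) by [].
apply: has_sum_uniq (has_sum_diag hS) _.
have -> : a i + x - (a j + y) = a i - a j + (x - y) by ring.
apply: has_sum_ext (hc (x - y) _); last by apply: le_lt_trans hxy; exact: ncB.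
move=> k; rewrite exprDn mulr_sumr; apply: eq_bigr => -[l /=]; rewrite ltnS => lk _.
rewrite /e /= subnK // [(- y) ^+ _]exprNn -[X in c k * X]mulr_natl.
ring.
Qed.
End Analytic.

(** * Isolated zeros and the identity theorem on polydiscs *)

Section Identity.
Variable R : realType.
Local Notation C := R[i].

(** On the polydisc of radius [d * t] each nonconstant term carries at least one factor [d], so [F]
    differs from its constant term by at most [d * M]; the choice [d = e / (M + e)] makes this less
    than [e = |F a|], also when [M = 0]. *)
Lemma analytic_neq0 n (F : ('I_n -> C) -> C) (a : 'I_n -> C) :
  analytic_at F a -> F a != 0 ->
  exists2 s, 0 < s & forall z, polydisc a s z -> F z != 0.
Proof.
move=> /analyticP[r [c [r0 hc]]] Fa.
pose t := r / 2; have t0 : 0 < t by rewrite /t; lra.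
have [M hM] : bsums (fun k => nc (c k) * t ^+ kdeg k).
  have : forall i : 'I_n, nc ((fun=> t%:C) i : C) < r.
    by move=> i; rewrite nc_real gtr0_norm // /t; lra.
  move=> /hc /has_sum_bsums; apply: bsums_le => k; rewrite ncM nc_mon.
  by rewrite nc_real gtr0_norm // /kdeg expr_sum.
have M0 : 0 <= M by have := hM fset0; rewrite big_seq_fset0.
have bound (u : 'I_n -> C) (d : R) : 0 <= d <= 1 -> (forall i, nc (u i) <= d * t) ->
    nc (F (fun i => a i + u i) - c [ffun=> 0%N]) <= d * M.
  move=> /andP[d0 d1] hu; pose k0 : {ffun 'I_n -> nat} := [ffun=> 0%N].
  have h1 : has_sum (fun k => c k * mon u k) (F (fun i => a i + u i)).
    apply: hc => i; apply: le_lt_trans (hu i) _.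
    by apply: (@le_lt_trans _ _ t); [rewrite ler_piMl // ltW | rewrite /t; lra].
  have h2 : has_sum (fun k => if k == k0 then c k else 0) (c k0).
    have := @has_sum_fin R _ (fun k => if k == k0 then c k else 0) [fset k0]%fset.
    by rewrite big_seq_fset1 eqxx; apply => k; rewrite inE => /negPf ->.
  apply: (@has_sum_le _ _ _ (fun k => d * (nc (c k) * t ^+ kdeg k)) _ _
    (has_sumD h1 (has_sumN h2))); last first.
    by move=> A; rewrite -mulr_sumr ler_wpM2l.
  move=> k; case: eqP => [->|/eqP kk0].
    rewrite /mon big1 ?mulr1 ?subrr ?nc0 => [|i _]; last by rewrite ffunE expr0.
    by rewrite !mulr_ge0 ?nc_ge0 ?exprn_ge0 // ltW.
  rewrite subr0 ncM mulrCA ler_wpM2l ?nc_ge0 // nc_mon.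
  apply: (@le_trans _ _ (\prod_(i < n) (d * t) ^+ k i)).
    apply: ler_prod => i _; rewrite exprn_ge0 ?nc_ge0 //=.
    by apply: lerXn2r (hu i); rewrite nnegrE ?nc_ge0 // mulr_ge0 // ltW.
  rewrite -expr_sum -/(kdeg k) exprMn ler_wpM2r ?exprn_ge0 ?(ltW t0) //.
  have : (0 < kdeg k)%N.
    rewrite lt0n /kdeg sum_nat_eq0; apply: contra kk0 => /forallP h.
    by apply/eqP/ffunP => i; rewrite ffunE; exact/eqP/(implyP (h i)).
  by case: (kdeg k) => // m _; rewrite exprS ler_piMr // exprn_ile1.
have Fc : F a = c [ffun=> 0%N].
  apply/eqP; rewrite -subr_eq0 -nc_eq0 eq_le nc_ge0 andbT.
  have := @bound (fun=> 0) 0; rewrite mul0r lexx ler01 => /(_ isT).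
  rewrite (_ : (fun i => a i + 0) = a); last by apply/funext => i; rewrite addr0.
  by rewrite mul0r; apply => i; rewrite nc0.
rewrite -Fc in bound; rewrite -nc_gt0 in Fa; set e := nc (F a) in Fa.
pose d := e / (M + e); have Me : 0 < M + e by lra.
have d0 : 0 < d by rewrite divr_gt0.
have d1 : d <= 1 by rewrite ler_pdivrMr //; lra.
have dM : d * M < e by rewrite /d mulrAC ltr_pdivrMr // mulrDr ltrDl mulr_gt0.
exists (d * t); first by rewrite mulr_gt0.
move=> z /polydiscP hz; rewrite -nc_gt0.
have := bound (fun i => z i - a i) d; rewrite ltW // d1 => /(_ isT).
rewrite (_ : (fun i => a i + _) = z); last by apply/funext => i; rewrite addrC subrK.
move=> /(_ (fun i => ltW (hz i))) h.
have := nc_triangle (F a) (F z) 0; rewrite !subr0 ncBC -/e; lra.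
Qed.

(** With [m] the order of vanishing at 0 and [x = |t| / t0], the leading term has modulus [x^m * e]
    and the rest at most [x^(m+1) * M]; the leading term wins as soon as [x * M < e]. *)
Lemma isolated_zeros (g : nat -> C) (t0 : R) (f : R -> C) : 0 < t0 ->
  (forall t : R, `|t| <= t0 -> has_sum (fun m => g m * t%:C ^+ m) (f t)) ->
  exists2 d, 0 < d & (forall t, `|t| < d -> f t = 0) \/
    (forall t, `|t| < d -> t != 0 -> f t != 0).
Proof.
move=> t00 hf.
have [g0|/existsNP [m0 gm0]] := pselect (forall m, g m = 0).
  exists t0 => //; left => t /ltW /hf h; apply: has_sum_uniq h _.
  by apply: has_sum_ext (@has_sum0 R nat) => m; rewrite g0 mul0r.
have : exists m, g m != 0 by exists m0; apply/eqP.
move=> /ex_minnP[m gm hm].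
have [M hM] : bsums (fun k => nc (g k) * t0 ^+ k).
  have := hf t0; rewrite gtr0_norm // lexx => /(_ isT) /has_sum_bsums.
  by apply: bsums_le => k; rewrite ncM ncX nc_real gtr0_norm.
have M0 : 0 <= M by have := hM fset0; rewrite big_seq_fset0.
pose e := nc (g m) * t0 ^+ m; have e0 : 0 < e by rewrite mulr_gt0 ?nc_gt0 ?exprn_gt0.
have Me : 0 < M + e by lra.
exists (t0 * (e / (M + e))); first by rewrite mulr_gt0 // divr_gt0.
right => t ht tn; have tp : 0 < `|t| by rewrite normr_gt0.
pose x := `|t| / t0; have x0 : 0 < x by rewrite divr_gt0.
have xe : x < e / (M + e) by rewrite /x ltr_pdivrMr // mulrC.
have tx : `|t| = x * t0 by rewrite /x divfK // gt_eqF.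
have e1 : e / (M + e) <= 1 by rewrite ler_pdivrMr //; lra.
have tt0 : `|t| <= t0 by rewrite tx ler_piMl ?ltW //; lra.
have xM : x * M < e.
  by move: xe; rewrite ltr_pdivlMr // => xe; nra.
have h2 : has_sum (fun k => if k == m then g k * t%:C ^+ k else 0) (g m * t%:C ^+ m).
  have := @has_sum_fin R _ (fun k => if k == m then g k * t%:C ^+ k else 0) [fset m]%fset.
  by rewrite big_seq_fset1 eqxx; apply => k; rewrite inE => /negPf ->.
have := @has_sum_le _ _ _ (fun k => x ^+ m.+1 * (nc (g k) * t0 ^+ k)) _ (x ^+ m.+1 * M)
  (has_sumD (hf t tt0) (has_sumN h2)).
have x1 : x <= 1 by lra.
have h3 k : nc (g k * t%:C ^+ k - (if k == m then g k * t%:C ^+ k else 0)) <=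
    x ^+ m.+1 * (nc (g k) * t0 ^+ k).
  case: (ltngtP k m) => [km|km|->].
  - have -> : g k = 0 by apply/eqP; apply: contraLR km => /hm; rewrite -leqNgt.
    by rewrite !mul0r subr0 nc0 mul0r mulr0.
  - rewrite subr0 ncM ncX nc_real tx exprMn mulrCA.
    rewrite ler_wpM2r ?mulr_ge0 ?nc_ge0 ?exprn_ge0 ?(ltW t00) //.
    rewrite -(subnK km) exprD.
    rewrite ler_piMl ?exprn_ge0 ?(ltW x0) //.
    by rewrite exprn_ile1 // ltW.
  - by rewrite subrr nc0 !mulr_ge0 ?nc_ge0 ?exprn_ge0 // ltW.
move=> /(_ h3) h4; have {}h4 := h4 (fun A => _).
apply/eqP => ft0; rewrite ft0 sub0r ncN in h4.
have : nc (g m * t%:C ^+ m) <= x ^+ m.+1 * M.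
  by apply: h4 => A; rewrite -mulr_sumr ler_wpM2l // exprn_ge0 // ltW.
rewrite ncM ncX nc_real tx exprMn mulrCA -/e exprS.
have -> : x * x ^+ m * M = x ^+ m * (x * M) by ring.
by rewrite ler_pM2l ?exprn_gt0 //; lra.
Qed.

(** The terms of total degree [m] scale by [t^m], so their sum at the single value [t0], divided by
    [t0^m], is the coefficient for every [t]. *)
Lemma analytic_line n (F : ('I_n -> C) -> C) (a d : 'I_n -> C) :
  analytic_at F a -> exists (g : nat -> C) (t0 : R), 0 < t0 /\
    forall t : R, `|t| <= t0 ->
      has_sum (fun m => g m * t%:C ^+ m) (F (fun i => a i + t%:C * d i)).
Proof.
move=> /analyticP[r [c [r0 hc]]].
pose D := \sum_i nc (d i) + 1.
have dD i : nc (d i) < D.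
  rewrite /D (bigD1 i) //= -addrA ltrDl ltr_wpDl // sumr_ge0 // => j _.
  exact: nc_ge0.
have D0 : 0 < D by rewrite ltr_wpDl // sumr_ge0 // => j _; exact: nc_ge0.
pose t0 := r / D; have t00 : 0 < t0 by rewrite divr_gt0.
have ht (t : R) : `|t| <= t0 -> forall i, nc (t%:C * d i) < r.
  move=> tt i; rewrite ncM nc_real.
  have [->|t1] := eqVneq t 0; first by rewrite normr0 mul0r.
  apply: (@lt_le_trans _ _ (`|t| * D)); first by rewrite ltr_pM2l ?normr_gt0.
  by rewrite -ler_pdivlMr.
have tt0 : `|t0| <= t0 by rewrite gtr0_norm.
have [G [h1 _]] := has_sum_fibre (@kdeg n) (hc _ (ht t0 tt0)).
exists (fun m => G m / t0%:C ^+ m), t0; split => // t tt.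
have [H [k1 k2]] := has_sum_fibre (@kdeg n) (hc _ (ht t tt)); move: k1 k2 => /= k1 k2.
apply: has_sum_ext k2 => m; apply: has_sum_uniq (k1 m) _.
have t0n : t0%:C != 0 :> C by rewrite -nc_gt0 nc_real normr_gt0 gt_eqF.
have -> : G m / t0%:C ^+ m * t%:C ^+ m = t%:C ^+ m * (t0%:C ^- m * G m) by ring.
apply: has_sum_ext (has_sumZ (t%:C ^+ m) (has_sumZ (t0%:C ^- m) (h1 m))) => k /=.
case: eqP => [<-|_]; last by rewrite !mulr0.
by rewrite !mon_scale; field; exact: expf_neq0.
Qed.

(** Connectedness of [[0, 1]]: at the supremum of the points where [P] holds, the local hypothesis
    carries [P] from a point just below it to a point beyond it, unless the supremum is 1. *)
Lemma unit_interval_ind (P : R -> Prop) : P 0 ->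
  (forall T, 0 <= T <= 1 -> exists2 d, 0 < d & forall s t, 0 <= s <= 1 ->
     0 <= t <= 1 -> `|s - T| < d -> `|t - T| < d -> P s -> P t) ->
  P 1.
Proof.
move=> P0 h; pose S := [set t | 0 <= t <= 1 /\ P t]%classic.
have supS : has_sup S.
  by split; [exists 0; split; rewrite ?lexx ?ler01|exists 1 => t [/andP[]]].
have S0 : 0 <= sup S by apply: (sup_upper_bound supS); split; rewrite ?lexx ?ler01.
have S1 : sup S <= 1 by apply: ge_sup; [exact: supS.1|move=> t [/andP[]]].
have [|d d0 hd] := h (sup S); first by rewrite S0.
have [s [s01 Ps] hs] := sup_adherent d0 supS.
have sS : s <= sup S by apply: (sup_upper_bound supS).
have sd : `|s - sup S| < d by rewrite ler0_norm; lra.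
pose t := Num.min 1 (sup S + d / 2).
have t01 : 0 <= t <= 1 by rewrite /t le_min ge_min lexx ler01 /= andbT; lra.
have tS : sup S <= t by rewrite /t le_min S1 /=; lra.
have td : `|t - sup S| < d.
  have : t <= sup S + d / 2 by rewrite /t ge_min lexx orbT.
  by move=> ?; rewrite ger0_norm; lra.
have Pt := hd s t s01 t01 sd td Ps.
have {}tS : t <= sup S by apply: (sup_upper_bound supS).
suff <- : t = 1 by [].
move: tS; rewrite /t /Order.min; case: ifP => // _ ?; lra.
Qed.

Lemma identity_segment n (F : ('I_n -> C) -> C) (a d : 'I_n -> C) :
  (forall t : R, 0 <= t <= 1 -> analytic_at F (fun i => a i + t%:C * d i)) ->
  (exists2 e : R, 0 < e & forall t : R, `|t| < e -> F (fun i => a i + t%:C * d i) = 0) ->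
  F (fun i => a i + d i) = 0.
Proof.
move=> hF [e e0 he].
pose f (t : R) := F (fun i => a i + t%:C * d i).
suff [e1 e10 /(_ 1)] : exists2 e, 0 < e & forall t, `|t - 1| < e -> f t = 0.
  rewrite subrr normr0 => /(_ e10); rewrite /f (_ : (fun i => _) = fun i => a i + d i) //.
  by apply/funext => i; rewrite mul1r.
apply: (@unit_interval_ind (fun s => exists2 e, 0 < e & forall t, `|t - s| < e -> f t = 0)).
  by exists e => // t; rewrite subr0; exact: he.
move=> T T01; have [g [t0 [t00 hg]]] := analytic_line d (hF T T01).
have [t t1|d1 d10 hd] := @isolated_zeros g t0 (fun t => f (T + t)) t00.
  rewrite (_ : f (T + t) = F (fun i => a i + T%:C * d i + t%:C * d i)); first exact: hg.
  by rewrite /f; congr F; apply/funext => i; rewrite rmorphD mulrDl addrA.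
have {}hd : (forall t, `|t - T| < d1 -> f t = 0) \/
    (forall t, `|t - T| < d1 -> t != T -> f t != 0).
  have E t : T + (t - T) = t by rewrite addrC subrK.
  case: hd => hd; [left|right] => t tT; first by rewrite -(E t); exact: hd.
  by move=> tn; rewrite -(E t); apply: hd; rewrite ?subr_eq0.
exists d1 => // s t _ _ sT tT [e1 e10 h1].
case: hd => hd; last first.
  (* Isolated zeros are impossible here: [f] vanishes on an interval around [s], and [x] is small
     enough to leave in it, still close to [T], a point [v] other than [T]. *)
  exfalso; pose x := Num.min e1 (d1 - `|s - T|) / 2.
  have y0 : 0 < Num.min e1 (d1 - `|s - T|) by rewrite lt_min e10 subr_gt0.
  have y1 : Num.min e1 (d1 - `|s - T|) <= e1 by rewrite ge_min lexx.
  have y2 : Num.min e1 (d1 - `|s - T|) <= d1 - `|s - T| by rewrite ge_min lexx orbT.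
  have x0 : 0 < x by rewrite /x; lra.
  have xe : x < e1 by rewrite /x; lra.
  have xd : x < d1 - `|s - T| by rewrite /x; lra.
  have [v vs vT] : exists2 v, `|v - s| <= x & v != T.
    have [sT'|] := eqVneq s T; last by exists s; rewrite // subrr normr0 ltW.
    exists (s + x); first by rewrite addrC addKr gtr0_norm.
    by rewrite sT' -subr_eq0 addrC addKr gt_eqF.
  have := hd v; rewrite h1 ?eqxx; last by lra.
  move=> /(_ _ vT) H; have : false by apply: H; have := ler_distD s v T; lra.
  by [].
exists (d1 - `|t - T|); first by lra.
by move=> v vt; apply: hd; have := ler_distD t v T; lra.
Qed.

Lemma polydisc_convex n (a b c : 'I_n -> C) r (t : R) : 0 <= t <= 1 ->
  polydisc a r b -> polydisc a r c ->
  polydisc a r (fun i => b i + t%:C * (c i - b i)).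
Proof.
move=> /andP[t0 t1] /polydiscP hb /polydiscP hc; apply/polydiscP => i.
have -> : b i + t%:C * (c i - b i) - a i = (1 - t)%:C * (b i - a i) + t%:C * (c i - a i).
  by rewrite rmorphB rmorph1; ring.
apply: (le_lt_trans (ncD _ _)); rewrite !ncM !nc_real !ger0_norm ?subr_ge0 //.
set x := nc _; set y := nc _; apply: (@le_lt_trans _ _ (Num.max x y)).
  have : x <= Num.max x y by rewrite le_max lexx.
  have : y <= Num.max x y by rewrite le_max lexx orbT.
  by set m := Num.max x y; nra.
by rewrite gt_max /x /y hb hc.
Qed.

Lemma identity_polydisc n (F : ('I_n -> C) -> C) (a b : 'I_n -> C) r s :
  (forall z, polydisc a r z -> analytic_at F z) ->
  polydisc a r b -> 0 < s -> (forall z, polydisc b s z -> F z = 0) ->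
  forall z, polydisc a r z -> F z = 0.
Proof.
move=> hF hb s0 h0 z hz.
have -> : z = fun i => b i + (z i - b i) by apply/funext => i; rewrite addrC subrK.
apply: identity_segment.
  by move=> t t01; apply: hF; exact: polydisc_convex.
have [D D0 hD] : exists2 D, 0 < D & forall i, nc (z i - b i) < D.
  exists (\sum_i nc (z i - b i) + 1).
    by rewrite ltr_wpDl // sumr_ge0 // => j _; exact: nc_ge0.
  move=> i; rewrite (bigD1 i) //= -addrA ltrDl ltr_wpDl // sumr_ge0 // => j _.
  exact: nc_ge0.
exists (s / D); first by rewrite divr_gt0.
move=> t ht; apply: h0; apply/polydiscP => i; rewrite addrC addKr ncM nc_real.
apply: (@le_lt_trans _ _ (`|t| * D)); first by rewrite ler_wpM2l // ltW.
by rewrite -ltr_pdivlMr.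
Qed.

(** Absence of zero divisors: near [b] the factor [h] has no zero, so [f] vanishes there and hence
    on the whole polydisc. *)
Lemma integral_polydisc n (f h : ('I_n -> C) -> C) (a b : 'I_n -> C) r :
  0 < r -> (forall z, polydisc a r z -> analytic_at f z) -> analytic_at h b ->
  polydisc a r b -> h b != 0 ->
  (exists2 s, 0 < s & forall z, polydisc b s z -> f z * h z = 0) ->
  forall z, polydisc a r z -> f z = 0.
Proof.
move=> r0 hf hh hb hb0 [s s0 hs].
have [s' s'0 hs'] := analytic_neq0 hh hb0.
apply: (@identity_polydisc _ f a b r (Num.min s s')) => //.
  by rewrite lt_min s0.
move=> z hz; have /hs/eqP : polydisc b s z.
  by apply: polydisc_le hz; rewrite ge_min lexx.
rewrite mulf_eq0 (negPf (hs' z _)) ?orbF => [/eqP//|].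
by apply: polydisc_le hz; rewrite ge_min lexx orbT.
Qed.

(** The discs in the definition of a meromorphic function may be shrunk and recentred: a denominator
    that vanished on a small disc would vanish on the large one. *)
Lemma nonzero_shrink n (h : ('I_n -> C) -> C) (a : 'I_n -> C) r s :
  (forall z, polydisc a r z -> analytic_at h z) ->
  (exists2 z, polydisc a r z & h z != 0) ->
  forall b, polydisc a r b -> 0 < s -> exists2 z, polydisc b s z & h z != 0.
Proof.
move=> hh [z hz hz0] b hb s0; apply: contrapT => H.
move/eqP: hz0; apply; apply: (@identity_polydisc _ h a b r s hh) => // w hw.
by apply: contrapT => /eqP hw0; apply: H; exists w.
Qed.
End Identity.

(** * Meromorphic functions *)

Section Meromorphic.
Variable R : realType.
Local Notation C := R[i].

(** The condition of [meromorphic] at one point. The local form is needed because the auxiliary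
    function in the proof that [P1] is odd is known to be meromorphic only along a segment. *)
Definition mero_at n (F : ('I_n -> C) -> C) (a : 'I_n -> C) : Prop :=
  exists (r : R) (f h : ('I_n -> C) -> C),
    [/\ 0 < r,
        forall z, polydisc a r z -> analytic_at f z /\ analytic_at h z,
        exists2 z, polydisc a r z & h z != 0 &
        forall z, polydisc a r z -> h z != 0 -> F z = f z / h z].

(* The values of [F] on the zeros of [h] are ignored: a function in the class
   [meromorphic] is arbitrary there. *)
Definition vanishes_near n (F : ('I_n -> C) -> C) (a : 'I_n -> C) : Prop :=
  exists (r : R) (h : ('I_n -> C) -> C),
    [/\ 0 < r,
        forall z, polydisc a r z -> analytic_at h z,
        exists2 z, polydisc a r z & h z != 0 &
        forall z, polydisc a r z -> h z != 0 -> F z = 0].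

Lemma vanishes_nearW n (F : ('I_n -> C) -> C) (a : 'I_n -> C) r :
  0 < r -> (forall z, polydisc a r z -> F z = 0) -> vanishes_near F a.
Proof.
move=> r0 h; exists r, (fun=> 1); split => //.
- by move=> z _; exact: analytic_const.
- by exists a; rewrite ?oner_eq0 //; exact: polydisc_center.
- by move=> z /h.
Qed.

Lemma mero_analytic n (F : ('I_n -> C) -> C) (a : 'I_n -> C) r :
  0 < r -> (forall z, polydisc a r z -> analytic_at F z) -> mero_at F a.
Proof.
move=> r0 h; exists r, F, (fun=> 1); split => //.
- by move=> z /h; split => //; exact: analytic_const.
- by exists a; rewrite ?oner_eq0 //; exact: polydisc_center.
- by move=> z _ _; rewrite divr1.
Qed.

Lemma mero_const n (b : C) (a : 'I_n -> C) : mero_at (fun=> b) a.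
Proof. by apply: (mero_analytic ltr01) => z _; exact: analytic_const. Qed.

(** A common polydisc and the common denominator [h * h'], which is not identically zero by the
    absence of zero divisors. *)
Lemma mero2 n (F G : ('I_n -> C) -> C) (a : 'I_n -> C) :
  mero_at F a -> mero_at G a ->
  exists (r : R) (f h f' h' : ('I_n -> C) -> C),
    [/\ 0 < r,
        forall z, polydisc a r z ->
          [/\ analytic_at f z, analytic_at h z, analytic_at f' z & analytic_at h' z],
        exists2 z, polydisc a r z & h z * h' z != 0 &
        forall z, polydisc a r z -> h z * h' z != 0 ->
          [/\ h z != 0, h' z != 0, F z = f z / h z & G z = f' z / h' z]].
Proof.
move=> [r [f [h [r0 fh h0 Ff]]]] [s [f' [h' [s0 fh' h0' Gf]]]].
exists (Num.min r s), f, h, f', h'.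
have mr z : polydisc a (Num.min r s) z -> polydisc a r z.
  by apply: polydisc_le; rewrite ge_min lexx.
have ms z : polydisc a (Num.min r s) z -> polydisc a s z.
  by apply: polydisc_le; rewrite ge_min lexx orbT.
have t0 : 0 < Num.min r s by rewrite lt_min r0.
split => //.
- by move=> z hz; have [? ?] := fh z (mr z hz); have [? ?] := fh' z (ms z hz).
- have [b hb hb0] : exists2 b, polydisc a (Num.min r s) b & h b != 0.
    apply: (@nonzero_shrink _ _ _ a r) => //; last exact: polydisc_center.
    by move=> z /fh[].
  apply: contrapT => H; have [w hw /negP] := h0'; apply; apply/eqP.
  have hbr := mr _ hb; have hbs := ms _ hb.
  apply: (@integral_polydisc _ _ h' h a b s s0) => //.
  + by move=> z /fh'[].
  + by have [] := fh b hbr.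
  + have [d d0 hd] := polydisc_open t0 hb; exists d => // z /hd hz.
    apply/eqP; apply: contrapT => /negP e; apply: H; exists z => //.
    by rewrite mulrC.
- move=> z hz; rewrite mulf_eq0 negb_or => /andP[h1 h2]; split => //.
    by apply: Ff => //; exact: mr.
  by apply: Gf => //; exact: ms.
Qed.

Lemma meroD n (F G : ('I_n -> C) -> C) (a : 'I_n -> C) :
  mero_at F a -> mero_at G a -> mero_at (fun z => F z + G z) a.
Proof.
move=> hF hG; have [r [f [h [f' [h' [r0 an nz e]]]]]] := mero2 hF hG.
exists r, (fun z => f z * h' z + f' z * h z), (fun z => h z * h' z); split => //.
  move=> z /an[? ? ? ?]; split; last exact: analyticM.
  by apply: analyticD; apply: analyticM.
move=> z hz hh; have [h0 h0' -> ->] := e z hz hh.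
by rewrite addf_div.
Qed.

Lemma meroM n (F G : ('I_n -> C) -> C) (a : 'I_n -> C) :
  mero_at F a -> mero_at G a -> mero_at (fun z => F z * G z) a.
Proof.
move=> hF hG; have [r [f [h [f' [h' [r0 an nz e]]]]]] := mero2 hF hG.
exists r, (fun z => f z * f' z), (fun z => h z * h' z); split => //.
  by move=> z /an[? ? ? ?]; split; apply: analyticM.
move=> z hz hh; have [h0 h0' -> ->] := e z hz hh.
by rewrite mulf_div.
Qed.

Lemma mero_sum n (J : Type) (s : seq J) (P : pred J)
    (F : J -> ('I_n -> C) -> C) (a : 'I_n -> C) :
  (forall j, P j -> mero_at (F j) a) ->
  mero_at (fun z => \sum_(j <- s | P j) F j z) a.
Proof.
move=> h; elim: s => [|j s IH].
  by rewrite (_ : (fun _ => _) = fun=> 0); [exact: mero_const|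
    apply/funext => z; rewrite big_nil].
rewrite (_ : (fun _ => _) = fun z => (if P j then F j z else 0) +
    \sum_(j <- s | P j) F j z); last first.
  by apply/funext => z; rewrite big_cons; case: (P j); rewrite ?add0r.
apply: meroD => //; case: (boolP (P j)) => [/h//|_]; exact: mero_const.
Qed.

Lemma mero_prod n (J : Type) (s : seq J) (P : pred J)
    (F : J -> ('I_n -> C) -> C) (a : 'I_n -> C) :
  (forall j, P j -> mero_at (F j) a) ->
  mero_at (fun z => \prod_(j <- s | P j) F j z) a.
Proof.
move=> h; elim: s => [|j s IH].
  by rewrite (_ : (fun _ => _) = fun=> 1); [exact: mero_const|
    apply/funext => z; rewrite big_nil].
rewrite (_ : (fun _ => _) = fun z => (if P j then F j z else 1) *
    \prod_(j <- s | P j) F j z); last first.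
  by apply/funext => z; rewrite big_cons; case: (P j); rewrite ?mul1r.
apply: meroM => //; case: (boolP (P j)) => [/h//|_]; exact: mero_const.
Qed.

Lemma mero_comp_sub n (F : C -> C) (i j : 'I_n) (a : 'I_n -> C) :
  i != j -> meromorphic1 F -> mero_at (fun z => F (z i - z j)) a.
Proof.
move=> ij /(_ (fun=> a i - a j)) [r [f [h [r0 fh [w hw hw0] Ff]]]].
have E (z : 'I_1 -> C) : (fun=> z ord0) = z.
  by apply/funext => k; rewrite (ord1 k).
have r2 : 0 < r / 2 by lra.
have an (z : 'I_n -> C) : polydisc a (r / 2) z ->
    polydisc (fun=> a i - a j) r (fun _ : 'I_1 => z i - z j).
  move=> /polydiscP hz; apply/polydiscP => k.
  have -> : z i - z j - (a i - a j) = (z i - a i) - (z j - a j) by ring.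
  by apply: (le_lt_trans (ncB _ _)); have := hz i; have := hz j; lra.
exists (r / 2), (fun z => f (fun=> z i - z j)), (fun z => h (fun=> z i - z j)).
split => //.
- move=> z /an /fh[h1 h2].
  split; [apply: (@analytic_comp_sub _ _ (fun w => f (fun=> w)))|
          apply: (@analytic_comp_sub _ _ (fun w => h (fun=> w)))] => //;
  by rewrite /analytic1_at; under eq_fun do rewrite E.
(* The point [w] is reached by moving the two coordinates by [d] and [- d], half of the displacement
   each, so that both stay within [r / 2]. *)
- pose d := (w ord0 - (a i - a j)) / 2.
  exists (fun k => a k + (if k == i then d else if k == j then - d else 0)).
    move/polydiscP: hw => /(_ ord0) hw; apply/polydiscP => k; rewrite addrC addKr.
    have hd : nc d < r / 2.
      rewrite /d ncM ncV nc_nat ltr_pM2r ?invr_gt0 //.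
    by case: ifP => _ //; case: ifP => _; rewrite ?ncN ?nc0.
  rewrite !eqxx (eq_sym j i) (negPf ij).
  have -> : a i + d - (a j + - d) = w ord0 by rewrite /d; field.
  by rewrite E.
- by move=> z /an /Ff.
Qed.

(** Vanishing near one point of the disc where [F = f / h] makes [f * h] vanish on a small disc,
    hence [f] on the whole disc, hence [F] off the zeros of [h] around every other point. The radius
    depends on [a] alone, as the propagation along a segment requires. *)
Lemma vanishes_near_local n (F : ('I_n -> C) -> C) (a : 'I_n -> C) :
  mero_at F a -> exists2 r, 0 < r & forall b c, polydisc a r b -> polydisc a r c ->
    vanishes_near F b -> vanishes_near F c.
Proof.
move=> [r [f [h [r0 fh h0 Ff]]]]; exists r => // b c hb hc [s [k [s0 ak k0 Fk]]].
have [t t0 ht] := polydisc_open r0 hb.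
have [z1 hz1 kz1] : exists2 z, polydisc b (Num.min s t) z & k z != 0.
  by apply: (nonzero_shrink ak k0); rewrite ?lt_min ?s0 //; exact: polydisc_center.
have hz1s : polydisc b s z1 by apply: polydisc_le hz1; rewrite ge_min lexx.
have hz1r : polydisc a r z1.
  by apply: ht; apply: polydisc_le hz1; rewrite ge_min lexx orbT.
have [s1 s10 hs1] := polydisc_open s0 hz1s.
have [s2 s20 hs2] := analytic_neq0 (ak _ hz1s) kz1.
have [s3 s30 hs3] := polydisc_open r0 hz1r.
pose s4 := Num.min s1 (Num.min s2 s3).
have s40 : 0 < s4 by rewrite !lt_min s10 s20.
have fh0 z : polydisc z1 s4 z -> f z * h z = 0.
  move=> hz; have [->|hz0] := eqVneq (h z) 0; first by rewrite mulr0.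
  have := Ff z; rewrite Fk.
  - move=> e; have {}e : 0 = f z / h z.
      by apply: e => //; apply: hs3; apply: polydisc_le hz; rewrite !ge_min lexx !orbT.
    by rewrite -(divfK hz0 (f z)) -e !mul0r.
  - by apply: hs1; apply: polydisc_le hz; rewrite !ge_min lexx.
  - by apply: hs2; apply: polydisc_le hz; rewrite !ge_min lexx !orbT.
have [z2 hz2 hz20] : exists2 z, polydisc z1 s4 z & h z != 0.
  by apply: (@nonzero_shrink _ _ _ a r) => // z /fh[].
have hz2r : polydisc a r z2.
  by apply: hs3; apply: polydisc_le hz2; rewrite !ge_min lexx !orbT.
have f0 : forall z, polydisc a r z -> f z = 0.
  apply: (@integral_polydisc _ _ f h a z2 r r0) => //.
  - by move=> z /fh[].
  - by have [] := fh _ hz2r.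
  - by have [d d0 hd] := polydisc_open s40 hz2; exists d => // z /hd /fh0.
have [d d0 hd] := polydisc_open r0 hc.
exists d, h; split => //.
- by move=> z /hd /fh[].
- by apply: (@nonzero_shrink _ _ _ a r) => // z /fh[].
- by move=> z /hd hz hz0; rewrite Ff // f0 // mul0r.
Qed.

Lemma vanishes_near_segment n (F : ('I_n -> C) -> C) (a d : 'I_n -> C) :
  (forall t : R, 0 <= t <= 1 -> mero_at F (fun i => a i + t%:C * d i)) ->
  vanishes_near F a -> vanishes_near F (fun i => a i + d i).
Proof.
move=> hF ha.
rewrite (_ : (fun i => a i + d i) = fun i => a i + (1 : R)%:C * d i); last first.
  by apply/funext => i; rewrite mul1r.
apply: (@unit_interval_ind _ (fun t : R => vanishes_near F (fun i => a i + t%:C * d i))).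
  rewrite (_ : (fun i => _) = a) //.
  by apply/funext => i; rewrite mul0r addr0.
move=> T T01; have [r r0 hr] := vanishes_near_local (hF T T01).
have [D D0 hD] : exists2 D, 0 < D & forall i, nc (d i) < D.
  exists (\sum_i nc (d i) + 1).
    by rewrite ltr_wpDl // sumr_ge0 // => j _; exact: nc_ge0.
  move=> i; rewrite (bigD1 i) //= -addrA ltrDl ltr_wpDl // sumr_ge0 // => j _.
  exact: nc_ge0.
have near t : `|t - T| < r / D ->
    polydisc (fun i => a i + T%:C * d i) r (fun i => a i + t%:C * d i).
  move=> tT; apply/polydiscP => i.
  have -> : a i + t%:C * d i - (a i + T%:C * d i) = (t - T)%:C * d i.
    by rewrite rmorphB; ring.
  rewrite ncM nc_real; apply: (@le_lt_trans _ _ (`|t - T| * D)).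
    by rewrite ler_wpM2l // ltW.
  by rewrite -ltr_pdivlMr.
exists (r / D); first by rewrite divr_gt0.
by move=> s t _ _ /near hs /near ht; exact: hr.
Qed.

Lemma vanishes_near_everywhere n (F : ('I_n -> C) -> C) (a b : 'I_n -> C) :
  meromorphic F -> vanishes_near F a -> vanishes_near F b.
Proof.
move=> hF ha; rewrite (_ : b = fun i => a i + (b i - a i)); last first.
  by apply/funext => i; rewrite addrC subrK.
by apply: vanishes_near_segment => // t _; exact: hF.
Qed.

(* Only analyticity at the single point [a] is available, so the argument runs
   along one line through [a] on which the denominator does not vanish identically. *)
Lemma vanishes_near_analytic n (F : ('I_n -> C) -> C) (a : 'I_n -> C) :
  analytic_at F a -> vanishes_near F a -> F a = 0.
Proof.
move=> aF [r [h [r0 ah [b hb hb0] Fh]]].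
pose d i := b i - a i; pose L (t : R) i := a i + t%:C * d i.
have L0 : L 0 = a by apply/funext => i; rewrite /L mul0r addr0.
have hL t : 0 <= t <= 1 -> polydisc a r (L t).
  by move=> t01; apply: polydisc_convex => //; exact: polydisc_center.
have [g [t0 [t00 hg]]] := analytic_line d aF.
have [g' [t1 [t10 hg']]] := analytic_line d (ah a (polydisc_center a r0)).
have [d0 d00 hd0] := @isolated_zeros _ g t0 (F \o L) t00 hg.
have [d1 d10 hd1] := @isolated_zeros _ g' t1 (h \o L) t10 hg'.
rewrite -L0; case: hd0 => hd0; first by apply: hd0; rewrite normr0.
case: hd1 => hd1.
  exfalso; move/eqP: hb0; apply.
  rewrite (_ : b = fun i => a i + d i); last by apply/funext => i; rewrite addrC subrK.
  apply: identity_segment; last by exists d1.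
  by move=> t /hL; exact: ah.
(* Both [F] and [h] have isolated zeros along the line, so at this small [t] neither vanishes,
   against [Fh]; the bound 1 keeps [L t] in the polydisc. *)
exfalso; pose t := Num.min 1 (Num.min d0 d1) / 2.
have m0 : 0 < Num.min 1 (Num.min d0 d1) by rewrite !lt_min ltr01 d00.
have m1 : Num.min 1 (Num.min d0 d1) <= 1 by rewrite ge_min lexx.
have m2 : Num.min 1 (Num.min d0 d1) <= d0 by rewrite !ge_min lexx !orbT.
have m3 : Num.min 1 (Num.min d0 d1) <= d1 by rewrite !ge_min lexx !orbT.
have tp : 0 < t by rewrite /t; lra.
have tn : t != 0 by rewrite gt_eqF.
have td : `|t| < d0 by rewrite gtr0_norm // /t; lra.
have /eqP := hd0 t td tn; apply.
apply: Fh; first by apply: hL; rewrite ltW //= /t; lra.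
by apply: hd1; rewrite ?gtr0_norm // /t; lra.
Qed.
End Meromorphic.

(** * The complex exponential *)

Section ComplexExp.
Variable R : realType.
Local Notation C := R[i].
Implicit Types (x y : R) (z w : C).

Lemma cexpD z w : cexp (z + w) = cexp z * cexp w.
Proof.
case: z w => [a b] [c d]; rewrite /cexp /= expRD cosD sinD.
by apply/eqP; rewrite eq_complex /=; apply/andP; split; apply/eqP; ring.
Qed.

Lemma cexp0 : cexp (0 : C) = 1.
Proof. by rewrite /cexp /= expR0 cos0 sin0 mulr1 mulr0. Qed.

Lemma nc_cexp z : nc (cexp z) = expR (complex.Re z).
Proof.
rewrite /cexp /= !exprMn -mulrDr cos2Dsin2 mulr1 sqrtr_sqr gtr0_norm //.
exact: expR_gt0.
Qed.

Lemma cexp_neq0 z : cexp z != 0.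
Proof. by rewrite -nc_gt0 nc_cexp expR_gt0. Qed.

Lemma cexpN z : cexp (- z) = (cexp z)^-1.
Proof.
apply: (mulfI (cexp_neq0 z)); rewrite -cexpD subrr cexp0 divff //.
exact: cexp_neq0.
Qed.

Lemma exp_partial_sum x (B : {fset nat}) : 0 <= x ->
  \sum_(k <- B) x ^+ k / k`!%:R <= expR x.
Proof.
move=> x0; pose N := (\max_(k <- B) k).+1.
apply: (@le_trans _ _ (series (exp_coeff x) N)); last first.
  apply: nondecreasing_cvgn_le; last exact: is_cvg_series_exp_coeff.
  by apply/nondecreasing_seqP => n; rewrite seriesSr lerDl exp_coeff_ge0.
rewrite /series /= /index_iota subn0.
apply: ler_sum_uniq; rewrite ?fset_uniq ?iota_uniq //.
  by move=> k; rewrite divr_ge0 ?exprn_ge0.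
move=> k kB; rewrite mem_iota /= add0n /N ltnS.
by rewrite (big_rem k) //= leq_maxl.
Qed.

Lemma exp_bsums x : 0 <= x -> bsums (fun k => x ^+ k / k`!%:R).
Proof. by move=> x0; exists (expR x) => B; exact: exp_partial_sum. Qed.

(** Used with [g] the real or the imaginary part, to compare unconditional sums with the limits of
    partial sums that define [expR], [cos] and [sin]. *)
Lemma has_sum_series (f : nat -> C) (s : C) (g : C -> R) :
  (forall z, `|g z| <= nc z) -> additive g -> has_sum f s ->
  (series (g \o f) @ \oo --> g s)%classic.
Proof.
move=> gn gB /has_sumP hs.
have g0 : g 0 = 0 by rewrite -[X in g X](subrr 0) gB subrr.
have gD z w : g (z + w) = g z + g w.
  by rewrite -{1}[w]opprK gB -[in g (- w)]sub0r gB g0 sub0r opprK.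
apply/cvgrPdist_lt => e e0; have [A hA] := hs e e0.
exists (\max_(k <- A) k).+1 => // n /= hn.
rewrite /series /= -(big_morph g gD g0) -gB; apply: (le_lt_trans (gn _)).
rewrite ncBC /index_iota subn0.
have := hA [fset k in iota 0 n]%fset.
rewrite sum_fset_seq ?iota_uniq // => h; apply: h; apply/fsubsetP => k kA.
rewrite in_fset_of_seq mem_iota /= add0n; apply: leq_trans hn.
by rewrite ltnS (big_rem k) //= leq_maxl.
Qed.

(** The power series is matched with those of [expR], [cos] and [sin] on the two axes; the diagonals
    of the Cauchy product of the two series are then binomial expansions. *)
Lemma has_sum_cexp z : has_sum (fun k => z ^+ k / k`!%:R) (cexp z).
Proof.
have hE w : exists s, has_sum (fun k => w ^+ k / k`!%:R) s.
  apply: bsums_has_sum; apply: bsums_le (exp_bsums (nc_ge0 w)) => k.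
  by rewrite ncM ncX ncV nc_nat.
have real x : has_sum (fun k => x%:C ^+ k / k`!%:R) (expR x)%:C.
  have [s hs] := hE x%:C; suff <- : s = (expR x)%:C by [].
  have term k : x%:C ^+ k / k`!%:R = (exp_coeff x k)%:C :> C.
    by rewrite rmorphM fmorphV rmorphXn rmorph_nat.
  rewrite [s]complexE; have /(cvg_lim (@norm_hausdorff _ R)) :=
    has_sum_series (@ncR_le R) (fun z w => raddfB _ z w) hs.
  have /(cvg_lim (@norm_hausdorff _ R)) :=
    has_sum_series (@ncI_le R) (fun z w => raddfB _ z w) hs.
  rewrite (_ : series _ = fun=> 0); last first.
    by apply/funext => n; rewrite /series /= big1 // => k _; rewrite term.
  rewrite lim_cst // => <-.
  rewrite (_ : series _ = series (exp_coeff x)); last first.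
    by congr series; apply/funext => k /=; rewrite term.
  by move=> <-; rewrite mulr0 addr0.
have imag y : has_sum (fun k => (y *i) ^+ k / k`!%:R) (cexp (y *i)).
  have [s hs] := hE (y *i); suff <- : s = cexp (y *i) by [].
  have term k : (y *i) ^+ k / k`!%:R = (cos_coeff y k) +i* (sin_coeff y k) :> C.
    have pw : (y *i) ^+ k = (y%:C ^+ k) * ('i%C ^+ k) :> C.
      rewrite -exprMn; congr (_ ^+ _).
      by apply/eqP; rewrite eq_complex /=; apply/andP; split; apply/eqP; ring.
    have ik : 'i%C ^+ k = ((~~ odd k)%:R * (-1) ^+ k./2) +i* ((odd k)%:R * (-1) ^+ k.-1./2) :> C.
      rewrite -{1}(odd_double_half k) exprD -mul2n exprM sqr_i.
      have -> : (-1) ^+ k./2 = ((-1) ^+ k./2)%:C :> C by rewrite rmorphXn rmorphN rmorph1.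
      have [ok|ek] := boolP (odd k).
        have -> : k.-1./2 = k./2.
          by clear -ok; case: k ok => //= k; rewrite uphalf_half => /negPf ->.
        by apply/eqP; rewrite eq_complex /=; apply/andP; split; apply/eqP; ring.
      by apply/eqP; rewrite eq_complex /=; apply/andP; split; apply/eqP; ring.
    have cE : cos_coeff y k = (~~ odd k)%:R * (-1) ^+ k./2 * y ^+ k / k`!%:R by [].
    have sE : sin_coeff y k = (odd k)%:R * (-1) ^+ k.-1./2 * y ^+ k / k`!%:R by [].
    rewrite pw ik -rmorphXn -(rmorph_nat (real_complex R)) -fmorphV cE sE.
    have mulRC (u v w t : R) :
        u%:C * (v +i* w) * t%:C = (v * u * t) +i* (w * u * t) :> C.
      by apply/eqP; rewrite eq_complex /=; apply/andP; split; apply/eqP; ring.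
    exact: mulRC.
  have -> : cexp (y *i) = cos y +i* sin y :> C by rewrite /cexp /= expR0 !mul1r.
  have /(cvg_lim (@norm_hausdorff _ R)) :=
    has_sum_series (@ncR_le R) (fun z w => raddfB _ z w) hs.
  have /(cvg_lim (@norm_hausdorff _ R)) :=
    has_sum_series (@ncI_le R) (fun z w => raddfB _ z w) hs.
  rewrite (_ : series _ = series (sin_coeff y)); last first.
    by congr series; apply/funext => k /=; rewrite term.
  move=> H1.
  rewrite (_ : series _ = series (cos_coeff y)); last first.
    by congr series; apply/funext => k /=; rewrite term.
  rewrite cos.unlock sin.unlock => ->; rewrite H1; by case: (s).
case: z => x y.
have -> : x +i* y = x%:C + (y *i) by apply/eqP; rewrite eq_complex /= addr0 add0r !eqxx.
rewrite cexpD; have -> : cexp x%:C = (expR x)%:C :> C.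
  by rewrite /cexp /= cos0 sin0 mulr1 mulr0.
apply: has_sum_ext (has_sum_diag (has_sum_prod (real x) (imag y))) => k /=.
rewrite exprDn mulr_suml; apply: eq_bigr => -[l /=]; rewrite ltnS => lk _.
rewrite -(bin_fact lk) -mulr_natl !natrM.
have f0 (m : nat) : m`!%:R != 0 :> C by rewrite pnatr_eq0 -lt0n fact_gt0.
have c0 : 'C(k, l)%:R != 0 :> C by rewrite pnatr_eq0 -lt0n bin_gt0.
by field; rewrite !f0 c0.
Qed.

(** Each exponential is expanded around [a]. The resulting double series is summable because the sum
    over the powers of [u] is at most [expR (nc (l m) * r)], and regrouping it by powers gives the
    Taylor series. *)
Lemma analytic_expsum (I : choiceType) (b l : I -> C) (F : C -> C) (a : C) (r : R) :
  0 < r ->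
  bsums (fun m => nc (b m) * nc (cexp (l m * a)) * expR (nc (l m) * r)) ->
  (forall w, nc (w - a) < r -> has_sum (fun m => b m * cexp (l m * w)) (F w)) ->
  analytic1_at F a.
Proof.
move=> r0 hb hF; apply/analytic1P.
pose f (u : C) (p : I * nat) : C :=
  b p.1 * cexp (l p.1 * a) * ((l p.1 * u) ^+ p.2 / p.2`!%:R).
have hf u : nc u < r -> has_sum (f u) (F (a + u)).
  move=> ur; have /bsums_has_sum[S hS] : bsums (fun p => nc (f u p)).
    apply: bsums_dep hb; first by move=> p; exact: nc_ge0.
    move=> m B; have -> : \sum_(j <- B) nc (f u (m, j)) = nc (b m * cexp (l m * a)) *
        \sum_(j <- B) nc (l m * u) ^+ j / j`!%:R.
      by rewrite mulr_sumr; apply: eq_bigr => j _; rewrite /f [LHS]ncM /=;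
         congr (_ * _); rewrite [LHS]ncM ncX ncV nc_nat.
    rewrite -ncM ler_wpM2l ?nc_ge0 //.
    apply: le_trans (exp_partial_sum _ (nc_ge0 _)) _.
    by rewrite ler_expR ncM ler_wpM2l ?nc_ge0 // ltW.
  have [g [h1 h2]] := has_sum_fubini hS.
  suff <- : S = F (a + u) by [].
  apply: has_sum_uniq h2 _; apply: has_sum_ext (hF (a + u) _); last by rewrite addrC addKr.
  move=> m; apply/esym; apply: has_sum_uniq (h1 m) _.
  rewrite mulrDr cexpD mulrA.
  by have := has_sumZ (b m * cexp (l m * a)) (has_sum_cexp (l m * u)); apply: has_sum_ext.
have hr2 : nc (r / 2)%:C < r by rewrite nc_real gtr0_norm; lra.
have r2 : (r / 2)%:C != 0 :> C by rewrite -nc_gt0 nc_real normr_gt0; lra.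
have [G [h1 _]] := has_sum_fibre (@snd I nat) (hf _ hr2).
exists r, (fun k => G k / (r / 2)%:C ^+ k); split => // u ur.
have [H [k1 k2]] := has_sum_fibre (@snd I nat) (hf _ ur).
apply: has_sum_ext k2 => k; apply: has_sum_uniq (k1 k) _.
have -> : G k / (r / 2)%:C ^+ k * u ^+ k = u ^+ k * ((r / 2)%:C ^- k * G k) by ring.
apply: has_sum_ext (has_sumZ (u ^+ k) (has_sumZ ((r / 2)%:C ^- k) (h1 k))) => -[m j] /=.
case: eqP => [<-|_]; last by rewrite !mulr0.
rewrite /f /= !exprMn; field.
by rewrite pnatr_eq0 -lt0n fact_gt0 expf_neq0.
Qed.

Lemma analytic_cexp (l a : C) : analytic1_at (fun w => cexp (l * w)) a.
Proof.
apply: (@analytic_expsum unit (fun=> 1) (fun=> l) _ a 1 ltr01).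
  eexists=> A; apply: (sum_le_support (A := [fset tt]%fset)) => [_|[]].
    by rewrite !mulr_ge0 ?nc_ge0 ?expR_ge0.
  by rewrite inE.
move=> w _; have := @has_sum_fin R unit (fun=> 1 * cexp (l * w)) [fset tt]%fset.
by rewrite big_seq_fset1 mul1r; apply => -[]; rewrite inE.
Qed.
End ComplexExp.

(** * The twisted Weierstrass function *)

Section IntSums.
Variable R : realType.

Lemma bsums_int (f : int -> R) : (forall m, 0 <= f m) ->
  bsums (fun k : nat => f (Posz k)) -> bsums (fun k : nat => f (Negz k)) -> bsums f.
Proof.
move=> f0 hp hn.
pose f1 m := if m is Posz _ then f m else 0.
pose f2 m := if m is Negz _ then f m else 0.
apply: (@bsums_le _ _ _ (fun m => f1 m + f2 m)).
  by case=> k; rewrite /f1 /f2 ?addr0 ?add0r.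
apply: bsumsD.
  apply: (@bsums_inj _ _ _ f1 (fun k => f (Posz k)) (fun m => `|m|%N)) hp => //.
    by move=> [k|k] [k'|k']; rewrite !inE /f1 ?ltxx // => _ _ /= ->.
  by move=> [k|k]; rewrite /f1 ?ltxx.
apply: (@bsums_inj _ _ _ f2 (fun k => f (Negz k)) (fun m => `|m|%N.-1)) hn => //.
  by move=> [k|k] [k'|k']; rewrite !inE /f2 ?ltxx // => _ _ /= ->.
by move=> [k|k]; rewrite /f2 ?ltxx.
Qed.

Lemma bsums_geometric (x : R) : 0 <= x -> x < 1 -> bsums (fun k : nat => x ^+ k).
Proof.
move=> x0 x1; exists (1 - x)^-1 => A; pose N := (\max_(k <- A) k).+1.
apply: (@le_trans _ _ (\sum_(k <- iota 0 N) x ^+ k)).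
  apply: ler_sum_uniq; rewrite ?fset_uniq ?iota_uniq //.
    by move=> k; exact: exprn_ge0.
  by move=> k kA; rewrite mem_iota /= add0n ltnS (big_rem k) //= leq_maxl.
rewrite -[iota 0 N]/(index_iota 0 (N - 0)) subn0 big_mkord.
have x1' : 0 < 1 - x by lra.
rewrite -(ler_pM2l x1') mulfV ?gt_eqF // -opprB mulNr -subrX1 opprB gerBl.
exact: exprn_ge0.
Qed.

Lemma bsums_expR_int (c : R) : 0 < c -> bsums (fun m : int => expR (- (c * `|m|%:R))).
Proof.
move=> c0; have geo : bsums (fun k : nat => expR (- c) ^+ k).
  by apply: bsums_geometric; rewrite ?expR_ge0 // expR_lt1; lra.
have e (k : nat) : expR (- (c * k%:R)) = expR (- c) ^+ k.
  by rewrite -expRM_natr mulNr.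
apply: bsums_int => [m||]; first exact: expR_ge0.
  by apply: bsums_le geo => k; rewrite e.
apply: bsums_le geo => k; rewrite e exprS ler_piMl ?exprn_ge0 ?expR_ge0 //.
by rewrite expR_le1; lra.
Qed.
End IntSums.

Section TwistedWeierstrass.
Variables (R : realType) (theta tau : R[i]).
Hypothesis theta_sign : theta = 1 \/ theta = -1.
Hypothesis tau_im : 0 < complex.Im tau.
Local Notation C := R[i].

(* The summation index of [P_1] at [phi = -1] is [m + 1/2]. *)
Definition hf (m : int) : C := m%:~R + (2^-1 : R)%:C.

(* [log (1 / |q|)] *)
Definition period : R := 2 * pi * complex.Im tau.

Definition tden (m : int) : C := 1 - theta^-1 * cexp (two_pi_i R * tau * hf m).

Lemma period_gt0 : 0 < period.
Proof. by rewrite !mulr_gt0 ?pi_gt0. Qed.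

Lemma nc_q (x : R) : nc (cexp (two_pi_i R * tau * x%:C)) = expR (- (period * x)).
Proof.
rewrite nc_cexp /period; congr expR; rewrite /two_pi_i; case: tau => a b /=.
ring.
Qed.

Lemma theta_inv : theta^-1 = theta.
Proof. by case: theta_sign => ->; rewrite ?invr1 ?invrN1. Qed.

Lemma nc_theta : nc theta = 1.
Proof. by case: theta_sign => ->; rewrite ?ncN nc1. Qed.

Lemma theta2 : theta * theta = 1.
Proof. by case: theta_sign => ->; rewrite ?mulrNN mul1r. Qed.

Lemma hfE m : hf m = (m%:~R + 2^-1)%:C.
Proof. by rewrite /hf rmorphD /= rmorph_int. Qed.

Lemma Re_hfM m z : complex.Re (hf m * z) = (m%:~R + 2^-1) * complex.Re z.
Proof. by rewrite hfE; case: z => a b /=; rewrite mul0r subr0. Qed.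

Lemma Re_intM m (z : C) : complex.Re (m%:~R * z) = m%:~R * complex.Re z.
Proof.
by rewrite -(rmorph_int (real_complex R)); case: z => a b /=; rewrite mul0r subr0.
Qed.

(** This is [|q|^(1/2)], the largest [|q^(m + 1/2)|] with [m >= 0]. As [theta] has modulus 1,
    [1 - rho] keeps the denominators away from 0. *)
Let rho := expR (- (period / 2)).

Lemma rho_lt1 : rho < 1.
Proof. by rewrite expR_lt1; have := period_gt0; lra. Qed.

Lemma tden_pos (k : nat) : 1 - rho <= nc (tden (Posz k)).
Proof.
have := nc_triangle 1 (tden (Posz k)) 0; rewrite !subr0 nc1.
rewrite {1}/tden opprB addrCA subrr addr0 ncM theta_inv nc_theta mul1r hfE nc_q.
suff : expR (- (period * ((Posz k)%:~R + 2^-1))) <= rho by lra.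
rewrite ler_expR; have := period_gt0; have : 0 <= (Posz k)%:~R :> R by rewrite ler0n.
by nra.
Qed.

Lemma tden_neg (k : nat) :
  expR (period * (k%:R + 2^-1)) * (1 - rho) <= nc (tden (Negz k)).
Proof.
have := nc_triangle (tden (Negz k) - 1) (tden (Negz k)) 0; rewrite !subr0.
rewrite (_ : tden _ - 1 - tden _ = -1); last by ring.
rewrite {1}/tden (_ : 1 - ?[x] - 1 = - ?x); last by ring.
rewrite !ncN nc1 ncM theta_inv nc_theta mul1r hfE nc_q.
have -> : - (period * ((Negz k)%:~R + 2^-1)) = period * (k%:R + 2^-1).
  by rewrite NegzE mulrNz -[(Posz k.+1)%:~R]/(k.+1%:R : R) -[k.+1%:R]natr1; field.
suff : 1 <= expR (period * (k%:R + 2^-1)) * rho by lra.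
rewrite /rho -expRD -[leLHS]expR0 ler_expR.
have := period_gt0; have : 0 <= k%:R :> R by rewrite ler0n.
by nra.
Qed.

Lemma tden_neq0 m : tden m != 0.
Proof.
have r1 : 0 < 1 - rho by have := rho_lt1; lra.
rewrite -nc_gt0; case: m => k; first exact: lt_le_trans (tden_pos k).
by apply: lt_le_trans (tden_neg k); rewrite mulr_gt0 ?expR_gt0.
Qed.

(** With [y = q^(m - 1/2)] this is [1 / (1 - theta / y) + 1 / (1 - theta * y) = 1], which holds
    because [theta^2 = 1]. *)
Lemma tden_sym m : (tden (- m))^-1 = 1 - (tden (m - 1))^-1.
Proof.
have := tden_neq0 (- m); have := tden_neq0 (m - 1).
rewrite /tden theta_inv.
have -> : hf (- m) = - hf (m - 1).
  rewrite !hfE mulrNz intrB (_ : - _ + _ = - (m%:~R - 1%:~R + 2^-1)) ?rmorphN //.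
  by field.
rewrite mulrN cexpN; set y := cexp _; have y0 : y != 0 by exact: cexp_neq0.
move=> h1 h2; have h3 : y - theta != 0.
  rewrite (_ : y - theta = y * (1 - theta / y)) ?mulf_neq0 //.
  by rewrite mulrBr mulr1 mulrCA divff // mulr1.
have e1 : (1 - theta / y)^-1 = y / (y - theta) by field; rewrite h3 y0.
rewrite e1; apply: (mulfI h3); rewrite mulrCA divff // mulr1.
apply: (mulfI h1); rewrite mulrCA [X in _ = _ * X]mulrBr mulr1 divff //.
have -> : (y - theta) * (1 - theta * y - 1) = (theta * theta) * y - theta * y * y by ring.
by rewrite theta2; ring.
Qed.

(* Multiplying the series of [P_1] by [e^(w/2) - e^(-w/2)] gives [sum_m tcoef m e^(mw)],
   whose coefficients decay like [|q|^|m|]: the new series converges on both sides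
   of the line [Re w = 0], which carries the pole at [0]. *)
Definition tcoef (m : int) : C := (tden m)^-1 - (tden (m - 1))^-1.

Lemma tcoef_sym m : tcoef (- m) = tcoef m.
Proof.
rewrite /tcoef tden_sym (_ : - m - 1 = - (m + 1)); last by ring.
by rewrite tden_sym addrK; ring.
Qed.

Lemma nc_tdenV_pos (k : nat) : nc (tden (Posz k))^-1 <= (1 - rho)^-1.
Proof.
have r1 : 0 < 1 - rho by have := rho_lt1; lra.
by rewrite ncV lef_pV2 ?posrE ?tden_pos // (lt_le_trans r1 (tden_pos _)).
Qed.

Lemma nc_tdenV_neg (k : nat) :
  nc (tden (Negz k))^-1 <= expR (- (period * (k%:R + 2^-1))) / (1 - rho).
Proof.
have r1 : 0 < 1 - rho by have := rho_lt1; lra.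
have e1 : 0 < expR (period * (k%:R + 2^-1)) * (1 - rho) by rewrite mulr_gt0 ?expR_gt0.
rewrite ncV expRN -invfM lef_pV2 ?posrE ?tden_neg //.
exact: lt_le_trans (tden_neg _).
Qed.

(** For [m > 0] the difference is put over a common denominator: the numerator is of order [|q|^m]
    and the denominators have modulus at least [1 - rho]. The symmetry covers [m < 0]. The index 0
    involves [tden (-1)] and is bounded separately by [2 / (1 - rho)]. *)
Lemma tcoef_bound : exists2 K, 0 <= K &
  forall m, nc (tcoef m) <= K * expR (- (period * `|m|%:R)).
Proof.
have L0 := period_gt0; have r1 : 0 < 1 - rho by have := rho_lt1; lra.
have i0 : 0 < (1 - rho)^-1 by rewrite invr_gt0.
pose K0 := 2 * expR (period / 2) * (1 - rho)^-1 * (1 - rho)^-1.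
pose K := Num.max (2 / (1 - rho)) K0.
exists K; first by rewrite le_max divr_ge0 // ltW.
have pos (k : nat) : nc (tcoef (Posz k)) <= K * expR (- (period * k%:R)).
  case: k => [|k].
    rewrite mulr0 oppr0 expR0 mulr1; apply: (@le_trans _ _ (2 / (1 - rho))); last first.
      by rewrite le_max lexx.
    apply: le_trans (ncB _ _) _; have := nc_tdenV_pos 0; have := nc_tdenV_neg 0.
    have : expR (- (period * (0%:R + 2^-1))) <= 1 by rewrite expR_le1; nra.
    rewrite (_ : 0 - 1 = Negz 0) //; set e := expR _ => e1.
    have : e / (1 - rho) <= (1 - rho)^-1 by rewrite ler_piMl // ltW.
    by lra.
  have -> : tcoef (Posz k.+1) =
      (tden (Posz k) - tden (Posz k.+1)) * ((tden (Posz k.+1))^-1 * (tden (Posz k))^-1).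
    rewrite /tcoef (_ : Posz k.+1 - 1 = Posz k); last by rewrite -addn1 PoszD addrK.
    by field; rewrite !tden_neq0.
  have e1 (j : nat) : nc (tden (Posz j) - 1) = expR (- (period * (j%:R + 2^-1))).
    by rewrite /tden addrC addKr ncN ncM theta_inv nc_theta mul1r hfE nc_q.
  have d1 : nc (tden (Posz k) - tden (Posz k.+1)) <=
      2 * expR (period / 2) * expR (- (period * k.+1%:R)).
    apply: le_trans (nc_triangle _ 1 _) _; rewrite [X in _ + X]ncBC !e1.
    rewrite -mulrA -expRD.
    have : expR (- (period * (k%:R + 2^-1))) <= expR (period / 2 - period * k.+1%:R).
      by rewrite ler_expR -[k.+1%:R]natr1; lra.
    have : expR (- (period * (k.+1%:R + 2^-1))) <= expR (period / 2 - period * k.+1%:R).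
      by rewrite ler_expR; lra.
    by lra.
  rewrite ncM [nc (_^-1 * _)]ncM.
  apply: (@le_trans _ _ (K0 * expR (- (period * k.+1%:R)))); last first.
    by rewrite ler_wpM2r ?expR_ge0 // le_max lexx orbT.
  have -> : K0 * expR (- (period * k.+1%:R)) =
      (2 * expR (period / 2) * expR (- (period * k.+1%:R))) *
      ((1 - rho)^-1 * (1 - rho)^-1) by rewrite /K0; ring.
  by rewrite !ler_pM ?mulr_ge0 ?nc_ge0 ?nc_tdenV_pos.
case=> k; first exact: pos.
by rewrite NegzE tcoef_sym abszN; exact: pos.
Qed.

Definition kappa (w : C) : C := tsum (fun m : int => tcoef m * cexp (m%:~R * w)).

Lemma kappa_bsums (a : C) (r : R) : 0 <= r -> `|complex.Re a| + r < period ->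
  bsums (fun m : int => nc (tcoef m) * nc (cexp (m%:~R * a)) * expR (nc (m%:~R : C) * r)).
Proof.
move=> r0 ar; have [K K0 hK] := tcoef_bound.
have c0 : 0 < period - (`|complex.Re a| + r) by lra.
apply: bsums_le (bsumsZ K0 (bsums_expR_int c0)) => m.
apply: (@le_trans _ _ (K * expR (- (period * `|m|%:R)) *
   expR (`|m|%:R * `|complex.Re a|) * expR (`|m|%:R * r))).
  have mR : `|m%:~R : R| = `|m|%:R by rewrite -intr_norm; case: (m) => k.
  have nm : nc (m%:~R : C) = `|m|%:R by rewrite -(rmorph_int (real_complex R)) nc_real.
  rewrite nm; apply: ler_wpM2r; first exact: expR_ge0.
  apply: ler_pM; [exact: nc_ge0|exact: nc_ge0|exact: hK|].
  rewrite nc_cexp Re_intM ler_expR; apply: le_trans (ler_norm _) _.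
  by rewrite normrM ler_wpM2r // mR.
rewrite -!mulrA -!expRD le_eqVlt; apply/orP; left; apply/eqP; congr (K * expR _).
by rewrite /period; ring.
Qed.

Lemma has_sum_kappa (w : C) : `|complex.Re w| < period ->
  has_sum (fun m : int => tcoef m * cexp (m%:~R * w)) (kappa w).
Proof.
move=> hw; have [s hs] : exists s, has_sum (fun m : int => tcoef m * cexp (m%:~R * w)) s.
  apply: bsums_has_sum; have := @kappa_bsums w 0 (lexx _); rewrite addr0 => /(_ hw).
  by apply: bsums_le => m; rewrite ncM mulr0 expR0 mulr1.
by rewrite /kappa (tsum_eq hs).
Qed.

Lemma kappa_even (w : C) : `|complex.Re w| < period -> kappa (- w) = kappa w.
Proof.
move=> hw; have hw' : `|complex.Re (- w)| < period by case: (w) hw => a b /=; rewrite normrN.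
apply: has_sum_uniq (has_sum_kappa hw') _.
apply: has_sum_ext (has_sum_pull (@oppr_inj int) _ (has_sum_kappa hw)) => m /=.
  by rewrite tcoef_sym mulrNz mulrN mulNr.
by move=> _; exists (- m); rewrite opprK.
Qed.

Lemma kappa_analytic (a : C) : `|complex.Re a| < period -> analytic1_at kappa a.
Proof.
move=> ha; pose r := (period - `|complex.Re a|) / 2.
have r0 : 0 < r by rewrite /r; lra.
apply: (analytic_expsum r0 (kappa_bsums (ltW r0) _)); first by rewrite /r; lra.
move=> w hw; apply: has_sum_kappa.
have := ncR_le (w - a); have -> : complex.Re (w - a) = complex.Re w - complex.Re a.
  by case: (w) (a) => [? ?] [? ?].
have := ler_normD (complex.Re w - complex.Re a) (complex.Re a); rewrite subrK.
by move: hw; rewrite /r; lra.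
Qed.

Definition pser (w : C) : C := tsum (fun m : int => cexp (hf m * w) / tden m).

Lemma has_sum_pser (w : C) : - period < complex.Re w < 0 ->
  has_sum (fun m : int => cexp (hf m * w) / tden m) (pser w).
Proof.
move=> /andP[w1 w2]; suff [s hs] : exists s, has_sum (fun m : int => cexp (hf m * w) / tden m) s.
  by rewrite /pser (tsum_eq hs).
have r1 : 0 < 1 - rho by have := rho_lt1; lra.
have i0 : 0 <= (1 - rho)^-1 by rewrite invr_ge0 ltW.
have ebs (c : R) : 0 < c -> bsums (fun k : nat => (1 - rho)^-1 * expR (- c) ^+ k).
  move=> c0; apply: bsumsZ => //; apply: bsums_geometric; rewrite ?expR_ge0 //.
  by rewrite expR_lt1; lra.
apply: bsums_has_sum; apply: bsums_int => [m||]; first exact: nc_ge0.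
  have c0 : 0 < - complex.Re w by lra.
  apply: bsums_le (ebs _ c0) => k; rewrite ncM mulrC ler_pM ?nc_ge0 ?nc_tdenV_pos //.
  rewrite nc_cexp Re_hfM -expRM_natr ler_expR opprK -[(Posz k)%:~R]/(k%:R : R).
  by lra.
have c0 : 0 < complex.Re w + period by lra.
apply: bsums_le (ebs _ c0) => k; rewrite ncM mulrC.
apply: le_trans (ler_wpM2r (nc_ge0 _) (nc_tdenV_neg k)) _.
rewrite mulrAC mulrC ler_wpM2l // nc_cexp Re_hfM -expRM_natr -expRD ler_expR.
have -> : (Negz k)%:~R = - (k%:R + 1) :> R.
  by rewrite NegzE mulrNz -[(Posz k.+1)%:~R]/(k.+1%:R : R) -[k.+1%:R]natr1.
by lra.
Qed.

(** Both factors make the half-integer exponents integral; after [cexp (w / 2)] the index must also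
    be moved by one, which produces the differences [tcoef] with the opposite sign. *)
Lemma sinh_pser (w : C) : - period < complex.Re w < 0 ->
  (cexp (2^-1 * w) - cexp (- 2^-1 * w)) * pser w = - kappa w.
Proof.
move=> hw; have hs := has_sum_pser hw.
have hk : has_sum (fun m : int => tcoef m * cexp (m%:~R * w)) (kappa w).
  by apply: has_sum_kappa; move/andP: hw => [? ?]; rewrite ltr_norml; lra.
have h2 : (2^-1 : R)%:C = 2^-1 :> C by rewrite fmorphV rmorph_nat.
have e1 : has_sum (fun m : int => cexp (m%:~R * w) / tden (m - 1)) (cexp (2^-1 * w) * pser w).
  have bI : injective (fun m : int => m - 1) by exact: addIr.
  apply: has_sum_ext (has_sum_pull bI _ (has_sumZ (cexp (2^-1 * w)) hs)) => m /=.
    rewrite mulrA -cexpD; congr (cexp _ / _); rewrite /hf h2 intrB.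
    by field.
  by move=> _; exists (m + 1); rewrite addrK.
have e2 : has_sum (fun m : int => cexp (m%:~R * w) / tden m) (cexp (- 2^-1 * w) * pser w).
  apply: has_sum_ext (has_sumZ (cexp (- 2^-1 * w)) hs) => m /=.
  by rewrite mulrA -cexpD; congr (cexp _ / _); rewrite /hf h2; ring.
rewrite mulrBl; apply: has_sum_uniq (has_sumD e1 (has_sumN e2)) _.
by apply: has_sum_ext (has_sumN hk) => m; rewrite /tcoef; ring.
Qed.

Lemma sinh_neq0 (w : C) : complex.Re w != 0 ->
  cexp (2^-1 * w) - cexp (- 2^-1 * w) != 0.
Proof.
move=> hw; rewrite subr_eq0; apply: contra hw => /eqP /(congr1 (@Normc.normc R)).
have h2 : (2^-1 : R)%:C = 2^-1 :> C by rewrite fmorphV rmorph_nat.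
rewrite !nc_cexp -h2 -rmorphN => /expR_inj; case: w => a b /=; lra.
Qed.

Variable P1 : C -> C.
Hypothesis hP1 : twisted_weierstrass theta (-1) tau P1.

Lemma P1_pser (w : C) : - period < complex.Re w < 0 -> P1 w = - pser w.
Proof.
move=> /andP[w1 w2]; have [_ [lam [lam01 hl hP]]] := hP1.
(* The conditions [phi = -1] and [0 <= lam < 1] force [lam = 1/2]: the real part of the relation
   gives [cos (pi * lam) = 0] with [pi * lam] in [[0, pi]]. *)
have {}hl : lam = 2^-1.
  have L0 := pi_gt0 R; move: hl => /(congr1 (@complex.Re R)).
  rewrite /cexp /two_pi_i /= !mul0r mulr0 subr0 expR0 mul1r.
  rewrite (_ : 0 + 2 * pi * lam = (pi * lam) *+ 2); last by rewrite mulr2n; ring.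
  rewrite cos_mulr2n => h; have {h} : cos (pi * lam) ^+ 2 = 0.
    by move: h; rewrite mulr2n; lra.
  move=> /eqP; rewrite sqrf_eq0 => /eqP c0; move/andP: lam01 => [l0 l1].
  have : pi * lam = pi / 2.
    apply: cos_inj; rewrite ?cos_pihalf // in_itv /=; apply/andP; split; nra.
  by move=> /(mulfI (lt0r_neq0 L0)).
subst lam; apply: (hP w).
have -> : two_pi_i R * tau = two_pi_i R * tau * (1 : R)%:C by rewrite mulr1.
by rewrite !norm_nc !ltcR nc_q nc_cexp mulr1 ltr_expR expR_lt1 w1.
Qed.

Lemma P1_odd (w : C) : analytic1_at P1 w -> analytic1_at P1 (- w) -> P1 (- w) = - P1 w.
Proof.
move=> a1 a2; have [mP _] := hP1; have L0 := period_gt0.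
pose i0 : 'I_2 := ord0; pose i1 : 'I_2 := ord_max.
have i01 : i0 != i1 by []. have i10 : i1 != i0 by [].
(* In two variables the reflection [w -> - w] becomes the exchange of the coordinates, so the
   results on functions of [z i - z j] cover both terms. *)
pose E (z : 'I_2 -> C) := P1 (z i0 - z i1) + P1 (z i1 - z i0).
pose sh (v : C) := cexp (2^-1 * v) - cexp (- 2^-1 * v).
pose D (z : 'I_2 -> C) := sh (z i0 - z i1) * P1 (z i0 - z i1) - kappa (z i0 - z i1).
pose pt (x : C) (i : 'I_2) : C := if i == i0 then x else 0.
have pt0 x : pt x i0 - pt x i1 = x by rewrite /pt /= subr0.
have near (x v : R) (z : 'I_2 -> C) : polydisc (pt x%:C) v z ->
    `|complex.Re (z i0 - z i1) - x| < 2 * v.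
  move=> /polydiscP hz; have := hz i0; have := hz i1; rewrite /pt /= subr0 => h1 h0.
  have -> : complex.Re (z i0 - z i1) - x = complex.Re ((z i0 - x%:C) - z i1).
    by case: (z i0) (z i1) => [? ?] [? ?] /=; ring.
  by apply: le_lt_trans (ncR_le _) _; apply: le_lt_trans (ncB _ _) _; lra.
have mE : meromorphic E.
  by move=> z; apply: meroD; apply: mero_comp_sub.
have vD : vanishes_near D (pt (- (period / 2))%:C).
  apply: (@vanishes_nearW _ _ _ _ (period / 8)); first by lra.
  move=> z /near; rewrite ltr_norml => /andP[h1 h2].
  rewrite /D /sh P1_pser; last by apply/andP; split; lra.
  by rewrite mulrN sinh_pser ?opprK ?subrr //; apply/andP; split; lra.
(* The segment crosses the pole at 0, where [P1] is merely meromorphic; the radius [period / 8]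
   keeps its neighbourhood inside [|Re w| < period], where [kappa] is analytic. *)
have mD (t : R) : 0 <= t <= 1 ->
    mero_at D (fun i => pt (- (period / 2))%:C i + t%:C * pt period%:C i).
  move=> /andP[t0 t1]; set a := fun i => _.
  have aE : a = pt (- (period / 2) + t * period)%:C.
    apply/funext => i; rewrite /a /pt; case: ifP => _; last by rewrite mulr0 addr0.
    by rewrite rmorphD (rmorphM (real_complex R) t period).
  have re (z : 'I_2 -> C) : polydisc a (period / 8) z -> `|complex.Re (z i0 - z i1)| < period.
    rewrite aE => /near; rewrite !ltr_norml => /andP[h1 h2]; apply/andP; split; nra.
  have p8 : 0 < period / 8 by lra.
  apply: meroD.
    apply: meroM; last exact: mero_comp_sub.
    apply: (mero_analytic p8) => z _; apply: (@analytic_comp_sub _ _ sh) => //.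
    apply: analyticD; first exact: analytic_cexp.
    rewrite (_ : (fun _ => _) = fun z : 'I_1 -> C => (-1) * cexp (- 2^-1 * z ord0)).
      by apply: analyticZ; exact: analytic_cexp.
    by apply/funext => v; rewrite mulN1r.
  apply: (mero_analytic p8) => z hz.
  rewrite (_ : (fun _ => _) = fun z => (-1) * kappa (z i0 - z i1)); last first.
    by apply/funext => v; rewrite mulN1r.
  by apply: analyticZ; apply: analytic_comp_sub => //; apply: kappa_analytic; exact: re.
have {vD mD} := vanishes_near_segment mD vD.
rewrite (_ : (fun i => _ + _) = pt (period / 2)%:C); last first.
  apply/funext => i; rewrite /pt; case: ifP => _; last by rewrite addr0.
  by rewrite -rmorphD (_ : - _ + _ = period / 2) //; lra.
move=> [r [h [r0 ah nh hD]]].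
have vE : vanishes_near E (pt (period / 2)%:C).
  pose s := Num.min r (period / 8).
  have s0 : 0 < s by rewrite lt_min r0; lra.
  exists s, h; split => //.
  - by move=> z hz; apply: ah; apply: polydisc_le hz; rewrite ge_min lexx.
  - by apply: (nonzero_shrink ah nh) => //; exact: polydisc_center.
  move=> z hz hz0; have := hD z; rewrite hz0 => /(_ _ isT) Dz.
  have {}Dz : D z = 0 by apply: Dz; apply: polydisc_le hz; rewrite ge_min lexx.
  have : polydisc (pt (period / 2)%:C) (period / 8) z.
    by apply: polydisc_le hz; rewrite ge_min lexx orbT.
  move=> /near; rewrite ltr_norml => /andP[h1 h2].
  rewrite /E -(opprB (z i0)); move: Dz; rewrite /D; set v := z i0 - z i1 in h1 h2 *.
  have vN : complex.Re (- v) = - complex.Re v by case: (v).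
  have v0 : complex.Re v != 0 by apply/eqP; lra.
  have sv : sh (- v) = - sh v by rewrite /sh !mulrN mulNr opprK opprB.
  have vr : - period < complex.Re (- v) < 0 by rewrite vN; apply/andP; split; lra.
  (* The point [- v] lies in the strip of the series, which gives [P1 (- v)], while [D z = 0] gives
     [P1 v]; as [kappa] is even and [sh] odd, the two values cancel. *)
  have : sh (- v) * P1 (- v) = kappa v.
    rewrite -kappa_even; last by rewrite ltr_norml; apply/andP; split; lra.
    by rewrite (P1_pser vr) mulrN (sinh_pser vr) opprK.
  rewrite sv => <- /eqP; rewrite mulNr opprK -mulrDr mulf_eq0.
  by rewrite (negPf (sinh_neq0 v0)) => /eqP.
have aE : analytic_at E (pt w).
  apply: analyticD; apply: analytic_comp_sub => //; first by rewrite pt0.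
  by rewrite -opprB pt0.
have := vanishes_near_analytic aE (vanishes_near_everywhere (pt w) mE vE).
rewrite /E -(opprB (pt w i0)) pt0 addrC => /eqP.
by rewrite addr_eq0 => /eqP.
Qed.
End TwistedWeierstrass.

(** * The fermionic Fock space *)

Section Toggle.

(** Inserts [p] into an increasing sequence, or removes it if present. As an involution it lets
    creating and annihilating modes alike act as a scalar times a permutation of the basis. *)
Fixpoint tog (p : nat) (s : seq nat) : seq nat :=
  if s is x :: s' then
    if (p < x)%N then p :: s else if p == x then s' else x :: tog p s'
  else [:: p].

Lemma path_ltn_gt (m p : nat) (s : seq nat) : path ltn m s -> p \in s -> (m < p)%N.
Proof.
move=> hs ps; have := order_path_min ltn_trans hs.
by move=> /allP /(_ p ps).
Qed.

Lemma path_ltn_lt (m m' : nat) (s : seq nat) :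
  (m' <= m)%N -> path ltn m s -> path ltn m' s.
Proof. by case: s => //= x s mm /andP[mx ->]; rewrite andbT (leq_ltn_trans mm). Qed.

Lemma tog_path (m p : nat) (s : seq nat) : (m < p)%N -> path ltn m s -> path ltn m (tog p s).
Proof.
elim: s m => [|x s IH] m mp /=; first by rewrite mp.
move=> /andP[mx xs]; case: (ltngtP p x) => [px|px|_] /=.
- by rewrite mp px.
- by rewrite mx IH.
- exact: path_ltn_lt (ltnW mx) xs.
Qed.

Lemma togK (m p : nat) (s : seq nat) : (m < p)%N -> path ltn m s -> tog p (tog p s) = s.
Proof.
elim: s m => [|x s IH] m mp /=; first by rewrite ltnn eqxx.
move=> /andP[mx xs]; case: (ltngtP p x) => [px|px|e].
- by rewrite /= ltnn eqxx.
- by rewrite /= ltnNge ltnW //= gtn_eqF //= (IH x).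
- subst x; case: s xs {IH} => [|y s] //= /andP[py ys].
  by rewrite py.
Qed.

Lemma tog_size (p : nat) (s : seq nat) : odd (size (tog p s)) = ~~ odd (size s).
Proof.
elim: s => [|x s IH] //=; case: (ltngtP p x) => _ /=; rewrite ?negbK //.
by rewrite IH negbK.
Qed.
End Toggle.

(* [psi(k)] removes the part [k + 1] when [k >= 0] and inserts the part [-k] when [k < 0]. *)
Definition mode_index (k : int) : nat := if k is Posz j then j.+1 else `|k|%N.

Definition annihilates (k : int) : bool := if k is Posz _ then true else false.

Lemma mode_index_gt0 k : (0 < mode_index k)%N. Proof. by case: k. Qed.

Definition ftog (k : int) (s : fock_index) : fock_index :=
  Sub (tog (mode_index k) (val s)) (tog_path (mode_index_gt0 k) (valP s)).

Lemma ftogK k : involutive (ftog k).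
Proof.
by move=> s; apply: val_inj; rewrite !SubK (togK (mode_index_gt0 k)) //; exact: valP.
Qed.

Section Fermion.
Variables (R : realType) (V : vosa_data R) (psi : V) (B : hbasis V fock_index).
Hypothesis hV : is_vosa V.
Hypothesis hpsi : rank_one_fermion psi B.
Local Notation C := R[i].
Local Notation Y := (vmode V psi).
Local Notation crd := (Defs.coord B).

Lemma vmode_scale a n (k : C) u : vmode V a n (k *: u) = k *: vmode V a n u.
Proof.
have v0 : vmode V a n 0 = 0.
  have := vmode_linearr hV a n 1 0 0; rewrite !scale1r addr0 => /eqP.
  by rewrite -subr_eq0 opprD addrA subrr sub0r oppr_eq0 => /eqP.
by have := vmode_linearr hV a n k u 0; rewrite !addr0 v0 addr0.
Qed.

Lemma vmode_add a n u v : vmode V a n (u + v) = vmode V a n u + vmode V a n v.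
Proof. by have := vmode_linearr hV a n 1 u v; rewrite !scale1r. Qed.

Lemma vmode_zero a n : vmode V a n 0 = 0.
Proof. by rewrite -(scale0r 0) vmode_scale !scale0r. Qed.

Lemma vmode_scalel (k : C) a n u : vmode V (k *: a) n u = k *: vmode V a n u.
Proof.
have v0 : vmode V 0 n u = 0.
  have := vmode_linearl hV 1 0 0 n u; rewrite !scale1r addr0 => /eqP.
  by rewrite -subr_eq0 opprD addrA subrr sub0r oppr_eq0 => /eqP.
by have := vmode_linearl hV k a 0 n u; rewrite !addr0 v0 addr0.
Qed.

Lemma vmode_sum a n (I : Type) (r : seq I) (P : pred I) (f : I -> V) :
  vmode V a n (\sum_(i <- r | P i) f i) = \sum_(i <- r | P i) vmode V a n (f i).
Proof. exact: (big_morph _ (vmode_add a n) (vmode_zero a n)). Qed.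

Lemma coord_add i u v : crd i (u + v) = crd i u + crd i v.
Proof. by have := coord_linear B i 1 u v; rewrite scale1r mul1r. Qed.

Lemma coord_zero i : crd i 0 = 0.
Proof.
have /eqP := coord_add i 0 0; rewrite addr0 -subr_eq0 opprD addrA subrr sub0r oppr_eq0.
by move=> /eqP.
Qed.

Lemma coord_scale i (k : C) u : crd i (k *: u) = k * crd i u.
Proof. by have := coord_linear B i k u 0; rewrite !addr0 coord_zero addr0. Qed.

Lemma coord_sum i (I : Type) (r : seq I) (P : pred I) (f : I -> V) :
  crd i (\sum_(j <- r | P j) f j) = \sum_(j <- r | P j) crd i (f j).
Proof. exact: (big_morph _ (coord_add i) (coord_zero i)). Qed.

Lemma bvec_neq0 s : bvec B s != 0.
Proof.
apply/eqP => h; have := coord_bvec B s s; rewrite h coord_zero eqxx => /eqP.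
by rewrite eq_sym oner_eq0.
Qed.

Lemma psi_anti m n v : m + n + 1 != 0 -> Y m (Y n v) = - Y n (Y m v).
Proof.
move=> mn; have := psi_anticomm hpsi m n v; rewrite (negPf mn) scale0r => /eqP.
by rewrite addr_eq0 => /eqP.
Qed.

Lemma psi_sq m v : Y m (Y m v) = 0.
Proof.
have h : Y m (Y m v) = - Y m (Y m v).
  by apply: psi_anti; apply/eqP; lia.
by move/eqP: h; rewrite -addr_eq0 -mulr2n -scaler_nat scaler_eq0 pnatr_eq0 => /eqP.
Qed.

Definition fvec (s : seq nat) : V := foldr (fun k w => Y (- k%:Z) w) (vac V) s.

(** [psi(-p)] anticommutes past each smaller part at the cost of a sign, until it reaches its place
    or meets another [psi(-p)], whose square is 0. *)
Lemma psi_create p m s : (m < p)%N -> path ltn m s ->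
  Y (- p%:Z) (fvec s) = (if p \in s then 0 else (-1) ^+ count (fun x => x < p)%N s)
    *: fvec (tog p s).
Proof.
elim: s m => [|x s IH] m mp /=; first by rewrite scale1r.
move=> /andP[mx xs]; rewrite inE; case: (ltngtP p x) => [px|px|e] /=.
- have ps : p \notin s.
    by apply/negP => ps; have := ltn_trans px (path_ltn_gt xs ps); rewrite ltnn.
  rewrite (negPf ps) (_ : count _ s = 0%N) ?scale1r //.
  apply/eqP; rewrite -leqn0 leqNgt -has_count; apply/hasPn => y ys.
  by rewrite -leqNgt; apply: ltnW; apply: ltn_trans px (path_ltn_gt xs ys).
- rewrite psi_anti; last by apply/eqP; lia.
  rewrite (IH x) // vmode_scale -scaleNr add1n exprS mulN1r.
  by case: ifP => _; rewrite ?oppr0.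
- by subst x; rewrite psi_sq scale0r.
Qed.

(** [psi(p - 1)] has a nonzero anticommutator only with [psi(-p)]; if that part is absent, it
    reaches the vacuum and kills it. *)
Lemma psi_annihilate p m s : (m < p)%N -> path ltn m s ->
  Y (p%:Z - 1) (fvec s) = (if p \in s then (-1) ^+ count (fun x => x < p)%N s else 0)
    *: fvec (tog p s).
Proof.
elim: s m => [|x s IH] m mp /=.
  by rewrite scale0r (psi_vac hpsi) //; lia.
move=> /andP[mx xs]; rewrite inE.
have ac := psi_anticomm hpsi (p%:Z - 1) (- x%:Z) (fvec s).
case: (ltngtP p x) => [px|px|e] /=.
- have ps : p \notin s.
    by apply/negP => ps; have := ltn_trans px (path_ltn_gt xs ps); rewrite ltnn.
  rewrite (negPf ps) scale0r psi_anti; last by apply/eqP; lia.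
  rewrite (IH m) ?(negPf ps) ?scale0r ?vmode_zero ?oppr0 //.
  exact: path_ltn_lt (ltnW mx) xs.
- rewrite psi_anti; last by apply/eqP; lia.
  rewrite (IH x) // vmode_scale -scaleNr add1n exprS mulN1r.
  by case: ifP => _; rewrite ?oppr0.
- subst x; have ps : p \notin s.
    by apply/negP => ps; have := path_ltn_gt xs ps; rewrite ltnn.
  have e0 : Y (p%:Z - 1) (fvec s) = 0.
    rewrite (IH m) ?(negPf ps) ?scale0r //.
    exact: path_ltn_lt (ltnW mx) xs.
  move: ac; rewrite e0 vmode_zero addr0 => ->.
  rewrite add0n (_ : (_ == 0) = true) ?scale1r; last by apply/eqP; lia.
  rewrite (_ : count _ s = 0%N) ?scale1r //.
  apply/eqP; rewrite -leqn0 leqNgt -has_count; apply/hasPn => y ys.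
  by rewrite -leqNgt; apply: ltnW; apply: path_ltn_gt xs ys.
Qed.

(** It is 0 exactly when the mode would create an occupied part or annihilate an empty one; [ftog]
    is defined for these states all the same. *)
Definition mcoef (k : int) (s : fock_index) : C :=
  if (mode_index k \in val s) == annihilates k
  then (-1) ^+ count (fun x => x < mode_index k)%N (val s) else 0.

Lemma psi_bvec k s : Y k (bvec B s) = mcoef k s *: bvec B (ftog k s).
Proof.
rewrite !(psi_basis hpsi) /mcoef -!/(fvec _) SubK; have hs := valP s.
case: k => j /=.
  have -> : Posz j = (j.+1)%:Z - 1 by lia.
  by rewrite (psi_annihilate (ltn0Sn j) hs); case: (_ \in _).
by rewrite NegzE (psi_create (ltn0Sn j) hs) /=; case: (_ \in _).
Qed.

Lemma coord_psi k t v : crd t (Y k v) = mcoef k (ftog k t) * crd (ftog k t) v.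
Proof.
have [A vA] := Defs.coord_span B v.
rewrite {1}vA vmode_sum coord_sum [in RHS]vA coord_sum mulr_sumr; apply: eq_bigr => i _.
rewrite vmode_scale psi_bvec scalerA !coord_scale !coord_bvec.
have -> : (t == ftog k i) = (ftog k t == i).
  by apply/eqP/eqP => [->|<-]; rewrite ftogK.
by case: eqP => [->|_]; rewrite ?mulr0 // !mulr1 mulrC.
Qed.

Lemma binz0 (j : nat) : binz R 0 j = (j == 0%N)%:R.
Proof.
rewrite /binz; case: j => [|j]; first by rewrite big_ord0 fact0 divr1.
by rewrite big_ord_recl subrr !mul0r.
Qed.

Lemma binz1 (j : nat) : binz R 1 j = (j < 2)%N%:R.
Proof.
rewrite /binz; case: j => [|[|j]]; first by rewrite big_ord0 fact0 divr1.
  by rewrite big_ord1 subr0 divr1.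
by rewrite !big_ord_recl /= !subrr mul0r mulr0 mul0r.
Qed.

(** The component [l = -2], [m = 0], [n = 1] of the Jacobi identity: the left side is the mode 1 of
    [psi(-2) psi], that is [2 L(0)], applied to [psi]; on the right only the term with
    [psi(0) psi = 1] survives. *)
Lemma L0_psi : Lmode 0 psi = 2^-1 *: psi.
Proof.
rewrite /Lmode add0r (conf_psi hpsi) vmode_scalel; congr (_ *: _).
rewrite (creation hV).
have po := psi_odd hpsi.
have pp k : 0 <= k -> Y k psi = (k == 0)%:R *: vac V.
  move=> k0; rewrite -{2}(creation hV psi).
  have := psi_anticomm hpsi k (-1) (vac V); rewrite (psi_vac hpsi k0) vmode_zero addr0 => ->.
  by rewrite (_ : k + -1 + 1 = k) //; lia.
have [N hN] := borcherds hV psi (-2) 0 1 po po.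
have := hN N.+1 (leqnSn N); rewrite !big_ord_recl /=.
rewrite [X in _ + X = _]big1 => [|i _]; last by rewrite binz0 scale0r.
rewrite [X in _ = _ + X]big1 => [|i _]; last first.
  rewrite !pp // (_ : (_ == 0) = false) // (_ : (_ == 0) = false) //.
  by rewrite scale0r !vmode_zero scaler0 subr0 scaler0.
have b1 : binz R (-2) 0 = 1 by rewrite /binz big_ord0 fact0 divr1.
have s1 : (-1) ^+ 1 * (-1) ^ (-2) = -1 :> C.
  by rewrite expr1 mulN1r /exprz /= sqrrN expr1n invr1.
have p1 : Y (1 + Posz 0) psi = 0 by rewrite pp // scale0r.
have p0 : Y (0 + Posz 0) psi = vac V by rewrite pp // scale1r.
rewrite b1 s1 p1 p0 binz0 scale1r !addr0 vmode_zero sub0r mulr1.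
by rewrite scaleNr !scale1r opprK (creation hV).
Qed.

(** The component [l = 0], [m = 1] of the Jacobi identity for [conf] and [psi]: [L(-1) psi]
    contributes [- (n + 1)] by translation, and [L(0) psi] contributes [1/2]. *)
Lemma L0_comm n u : Lmode 0 (Y n u) = Y n (Lmode 0 u) + (- n%:~R - 2^-1) *: Y n u.
Proof.
have po := psi_odd hpsi; have ce := conf_even hV.
have [N hN] := borcherds hV u 0 1 n ce po.
have := hN N.+2 (leqW (leqnSn N)); rewrite !big_ord_recl /= !binz0 !binz1.
rewrite big1 => [|i _]; last by rewrite binz1 /= scale0r.
rewrite [X in _ = _ + (_ + X)]big1 => [|i _]; last by rewrite binz0 mulr0 scale0r.
rewrite (_ : 1 + n - Posz 0 = n + 1); last by lia.
rewrite (_ : 1 + n - Posz (bump 0 0) = n); last by rewrite /bump; lia.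
rewrite (_ : n + Posz 0 = n); last by lia.
rewrite (_ : 0 + n - Posz 0 = n); last by lia.
have c1 : (-1) ^+ 0 * (0%N == 0%N)%:R = 1 :> C by rewrite expr0 mul1r.
have c2 : (-1) ^+ 0 * (-1) ^ 0 = 1 :> C by rewrite expr0 mul1r.
rewrite -[bump 0 0]/1%N c1 ?c2 mulr0 scale0r !addr0.
have c3 : (0 < 2)%N%:R = 1 :> C by [].
rewrite c3 ?c3 !scale1r.
rewrite -[vmode V (conf V) 0 psi]/(Lmode (-1) psi).
rewrite -[vmode V (conf V) (0 + Posz 1) psi]/(Lmode 0 psi).
rewrite -[vmode V (conf V) (0 + 1) (Y n u)]/(Lmode 0 (Y n u)).
rewrite -[vmode V (conf V) (0 + 1) u]/(Lmode 0 u).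
rewrite (translation hV) L0_psi vmode_scalel addrK => h.
rewrite -[LHS](subrK (Y n (Lmode 0 u))) -h addrC -scalerDl; congr (_ + _ *: _).
by rewrite intrD; field.
Qed.

Definition wt (s : seq nat) : R := \sum_(x <- s) (x%:R - 2^-1).

Lemma L0_fvec s : Lmode 0 (fvec s) = (wt s)%:C *: fvec s.
Proof.
elim: s => [|x s IH] /=.
  by rewrite /Lmode add0r (creation_ge0 hV) // /wt big_nil scale0r.
rewrite L0_comm IH vmode_scale -scalerDl; congr (_ *: _).
rewrite /wt big_cons rmorphD rmorphB fmorphV !rmorph_nat /= mulrNz opprK addrC.
by [].
Qed.

(** The weights are part of the data of [B], but a nonzero eigenvector leaves no choice of
    eigenvalue. *)
Lemma bwtE s : bwt B s = wt (val s).
Proof.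
have := bwtP B s; rewrite (psi_basis hpsi) -/(fvec _) L0_fvec => /eqP.
rewrite -subr_eq0 -scalerBl scaler_eq0 /fvec -(psi_basis hpsi) (negPf (bvec_neq0 s)) orbF.
by rewrite -rmorphB => /eqP[] /eqP; rewrite subr_eq0 => /eqP.
Qed.

Lemma fvec_sector s : sector V (odd (size s)) (fvec s).
Proof.
elim: s => [|x s IH] /=; first exact: vac_even hV.
by rewrite -addTb; apply: (vmode_sector hV) => //; exact: psi_odd hpsi.
Qed.

Lemma bparE s : bpar B s = odd (size (val s)).
Proof.
have h1 := bparP B s; have h2 := fvec_sector (val s).
move: h2; rewrite /fvec -(psi_basis hpsi) => h2.
have /eqP n0 := bvec_neq0 s.
by case: (bpar B s) h1; case: (odd _) h2 => //= h2 h1; case: n0; exact: (sector_direct hV).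
Qed.

Lemma wt_tog m p s : path ltn m s ->
  wt (tog p s) = wt s + (if p \in s then - (p%:R - 2^-1) else p%:R - 2^-1).
Proof.
rewrite /wt; elim: s m => [|x s IH] m /=; first by rewrite big_nil big_seq1 add0r.
move=> /andP[mx xs]; rewrite inE; case: (ltngtP p x) => [px|px|e] /=.
- have ps : p \notin s.
    by apply/negP => ps; have := ltn_trans px (path_ltn_gt xs ps); rewrite ltnn.
  by rewrite (negPf ps) !big_cons; ring.
- by rewrite !big_cons (IH x) // addrA.
- by rewrite e big_cons; ring.
Qed.

Lemma wt_ftog k s : mcoef k s != 0 -> wt (val (ftog k s)) = wt (val s) - k%:~R - 2^-1.
Proof.
rewrite /mcoef SubK (wt_tog _ (valP s)); case: ifP => [/eqP ->|]; rewrite ?eqxx // => _.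
case: k => j /=; first by rewrite -natr1 -[(Posz j)%:~R]/(j%:R : R); field.
by rewrite NegzE mulrNz -[(Posz j.+1)%:~R]/(j.+1%:R : R); field.
Qed.

Lemma nc_mcoef k s : nc (mcoef k s) = (mcoef k s != 0)%:R.
Proof.
rewrite /mcoef; case: ifP => _; last by rewrite nc0 eqxx.
by rewrite ncX ncN nc1 expr1n signr_eq0.
Qed.

Lemma wt_ge0 (s : fock_index) : 0 <= wt (val s).
Proof.
rewrite /wt big_seq sumr_ge0 // => x xs.
have : (1 : R) <= x%:R by rewrite ler1n; exact: path_ltn_gt (valP s) xs.
lra.
Qed.

Lemma expL0_psi (z : C) : expL0 B z psi = cexp (z * (2^-1 : R)%:C) *: psi.
Proof.
have p1 : path ltn 0 [:: 1%N] by [].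
pose s1 : fock_index := Sub [:: 1%N] p1.
have psiE : psi = bvec B s1 by rewrite (psi_basis hpsi) SubK /= (creation hV).
rewrite /expL0 -(@fsbig_widen _ _ _ _ [set s1]%classic) //; last first.
  move=> i /= [_ /eqP is1]; rewrite [X in crd i X]psiE coord_bvec (negPf is1).
  by rewrite mulr0 scale0r.
rewrite fsbig_set1 [X in crd s1 X]psiE coord_bvec eqxx mulr1 -psiE bwtE SubK /wt.
by rewrite big_seq1 (_ : 1 - 2^-1 = 2^-1) //; lra.
Qed.
End Fermion.

(** * Expansion of Pfaffians *)

Section PfaffianExpansion.

Lemma lift_perm_exists n (i : 'I_n.+1) (s : 'S_n.+1) :
  exists t : 'S_n, s = lift_perm i (s i) t.
Proof.
pose f k := odflt k (unlift (s i) (s (lift i k))).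
have fK k : lift (s i) (f k) = s (lift i k).
  have : s i != s (lift i k) by rewrite (inj_eq perm_inj) neq_lift.
  by move=> /unlift_some[t h1 h2]; rewrite /f h2 /= -h1.
have fI : injective f.
  by move=> k l e; apply: (@lift_inj _ i); apply: (@perm_inj _ s); rewrite -!fK e.
exists (perm fI); apply/permP => k; case: (unliftP i k) => [l|] ->.
  by rewrite lift_perm_lift permE fK.
by rewrite lift_perm_id.
Qed.

Lemma lift_perm_inj n (i j : 'I_n.+1) : injective (@lift_perm n i j).
Proof.
move=> s t /permP e; apply/permP => k; apply: (@lift_inj _ j).
by rewrite -!(lift_perm_lift i) e.
Qed.

(** Encodes the partner [p.1 + 1] of the index 0, followed by an arrangement [p.2] of the renumbered
    remaining indices. *)
Definition pair_perm n (p : 'I_n.+1 * 'S_n) : 'S_n.+2 :=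
  lift_perm ord0 ord0 (lift_perm ord0 p.1 p.2).

Lemma pair_perm_inj n : injective (@pair_perm n).
Proof.
move=> [j s] [k t] /lift_perm_inj /= e.
have jk : j = k by rewrite -(lift_perm_id ord0 j s) e lift_perm_id.
by subst k; congr (_, _); apply: lift_perm_inj e.
Qed.

Lemma pair_perm0 n (p : 'I_n.+1 * 'S_n) : pair_perm p ord0 = ord0.
Proof. exact: lift_perm_id. Qed.

Lemma pair_perm1 n (p : 'I_n.+1 * 'S_n) : pair_perm p (lift ord0 ord0) = lift ord0 p.1.
Proof. by rewrite /pair_perm lift_perm_lift lift_perm_id. Qed.

Lemma pair_perm2 n (p : 'I_n.+1 * 'S_n) i :
  pair_perm p (lift ord0 (lift ord0 i)) = lift ord0 (lift p.1 (p.2 i)).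
Proof. by rewrite /pair_perm !lift_perm_lift. Qed.

Lemma lift_ltn n (i : 'I_n.+1) (j k : 'I_n) : (lift i j < lift i k)%N = (j < k)%N.
Proof. by rewrite /= /bump; case: leqP; case: leqP; lia. Qed.

Lemma pairing_pair_perm n (p : 'I_n.+1 * 'S_n) : ~~ odd n ->
  pairing (pair_perm p) = pairing p.2.
Proof.
move=> en; apply/forallP/forallP => h i; apply/forallP => j; apply/implyP.
  move=> /andP[oi ij].
  have /forallP /(_ (lift ord0 (lift ord0 j))) := h (lift ord0 (lift ord0 i)).
  rewrite !pair_perm2 !lift_ltn => /implyP; apply.
  by rewrite !lift0 /= negbK oi /= !eqSS.
case: (unliftP ord0 i) => [i1|] ->; last first.
  rewrite pair_perm0; case: (unliftP ord0 j) => [j1|] -> /=; last by [].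
  case: (unliftP ord0 j1) => [j2|] -> /=; first by rewrite pair_perm2.
  by rewrite pair_perm1.
case: (unliftP ord0 i1) => [i2|] -> //.
case: (unliftP ord0 j) => [j1|] ->; last by rewrite !lift0 /= andbF.
case: (unliftP ord0 j1) => [j2|] ->; last by rewrite !lift0 /= !eqSS /= andbF.
rewrite !pair_perm2 !lift_ltn !lift0 /= negbK !eqSS => ij.
by have /forallP /(_ j2) /implyP := h i2; apply.
Qed.

(** The first members of the pairs increase and each lies below its partner, so no value is less
    than [s ord0]; the value 0 is attained somewhere. *)
Lemma pairing_min n (s : 'S_n.+2) : ~~ odd n -> pairing s -> s ord0 = ord0.
Proof.
move=> en /forallP h.
have hs (i j : 'I_n.+2) : ~~ odd i -> (j == i.+1 :> nat) || (j == i.+2 :> nat) ->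
    (s i < s j)%N.
  by move=> oi ij; have /forallP /(_ j) /implyP := h i; apply; rewrite oi.
have even0 m : forall i : 'I_n.+2, i = m.*2 :> nat -> (s ord0 <= s i)%N.
  elim: m => [|m IH] i im; first by rewrite (_ : i = ord0) //; apply: val_inj.
  have mn : (m.*2 < n.+2)%N by rewrite (leq_trans _ (ltn_ord i)) // im doubleS; lia.
  apply: leq_trans (IH (Ordinal mn) erefl) _; apply: ltnW; apply: hs => /=.
    by rewrite odd_double.
  by rewrite im doubleS eqxx orbT.
have all0 i : (s ord0 <= s i)%N.
  have [oi|ei] := boolP (odd i); last first.
    by apply: (even0 i./2); rewrite -[LHS]odd_double_half (negPf ei).
  have i0 : (0 < i)%N by case: (i : nat) oi.
  have pn : (i.-1 < n.+2)%N by rewrite (leq_ltn_trans (leq_pred i)).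
  have ev : ~~ odd i.-1 by move: oi; rewrite -{1}(prednK i0).
  apply: leq_trans (even0 i.-1./2 (Ordinal pn) _) _.
    by rewrite /= -[LHS]odd_double_half (negPf ev).
  by apply: ltnW; apply: hs => //=; rewrite prednK // eqxx.
have := all0 (s^-1%g ord0); rewrite permKV leqn0 => /eqP s0.
exact: val_inj.
Qed.

Lemma prod_pairs_recl (R : realType) n (f : 'I_n.+2 -> 'I_n.+2 -> R[i]) :
  \prod_(p : 'I_n.+2 * 'I_n.+2 | ~~ odd p.1 && (p.2 == p.1.+1 :> nat)) f p.1 p.2 =
  f ord0 (lift ord0 ord0) *
  \prod_(p : 'I_n * 'I_n | ~~ odd p.1 && (p.2 == p.1.+1 :> nat))
     f (lift ord0 (lift ord0 p.1)) (lift ord0 (lift ord0 p.2)).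
Proof.
rewrite -(pair_big_dep (fun i : 'I_n.+2 => ~~ odd i)
  (fun i (j : 'I_n.+2) => j == i.+1 :> nat) f) /=.
rewrite -(pair_big_dep (fun i : 'I_n => ~~ odd i) (fun i (j : 'I_n) => j == i.+1 :> nat)
  (fun i j => f (lift ord0 (lift ord0 i)) (lift ord0 (lift ord0 j)))) /=.
rewrite big_mkcond !big_ord_recl /= mul1r; congr (_ * _).
  by rewrite (big_pred1 (lift ord0 ord0)).
rewrite [RHS]big_mkcond; apply: eq_bigr => i _; rewrite /= negbK add0n.
case: ifP => // _; rewrite big_mkcond !big_ord_recl /= !mul1r [RHS]big_mkcond.
by apply: eq_bigr => j _.
Qed.

(** A pairing amounts to the partner of the index 0 and a pairing of the rest. Of the two liftings
    in [pair_perm] only the inner one changes the sign, by [(-1) ^+ j]. *)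
Lemma pfaffian_recl (R : realType) n (M : 'M[R[i]]_n.+2) : ~~ odd n ->
  pfaffian M = \sum_(j < n.+1) (-1) ^+ j * (M ord0 (lift ord0 j) *
    pfaffian (\matrix_(i < n, k < n) M (lift ord0 (lift j i)) (lift ord0 (lift j k)))).
Proof.
move=> en; rewrite /pfaffian.
pose F (s : 'S_n.+2) := (-1) ^+ s *
  \prod_(p : 'I_n.+2 * 'I_n.+2 | ~~ odd p.1 && (p.2 == p.1.+1 :> nat)) M (s p.1) (s p.2).
pose A := [set p : 'I_n.+1 * 'S_n | pairing p.2].
transitivity (\sum_(s in [set pair_perm p | p in A]) F s).
  apply: eq_bigl => s; apply/idP/imsetP => [ps|[p]].
    have s0 := pairing_min en ps; have [t st] := lift_perm_exists ord0 s.
    have [u tu] := lift_perm_exists ord0 t.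
    rewrite s0 in st; exists (t ord0, u); last by rewrite /pair_perm /= -tu.
    by rewrite inE /= -(pairing_pair_perm (t ord0, u) en) /pair_perm /= -tu -st.
  by rewrite inE => pp ->; rewrite pairing_pair_perm.
rewrite big_imset /=; last by move=> p q _ _; exact: pair_perm_inj.
rewrite (eq_bigl (fun p => true && pairing p.2)); last by move=> p; rewrite inE.
rewrite -(pair_big_dep xpredT (fun=> @pairing n) (fun j t => F (pair_perm (j, t)))) /=.
apply: eq_bigr => j _; rewrite !mulr_sumr; apply: eq_bigr => t _.
rewrite /F (prod_pairs_recl (fun a b => M (pair_perm (j, t) a) (pair_perm (j, t) b))).
rewrite pair_perm0 pair_perm1 /= /pair_perm !odd_lift_perm /= signr_addb signr_odd.
rewrite -!mulrA; congr (_ * _); rewrite mulrCA; congr (_ * _); congr (_ * _).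
by apply: eq_bigr => p _; rewrite mxE !lift_perm_lift.
Qed.

Lemma pfaffian0 (R : realType) (M : 'M[R[i]]_0) : pfaffian M = 1.
Proof.
rewrite /pfaffian (big_pred1 (1%g : 'S_0)) => [|s].
  by rewrite odd_perm1 expr0 mul1r big1 // => -[[]].
have -> : s = 1%g by apply/permP => -[].
by rewrite /= eqxx; apply/forallP => -[].
Qed.

(** Pairs are listed increasingly, so only entries above the diagonal occur; those are the ones the
    series control on the trace domain. *)
Lemma pfaffian_ext (R : realType) n (M N : 'M[R[i]]_n) :
  (forall i j : 'I_n, (i < j)%N -> M i j = N i j) -> pfaffian M = pfaffian N.
Proof.
move=> MN; apply: eq_bigr => s /forallP hs; congr (_ * _); apply: eq_bigr => p /andP[o1 p2].
by apply: MN; have /forallP /(_ p.2) /implyP := hs p.1; apply; rewrite o1 p2.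
Qed.
End PfaffianExpansion.

(** * Traces of words in the modes of the fermion *)

Section PartitionFunction.
Variable R : realType.

Lemma prod1D_le (c : R) (N : nat) (a : nat -> R) :
  (forall i, 0 <= a i) -> \sum_(i < N) a i <= c -> \prod_(i < N) (1 + a i) <= expR c.
Proof.
move=> a0 ac; apply: (@le_trans _ _ (expR (\sum_(i < N) a i))); last by rewrite ler_expR.
rewrite expR_sum; apply: ler_prod => i _.
by rewrite expR_ge1Dx addr_ge0.
Qed.

(** The fermionic product formula: states are finite sets of parts, so any finite sum is at most the
    product of the [1 + a x] over [x < N], which is bounded by the exponential of the geometric-type
    sum of [a]. *)
Lemma bsums_wt (c : R) : 0 < c ->
  bsums (fun s : fock_index => expR (- (c * wt R (val s)))).
Proof.
move=> c0; pose a (x : nat) := expR (- (c * (x%:R - 2^-1))).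
have a0 x : 0 <= a x by exact: expR_ge0.
have [M hM] : bsums a.
  have geo : bsums (fun k : nat => expR (- c) ^+ k).
    by apply: bsums_geometric; rewrite ?expR_ge0 // expR_lt1; lra.
  apply: bsums_le (bsumsZ (expR_ge0 (c / 2)) geo) => k.
  by rewrite /a -expRM_natr -expRD ler_expR; lra.
exists (expR M) => A.
pose N := (\max_(s <- A) \max_(x <- val s) x).+1.
have sN (s : fock_index) x : s \in A -> x \in val s -> (x < N)%N.
  move=> sA xs; rewrite ltnS (big_rem s) //= leq_max; apply/orP; left.
  by rewrite (big_rem x) //= leq_maxl.
pose J (s : fock_index) := [set i : 'I_N | (i : nat) \in val s].
have srt (s : fock_index) : sorted ltn (val s) by have := valP s; exact: path_sorted.
have uq (s : fock_index) : uniq (val s).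
  by apply: sorted_uniq (srt s); [exact: ltn_trans|exact: ltnn].
have JI : {in A &, injective J}.
  move=> s t sA tA /setP e; apply: val_inj.
  apply: (irr_sorted_eq ltn_trans ltnn (srt s) (srt t)) => x.
  apply/idP/idP => xs.
    by have := e (Ordinal (sN _ _ sA xs)); rewrite !inE /= xs => <-.
  by have := e (Ordinal (sN _ _ tA xs)); rewrite !inE /= xs => ->.
pose G (K : {set 'I_N}) := \prod_(i < N) (if i \in K then a i else 1).
have eG s : s \in A -> expR (- (c * wt R (val s))) = G (J s).
  move=> sA; rewrite /G -big_mkcond /= /wt mulr_sumr -sumrN expR_sum.
  rewrite -[LHS]/(\prod_(x <- val s) a x).
  rewrite (eq_bigl (fun i : 'I_N => (i : nat) \in val s)); last by move=> i; rewrite inE.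
  rewrite -(big_map (@nat_of_ord N) (fun x => x \in val s) a) -[RHS]big_filter.
  apply: perm_big.
  apply: uniq_perm; rewrite ?uq // ?filter_uniq // ?map_inj_uniq ?index_enum_uniq //.
    exact: val_inj.
  move=> x; rewrite mem_filter; case: (boolP (x \in val s)) => //= xs.
  apply/esym/mapP; exists (Ordinal (sN _ _ sA xs)) => //.
  exact: mem_index_enum.
rewrite big_seq (eq_bigr _ eG) -big_seq -(big_map J xpredT G).
apply: (@le_trans _ _ (\sum_(K : {set 'I_N}) G K)).
  apply: ler_sum_uniq.
  - by move=> K; apply: prodr_ge0 => i _; case: ifP.
  - by rewrite map_inj_in_uniq ?fset_uniq.
  - exact: index_enum_uniq.
  - by move=> K _; exact: mem_index_enum.
rewrite (eq_bigr (fun K : {set 'I_N} => \prod_(i < N) (if i \in K then a i else 1))) //.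
rewrite -(@bigA_distr R 0 1 *%R +%R 'I_N (fun i => a i) (fun=> 1)).
rewrite (eq_bigr (fun i : 'I_N => 1 + a i)); last by move=> i _; exact: addrC.
apply: prod1D_le => //; apply: le_trans (hM [fset x in iota 0 N]%fset).
rewrite sum_fset_seq ?iota_uniq // -(big_mkord xpredT a) /index_iota subn0.
exact: lexx.
Qed.

Lemma bsums_ffun (I : choiceType) n (f : I -> R) :
  (forall i, 0 <= f i) -> bsums f ->
  bsums (fun u : {ffun 'I_n -> I} => \prod_(j < n) f (u j)).
Proof.
move=> f0 bf; elim: n => [|n IH].
  exists 1 => A; under eq_bigr do rewrite big_ord0.
  pose u0 : {ffun 'I_0 -> I} := ffun0 (card_ord 0).
  have uA (u : {ffun 'I_0 -> I}) : u = u0 by apply/ffunP => -[].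
  rewrite [leRHS](_ : 1 = \sum_(u <- [fset u0]%fset) 1); last by rewrite big_seq_fset1.
  apply: ler_sum_uniq; rewrite ?fset_uniq //.
  by move=> u _; rewrite (uA u) inE.
pose h (u : {ffun 'I_n.+1 -> I}) := (u ord0, [ffun j => u (lift ord0 j)] : {ffun 'I_n -> I}).
apply: (@bsums_inj _ _ _ _ (fun p : I * {ffun 'I_n -> I} =>
    f p.1 * \prod_(j < n) f (p.2 j)) h); last first.
- apply: (@bsums_prod R I {ffun 'I_n -> I} f _ f0 _ bf IH).
  by move=> u; exact: prodr_ge0.
- move=> u _; rewrite big_ord_recl /h /=; apply: ler_wpM2l; first exact: f0.
  by rewrite le_eqVlt; apply/orP; left; apply/eqP; apply: eq_bigr => j _; rewrite ffunE.
- move=> u v _ _ [e0 /ffunP e]; apply/ffunP => j.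
  by case: (unliftP ord0 j) => [k|] -> //; have := e k; rewrite !ffunE.
- by move=> p; rewrite mulr_ge0 // prodr_ge0.
Qed.
End PartitionFunction.

(** * Cyclicity of the trace and the recursion for words *)

Section Words.
Variables (R : realType) (V : vosa_data R) (psi : V) (B : hbasis V fock_index).
Hypothesis hV : is_vosa V.
Hypothesis hpsi : rank_one_fermion psi B.
Variables (theta tau : R[i]).
Hypothesis theta_sign : theta = 1 \/ theta = -1.
Hypothesis tau_im : 0 < complex.Im tau.
Local Notation C := R[i].
Local Notation Y := (vmode V psi).
Local Notation crd := (Defs.coord B).
Local Notation L := (period tau).

Definition act (ks : seq int) (v : V) : V := foldr (fun k w => Y k w) v ks.

Definition state (ks : seq int) (s : fock_index) : fock_index := foldr ftog s ks.

Fixpoint amp (ks : seq int) (s : fock_index) : C :=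
  if ks is k :: ks' then mcoef R k (state ks' s) * amp ks' s else 1.

Lemma act_bvec ks s : act ks (bvec B s) = amp ks s *: bvec B (state ks s).
Proof.
elim: ks => [|k ks IH] /=; first by rewrite scale1r.
by rewrite IH (vmode_scale hV) (psi_bvec hV hpsi) scalerA mulrC.
Qed.

Lemma nc_amp ks s : nc (amp ks s) <= 1.
Proof.
elim: ks => [|k ks IH]; first by rewrite nc1.
rewrite [amp _ _]/= ncM nc_mcoef; by case: eqP => _; rewrite ?mul0r ?mul1r.
Qed.

Lemma coord_act ks s : crd s (act ks (bvec B s)) = if state ks s == s then amp ks s else 0.
Proof.
rewrite act_bvec coord_scale coord_bvec eq_sym.
by case: eqP; rewrite ?mulr1 ?mulr0.
Qed.

Lemma act_scale ks (c : C) v : act ks (c *: v) = c *: act ks v.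
Proof. by elim: ks => [|k ks IH] //=; rewrite IH (vmode_scale hV). Qed.

Definition delete (j : nat) (ks : seq int) : seq int := take j ks ++ drop j.+1 ks.

Lemma act_comm k ks v : Y k (act ks v) =
  \sum_(j < size ks) ((-1) ^+ j * (k + nth 0 ks j + 1 == 0)%:R) *: act (delete j ks) v
  + (-1) ^+ size ks *: act ks (Y k v).
Proof.
elim: ks => [|x ks IH] /=; first by rewrite big_ord0 add0r expr0 scale1r.
have -> : Y k (Y x (act ks v)) = (k + x + 1 == 0)%:R *: act ks v - Y x (Y k (act ks v)).
  by rewrite -(psi_anticomm hpsi) addrK.
rewrite IH.
rewrite big_ord_recl /= expr0 mul1r (vmode_add hV) (vmode_scale hV) (vmode_sum hV).
rewrite (_ : delete 0 (x :: ks) = ks); last by rewrite /delete /= drop0.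
rewrite opprD addrA -sumrN; congr (_ + _ + _).
  apply: eq_bigr => j _; rewrite (vmode_scale hV) -scaleNr /bump add1n exprS mulN1r mulNr.
  by [].
by rewrite exprS mulN1r scaleNr.
Qed.

(** The factor [q^(L(0))] with the signs of the supertrace and of [g]: one sign per part for
    [g = 1], none for the parity automorphism, where the two cancel. The factor [q^(-1/48)] is left
    out. *)
Definition sw (s : fock_index) : C :=
  (- theta) ^+ size (val s) * cexp (two_pi_i R * tau * (wt R (val s))%:C).

Lemma nc_sw s : nc (sw s) = expR (- (L * wt R (val s))).
Proof. by rewrite /sw ncM ncX ncN (nc_theta theta_sign) expr1n mul1r nc_q. Qed.

Lemma sw_neq0 s : sw s != 0.
Proof. by rewrite -nc_gt0 nc_sw expR_gt0. Qed.

Definition wtrace (ks : seq int) : C := tsum (fun s => sw s * crd s (act ks (bvec B s))).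

Lemma has_sum_wtrace ks : has_sum (fun s => sw s * crd s (act ks (bvec B s))) (wtrace ks).
Proof.
suff [t ht] : exists t, has_sum (fun s => sw s * crd s (act ks (bvec B s))) t.
  by rewrite /wtrace (tsum_eq ht).
apply: bsums_has_sum; apply: bsums_le (bsums_wt (period_gt0 tau_im)) => s.
rewrite ncM nc_sw coord_act ler_piMr ?expR_ge0 //.
by case: ifP => _; rewrite ?nc_amp // nc0.
Qed.

Lemma sw_ftog k s : mcoef R k s != 0 ->
  sw s = - theta * cexp (two_pi_i R * tau * hf R k) * sw (ftog k s).
Proof.
move=> ks; have e2 (m : nat) : (- theta) ^+ m = (- theta) ^+ odd m.
  rewrite -{1}(odd_double_half m) exprD -mul2n exprM sqrrN expr2 (theta2 theta_sign).
  by rewrite expr1n mulr1.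
rewrite /sw (wt_ftog ks) e2 [in RHS]e2 SubK tog_size.
set q := cexp (_ * (wt _ _)%:C); set q1 := cexp (_ * hf R k).
set q2 := cexp (_ * (_ - _ - _)%:C).
have -> : q = q1 * q2.
  rewrite /q /q1 /q2 -cexpD hfE -mulrDr -rmorphD; congr (cexp (_ * _%:C)).
  by ring.
have -> : (- theta) ^+ odd (size (val s)) = - theta * (- theta) ^+ (~~ odd (size (val s))).
  by case: odd; rewrite ?expr0 ?expr1 ?mulr1 // mulrNN (theta2 theta_sign).
by ring.
Qed.

(* Cyclicity of the trace: moving [psi(k)] around the trace costs the factor
   [- theta q^(k + 1/2)], whereas moving it through an odd word costs a sign. *)
Lemma wtrace_cycle k ks :
  has_sum (fun s => sw s * crd s (act ks (Y k (bvec B s))))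
    (- theta * cexp (two_pi_i R * tau * hf R k) * wtrace (k :: ks)).
Proof.
have h := has_sumZ (- theta * cexp (two_pi_i R * tau * hf R k)) (has_sum_wtrace (k :: ks)).
have fI : injective (ftog k) by exact: (can_inj (ftogK k)).
apply: has_sum_ext (has_sum_pull fI _ h) => s /=; last first.
  by move=> _; exists (ftog k s); rewrite ftogK.
rewrite (coord_psi hV hpsi) ftogK (psi_bvec hV hpsi) act_scale coord_scale.
have [->|ms] := eqVneq (mcoef R k s) 0; first by rewrite !mul0r !mulr0.
by rewrite (sw_ftog ms); ring.
Qed.

(** Passing through an odd number of modes gives [-1], so cyclicity reads
    [W = S + theta * q^(k + 1/2) * W] with [S] the contractions; since [theta] is its own inverse,
    the factor to divide by is [tden]. *)
Lemma wtrace_rec k ks : odd (size ks) ->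
  wtrace (k :: ks) = (tden theta tau k)^-1 *
    \sum_(j < size ks) ((-1) ^+ j * (k + nth 0 ks j + 1 == 0)%:R) * wtrace (delete j ks).
Proof.
move=> ok; apply: (canRL (mulKf (tden_neq0 theta_sign tau_im k))).
have h1 : has_sum (fun s => \sum_(j < size ks) ((-1) ^+ j * (k + nth 0 ks j + 1 == 0)%:R) *
     (sw s * crd s (act (delete j ks) (bvec B s))))
   (\sum_(j < size ks) ((-1) ^+ j * (k + nth 0 ks j + 1 == 0)%:R) * wtrace (delete j ks)).
  by apply: has_sum_sum => j _; apply: has_sumZ; exact: has_sum_wtrace.
have h2 := has_sumD h1 (has_sumN (wtrace_cycle k ks)).
have h3 : has_sum (fun s => sw s * crd s (act (k :: ks) (bvec B s)))
   (\sum_(j < size ks) ((-1) ^+ j * (k + nth 0 ks j + 1 == 0)%:R) * wtrace (delete j ks)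
    - (- theta * cexp (two_pi_i R * tau * hf R k) * wtrace (k :: ks))).
  apply: has_sum_ext h2 => s; rewrite [act (k :: ks) _]/= act_comm coord_add coord_sum.
  rewrite coord_scale -signr_odd ok expr1 mulN1r mulrDr mulrN mulr_sumr; congr (_ - _).
  by apply: eq_bigr => j _; rewrite coord_scale mulrCA.
have := has_sum_uniq (has_sum_wtrace (k :: ks)) h3.
rewrite /tden (theta_inv theta_sign); set S := \sum_(_ < _) _; set W := wtrace _.
set q := cexp _ => e; have -> : S = W + - theta * q * W by rewrite {1}e subrK.
by ring.
Qed.

Definition word n (k : 'I_n -> int) : seq int := [seq k j | j <- enum 'I_n].

Lemma word_recl n (k : 'I_n.+1 -> int) : word k = k ord0 :: word (fun j => k (lift ord0 j)).
Proof. by rewrite /word enum_ordSl /= -map_comp. Qed.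

Lemma size_word n (k : 'I_n -> int) : size (word k) = n.
Proof. by rewrite size_map size_enum_ord. Qed.

Lemma nth_word n (k : 'I_n -> int) (j : 'I_n) : nth 0 (word k) j = k j.
Proof. by rewrite (nth_map j) ?size_enum_ord // nth_ord_enum. Qed.

Lemma delete_word n (k : 'I_n.+1 -> int) (j : 'I_n.+1) :
  delete j (word k) = word (fun i => k (lift j i)).
Proof.
have jn := ltn_ord j; rewrite ltnS in jn.
have sz : size (delete j (word k)) = n.
  by rewrite size_cat size_take size_drop size_word ltn_ord subSS subnKC.
apply: (@eq_from_nth _ 0); first by rewrite sz size_word.
rewrite sz => i iN; rewrite [RHS](nth_word _ (Ordinal iN)) -(nth_word k).
rewrite /delete nth_cat size_take size_word ltn_ord /= /bump.
case: ltnP => ij; first by rewrite nth_take // leqNgt ij.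
by rewrite nth_drop; congr (nth _ _ _); rewrite add1n addSn subnKC.
Qed.

(** The exponent [- k - 1/2] joins the power [- k - 1] that comes with the mode and the power [1/2]
    from [q_j^(L(0))] acting on [psi]. *)
Definition xmon n (z : 'I_n -> C) (k : 'I_n -> int) : C :=
  \prod_(j < n) cexp (- hf R (k j) * z j).

Definition pmat n (z : 'I_n -> C) : 'M[C]_n := \matrix_(i, j) pser theta tau (z j - z i).

Lemma has_sum_words n (z : 'I_n -> C) : ~~ odd n ->
  (forall i j : 'I_n, (i < j)%N -> - L < complex.Re (z j - z i) < 0) ->
  has_sum (fun k : {ffun 'I_n -> int} => xmon z k * wtrace (word k))
    (pfaffian (pmat z) * wtrace [::]).
Proof.
move=> en; rewrite -[n]odd_double_half (negPf en) add0n in z *; move: n./2 z => m.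
elim: m => [|m IH] z hz.
  rewrite pfaffian0 mul1r; pose u0 : {ffun 'I_0 -> int} := ffun0 (card_ord 0).
  have uA (u : {ffun 'I_0 -> int}) : u = u0 by apply/ffunP => -[].
  have := @has_sum_fin R _ (fun k : {ffun 'I_0 -> int} => xmon z k * wtrace (word k))
    [fset u0]%fset.
  rewrite big_seq_fset1 /xmon big_ord0 mul1r (_ : word u0 = [::]); last first.
    by apply: size0nil; rewrite size_word.
  by apply => u; rewrite (uA u) inE eqxx.
rewrite doubleS in z hz *; set N := m.*2 in IH z hz *.
have eN : ~~ odd N by rewrite odd_double.
rewrite (pfaffian_recl _ eN) mulr_suml.
(* [G j] is the contribution in which the first mode is contracted with the mode of index
   [j + 1]. *)
pose G (j : 'I_N.+1) (k : {ffun 'I_N.+2 -> int}) : C :=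
  (-1) ^+ j * ((k ord0 + k (lift ord0 j) + 1 == 0)%:R *
    (xmon z k / tden theta tau (k ord0) * wtrace (word (fun i => k (lift ord0 (lift j i)))))).
apply: (@has_sum_ext _ _ (fun k => \sum_(j < N.+1) G j k)).
  move=> k; rewrite word_recl wtrace_rec ?size_word /= ?negbK // mulrA mulr_sumr.
  apply: eq_bigr => j _; rewrite nth_word delete_word /G; ring.
apply: has_sum_sum => j _; rewrite -mulrA; apply: has_sumZ.
(* The contraction forces these two modes to be [p] and [- p - 1], whose powers combine to
   [cexp (hf p * (z_j - z_0))]; the sum over [p] is then [pser], and the other modes form a shorter
   word. *)
pose h (p : int * {ffun 'I_N -> int}) : {ffun 'I_N.+2 -> int} := [ffun a =>
  if unlift ord0 a is Some b then
    if unlift j b is Some c then p.2 c else - p.1 - 1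
  else p.1].
have h0 p : h p ord0 = p.1 by rewrite ffunE unlift_none.
have h1 p : h p (lift ord0 j) = - p.1 - 1 by rewrite ffunE liftK unlift_none.
have h2 p i : h p (lift ord0 (lift j i)) = p.2 i by rewrite ffunE !liftK.
have hI : injective h.
  move=> [a u] [b v] e; have e0 := h0 (a, u); rewrite e h0 /= in e0.
  congr (_, _) => //; apply/ffunP => i; have := h2 (a, u) i.
  by rewrite e h2.
apply: (has_sum_push hI) => [k|].
  have [kj _|] := eqVneq (k ord0 + k (lift ord0 j) + 1) 0; last by rewrite mul0r eqxx.
  exists (k ord0, [ffun i => k (lift ord0 (lift j i))]); apply/ffunP => a.
  case: (unliftP ord0 a) => [b|] ->; last by rewrite h0.
  case: (unliftP j b) => [c|] ->; first by rewrite h2 ffunE.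
  rewrite h1 /=; apply/eqP; rewrite -subr_eq0 -[X in _ == X]kj; apply/eqP; ring.
pose z' i := z (lift ord0 (lift j i)).
have hz' (i i' : 'I_N) : (i < i')%N -> - L < complex.Re (z' i' - z' i) < 0.
  by move=> ii; apply: hz; rewrite !lift_ltn.
have hj : - L < complex.Re (z (lift ord0 j) - z ord0) < 0 by apply: hz.
have H := has_sum_prod (has_sum_pser theta_sign tau_im hj) (IH z' hz').
have -> : pmat z ord0 (lift ord0 j) *
    pfaffian (\matrix_(i, k) pmat z (lift ord0 (lift j i)) (lift ord0 (lift j k))) * wtrace [::]
    = pser theta tau (z (lift ord0 j) - z ord0) * (pfaffian (pmat z') * wtrace [::]).
  rewrite mxE -mulrA; congr (_ * (_ * _)); congr pfaffian; apply/matrixP => a b.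
  by rewrite !mxE.
apply: has_sum_ext H => p /=.
rewrite h0 h1 (_ : (_ == 0) = true) ?mul1r; last by apply/eqP; lia.
rewrite (_ : word (fun i => h p (lift ord0 (lift j i))) = word p.2); last first.
  by rewrite /word; apply: eq_map => i; rewrite h2.
rewrite /xmon big_ord_recl (bigD1_ord j) //= h0 h1.
under [in RHS]eq_bigr do rewrite h2.
have hN : hf R (- p.1 - 1) = - hf R p.1.
  rewrite !hfE intrB mulrNz (_ : - _ - _ + _ = - (p.1%:~R + 2^-1)) ?rmorphN //.
  by field.
rewrite -[\prod_(i < N) cexp (- hf R (p.2 i) * z _)]/(xmon z' p.2) -/(xmon z' p.2) hN opprK.
rewrite mulrBr cexpD -mulNr; ring.
Qed.
End Words.

(** * Joint summability over states and modes *)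

Section JointSummability.
Variable R : realType.
Local Notation C := R[i].

Lemma abel_sum (W x : nat -> R) m :
  \sum_(j < m.+1) (W j - W j.+1) * x j =
  W 0%N * x 0%N - W m.+1 * x m + \sum_(j < m) W j.+1 * (x j.+1 - x j).
Proof.
elim: m => [|m IH]; first by rewrite big_ord1 big_ord0; ring.
by rewrite big_ord_recr /= IH [in RHS]big_ord_recr /=; ring.
Qed.

Lemma amp_neq0 ks s : amp R ks s != 0 ->
  forall j, (j < size ks)%N -> mcoef R (nth 0 ks j) (state (drop j.+1 ks) s) != 0.
Proof.
elim: ks => [|k ks IH] //=; rewrite mulf_eq0 negb_or => /andP[h1 h2] [|j] hj /=.
  by rewrite drop0.
exact: IH.
Qed.

Lemma state_drop ks s j : (j < size ks)%N ->
  state (drop j ks) s = ftog (nth 0 ks j) (state (drop j.+1 ks) s).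
Proof. by move=> hj; rewrite (drop_nth 0). Qed.

Lemma nc_xmon n (z : 'I_n -> C) (k : 'I_n -> int) :
  nc (xmon z k) = expR (\sum_(j < n) - ((k j)%:~R + 2^-1) * complex.Re (z j)).
Proof.
rewrite /xmon nc_prod expR_sum; apply: eq_bigr => j _.
rewrite nc_cexp mulNr mulNr -Re_hfM; congr expR.
by case: (hf R (k j) * z j).
Qed.

Variable tau : C.
Hypothesis tau_im : 0 < complex.Im tau.
Local Notation L := (period tau).

(* A nonzero term is determined by the states through which the word passes, and
   is bounded by a product of powers [r_j ^ wt] with all [r_j < 1]. *)
Lemma bsums_paths n (z : 'I_n -> C) :
  (forall i j : 'I_n, (i < j)%N -> complex.Re (z j) < complex.Re (z i)) ->
  (forall i j : 'I_n, complex.Re (z i) - L < complex.Re (z j)) ->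
  bsums (fun p : fock_index * {ffun 'I_n -> int} =>
    expR (- (L * wt R (val p.1))) * (nc (xmon z p.2) *
      (if state (word p.2) p.1 == p.1 then nc (amp R (word p.2) p.1) else 0))).
Proof.
case: n z => [|m] z hz hL.
  apply: (@bsums_inj _ _ _ _ (fun s => expR (- (L * wt R (val s)))) fst); last first.
  - exact: bsums_wt (period_gt0 tau_im).
  - move=> [s k] _ /=; rewrite ler_piMr ?expR_ge0 // /xmon big_ord0 nc1 mul1r.
    by case: ifP => _; rewrite ?nc_amp.
  - by move=> [s k] [t l] _ _ /= ->; congr (_, _); apply/ffunP => -[].
  - by move=> s; exact: expR_ge0.
pose x (j : nat) := complex.Re (z (inord j)).
have xz (j : 'I_m.+1) : complex.Re (z j) = x j by rewrite /x inord_val.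
have [c1 c10 hc1] : exists2 c, 0 < c & forall j : 'I_m, (x j.+1 - x j + 1) + c <= 1.
  apply: fin_lt_bound => // j; suff : x j.+1 < x j by lra.
  by apply: hz; rewrite !inordK ?ltnS // ltnW.
(* The slowest rate of decay: the gaps between consecutive [Re z_j] serve the intermediate states,
   and [L - (x 0 - x m)] the state at which the trace closes. *)
pose c := Num.min c1 (L - (x 0%N - x m)).
have c0 : 0 < c.
  rewrite lt_min c10 subr_gt0; have := hL (inord 0) (inord m).
  by rewrite -/(x 0) -/(x m); lra.
have cx (j : 'I_m) : x j.+1 - x j <= - c.
  have : c <= c1 by rewrite ge_min lexx.
  by have := hc1 j; lra.
have cL : x 0%N - x m - L <= - c.
  have : c <= L - (x 0%N - x m) by rewrite ge_min lexx orbT.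
  by lra.
(* The [j]-th label is the state once the modes [j, ..., m] have acted. For a nonzero term the label
   0 is the initial state, and each mode is recovered from the difference of two consecutive
   weights. *)
pose h (p : fock_index * {ffun 'I_m.+1 -> int}) : {ffun 'I_m.+1 -> fock_index} :=
  [ffun j : 'I_m.+1 => state (drop j (word p.2)) p.1].
have pos (p : fock_index * {ffun 'I_m.+1 -> int}) :
    0 < expR (- (L * wt R (val p.1))) * (nc (xmon z p.2) *
      (if state (word p.2) p.1 == p.1 then nc (amp R (word p.2) p.1) else 0)) ->
    state (word p.2) p.1 = p.1 /\ amp R (word p.2) p.1 != 0.
  case: eqP => [-> |_]; last by rewrite !mulr0 ltxx.
  by move=> hp; split=> //; apply: contraTneq hp => ->; rewrite nc0 !mulr0 ltxx.
have step (p : fock_index * {ffun 'I_m.+1 -> int}) (j : 'I_m.+1) :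
    amp R (word p.2) p.1 != 0 ->
    wt R (val (state (drop j (word p.2)) p.1)) =
    wt R (val (state (drop j.+1 (word p.2)) p.1)) - (p.2 j)%:~R - 2^-1.
  move=> ha; have js : (j < size (word p.2))%N by rewrite size_word.
  by have := amp_neq0 ha js; rewrite (state_drop _ js) nth_word => /wt_ftog.
apply: (@bsums_inj _ _ _ _ (fun u : {ffun 'I_m.+1 -> fock_index} =>
   \prod_(j < m.+1) expR (- (c * wt R (val (u j))))) h); last first.
- apply: (@bsums_ffun R _ m.+1 (fun s => expR (- (c * wt R (val s))))).
    by move=> s; exact: expR_ge0.
  exact: bsums_wt.
- move=> p /pos[hs ha].
  rewrite hs eqxx mulrA.
  apply: (@le_trans _ _ (expR (- (L * wt R (val p.1))) * nc (xmon z p.2))).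
    by rewrite ler_piMr ?nc_amp // mulr_ge0 ?expR_ge0 ?nc_ge0.
  rewrite nc_xmon -expRD -expR_sum ler_expR.
  pose W j := wt R (val (state (drop j (word p.2)) p.1)).
  have W0 : W 0%N = wt R (val p.1) by rewrite /W drop0 hs.
  have Wm : W m.+1 = wt R (val p.1) by rewrite /W drop_oversize ?size_word.
  have Wp j : 0 <= W j by exact: wt_ge0.
  (* Since [- (k_j + 1/2) = W j - W j.+1], summation by parts moves the differences onto [x]; the
     path is closed, so its two boundary terms combine with the exponent [- L * W 0]. *)
  rewrite (eq_bigr (fun j : 'I_m.+1 => (W j - W j.+1) * x j)); last first.
    by move=> j _; rewrite xz /W (step _ _ ha); ring.
  rewrite abel_sum Wm W0 big_ord_recl.
  rewrite [X in - (c * wt R (val X))](_ : _ = p.1); last by rewrite /h ffunE drop0.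
  have : \sum_(j < m) W j.+1 * (x j.+1 - x j) <=
      \sum_(j < m) - (c * wt R (val (h p (lift ord0 j)))).
    apply: ler_sum => j _; rewrite ffunE lift0 -/(W j.+1) -mulrN mulrC.
    by rewrite mulrN -mulNr ler_wpM2r.
  set S1 := \sum_(_ < _) _; set S2 := \sum_(_ < _) _.
  have := Wp 0%N; rewrite W0; nra.
- move=> p p' /pos[hs ha] /pos[hs' ha'] /ffunP e.
  have e0 : p.1 = p'.1 by have := e ord0; rewrite !ffunE !drop0 hs hs'.
  case: p p' hs ha hs' ha' e e0 => [s k] [s' k'] /= hs ha hs' ha' e e0; subst s'.
  congr (_, _); apply/ffunP => j.
  have st := step (s, k) j ha; have st' := step (s, k') j ha'.
  have ej : state (drop j (word k)) s = state (drop j (word k')) s.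
    by have := e j; rewrite !ffunE.
  have ej1 : state (drop j.+1 (word k)) s = state (drop j.+1 (word k')) s.
    case: (ltnP j.+1 m.+1) => jm; last by rewrite !drop_oversize ?size_word.
    by have := e (Ordinal jm); rewrite !ffunE.
  move: st st'; rewrite /= ej ej1 => -> h'.
  by apply: (@intr_inj R); move: h'; lra.
- by move=> u; apply: prodr_ge0 => j _; exact: expR_ge0.
Qed.
Lemma trace_domain_Re n (z : 'I_n -> C) : trace_domain tau z ->
  (forall i j : 'I_n, (i < j)%N -> complex.Re (z j) < complex.Re (z i)) /\
  (forall i j : 'I_n, complex.Re (z i) - L < complex.Re (z j)).
Proof.
move=> [d1 d2].
have hz (i j : 'I_n) : (i < j)%N -> complex.Re (z j) < complex.Re (z i).
  by move=> /d1; rewrite !norm_nc ltcR !nc_cexp ltr_expR.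
split=> // i j.
have hz' (i' j' : 'I_n) : (i' <= j')%N -> complex.Re (z j') <= complex.Re (z i').
  rewrite leq_eqVlt => /orP[/eqP/val_inj -> //|/hz]; exact: ltW.
case: n z d1 d2 hz hz' i j => [|m] z d1 d2 hz hz' i j; first by case: i.
have := d2 ord0 ord_max erefl erefl; rewrite !norm_nc ltcR ncM.
rewrite -[two_pi_i R * tau]mulr1 (nc_q tau 1) !nc_cexp -expRD ltr_expR mulr1.
have := hz' ord0 i (leq0n _); have := hz' j ord_max (leq_ord _); lra.
Qed.

Lemma trace_domain_strip n (z : 'I_n -> C) (i j : 'I_n) : trace_domain tau z ->
  (i < j)%N -> - L < complex.Re (z j - z i) < 0.
Proof.
move=> /trace_domain_Re[hz hL] ij.
have -> : complex.Re (z j - z i) = complex.Re (z j) - complex.Re (z i).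
  by case: (z j) (z i) => [? ?] [? ?].
by have := hz _ _ ij; have := hL i j; lra.
Qed.
End JointSummability.

(** * From words to the trace function *)

Section TraceFunction.
Variables (R : realType) (V : vosa_data R) (psi : V) (B : hbasis V fock_index).
Hypothesis hV : is_vosa V.
Hypothesis hpsi : rank_one_fermion psi B.
Variables (theta tau : R[i]) (g : {linear V -> V}).
Hypothesis hg : ((forall v : V, g v = v) /\ theta = 1)
        \/ (parity_automorphism g /\ theta = -1).
Hypothesis tau_im : 0 < complex.Im tau.
Local Notation C := R[i].
Local Notation Y := (vmode V psi).
Local Notation crd := (Defs.coord B).
Local Notation L := (period tau).

Lemma theta_sign : theta = 1 \/ theta = -1.
Proof. by case: hg => -[_ ->]; [left|right]. Qed.

Lemma coord_auto s v :
  (-1) ^+ bpar B s * crd s (g v) = (- theta) ^+ size (val s) * crd s v.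
Proof.
rewrite (bparE hV hpsi); case: hg => -[gE ->]; first by rewrite gE signr_odd.
rewrite opprK expr1n mul1r.
have [A vA] := Defs.coord_span B v.
rewrite {1}vA linear_sum coord_sum [in RHS]vA coord_sum mulr_sumr; apply: eq_bigr => i _.
rewrite linearZ /= (gE _ _ (bparP B i)) !coord_scale coord_bvec (bparE hV hpsi).
case: eqP => [->|_]; last by rewrite !mulr0.
rewrite !mulr1 mulrCA -[sval i]/(val i) !signr_odd -exprD addnn -signr_odd odd_double.
by rewrite expr0 mulr1.
Qed.

(** The scalar [q^(-c/24)] at [c = 1/2]. *)
Let kappa0 : C := cexp (- (two_pi_i R * tau * (2^-1 / 24%:R))).

Lemma qL0E s : (- theta) ^+ size (val s) * qL0 B tau s = kappa0 * sw theta tau s.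
Proof.
rewrite /qL0 (ccharge_psi hpsi) (bwtE hV hpsi) mulrBr cexpD /sw /kappa0.
by ring.
Qed.

Lemma Z_V_E : Z_V B g tau = kappa0 * wtrace psi B theta tau [::].
Proof.
have ts := theta_sign; apply: tsum_eq.
apply: has_sum_ext (has_sumZ kappa0 (has_sum_wtrace hV hpsi ts tau_im [::])) => s.
by rewrite mulrA -qL0E [in RHS]mulrA coord_auto; ring.
Qed.

Lemma foldr_expL0 n (z : 'I_n -> C) (k : 'I_n -> int) (r : seq 'I_n) v :
  foldr (fun j w => vmode V (expL0 B (z j) psi) (k j) w) v r =
  (\prod_(j <- r) cexp (z j * (2^-1 : R)%:C)) *: act psi [seq k j | j <- r] v.
Proof.
elim: r => [|j r IH] /=; first by rewrite big_nil scale1r.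
rewrite IH (expL0_psi hV hpsi) (vmode_scalel hV) (vmode_scale hV) scalerA big_cons.
by [].
Qed.

(** Both [F_V] and the sum over words are iterated sums of the joint family [f], in opposite orders,
    up to the factor [kappa0]. *)
Lemma F_V_E n (z : 'I_n -> C) : ~~ odd n -> trace_domain tau z ->
  F_V B g (fun=> psi) z tau = pfaffian (pmat theta tau z) * Z_V B g tau.
Proof.
move=> en dz; have ts := theta_sign; have [hz hL] := trace_domain_Re dz.
have hw := has_sum_words hV hpsi ts tau_im en (fun i j => @trace_domain_strip _ _ _ z i j dz).
pose f (p : fock_index * {ffun 'I_n -> int}) : C :=
  sw theta tau p.1 * (xmon z p.2 * crd p.1 (act psi (word p.2) (bvec B p.1))).
have [S hS] : exists S, has_sum f S.
  apply: bsums_has_sum; apply: bsums_le (bsums_paths tau_im hz hL) => p.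
  rewrite /f ncM [X in _ * X]ncM (nc_sw tau ts) (coord_act hV hpsi).
  by case: ifP; rewrite ?nc0.
have SE : S = pfaffian (pmat theta tau z) * wtrace psi B theta tau [::].
  have swI : injective (fun p : {ffun 'I_n -> int} * fock_index => (p.2, p.1)).
    by move=> [a b] [c d] [-> ->].
  have [|G [G1 G2]] := has_sum_fubini (has_sum_pull swI _ hS).
    by move=> [a b] _; exists (b, a).
  apply: has_sum_uniq G2 _; apply: has_sum_ext hw => k.
  apply/esym; apply: has_sum_uniq (G1 k) _.
  apply: has_sum_ext (has_sumZ (xmon z k) (has_sum_wtrace hV hpsi ts tau_im (word k))) => s.
  by rewrite /f /=; ring.
have [G [G1 G2]] := has_sum_fubini hS.
rewrite Z_V_E mulrCA -SE; apply: tsum_eq; apply: has_sum_ext (has_sumZ kappa0 G2) => s.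
(* The sum [G s] contains the weight [sw], which [vertex_entry] does not; [e] divides it out and
   restores the sign with which [g] acts on the state. *)
pose e := (-1) ^+ bpar B s * (- theta) ^+ size (val s) * (sw theta tau s)^-1.
have sg2 : (-1) ^+ bpar B s * (-1) ^+ bpar B s = 1 :> C by rewrite -signr_addb addbb.
have -> : vertex_entry B g (fun=> psi) z s = e * G s.
  apply: tsum_eq; apply: has_sum_ext (has_sumZ e (G1 s)) => k.
  rewrite foldr_expL0 linearZ coord_scale /= big_enum /= mulrA -big_split /=.
  rewrite (_ : \prod_(i < n) _ = xmon z k); last first.
    apply: eq_bigr => j _; rewrite -cexpD; congr cexp.
    have h2 : (2^-1 : R)%:C = 2^-1 :> C by rewrite fmorphV rmorph_nat.
    by rewrite /hf !h2 intrB mulrNz; field.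
  rewrite -/(word k); set w := act _ _ _.
  have ca : crd s (g w) = (-1) ^+ bpar B s * ((- theta) ^+ size (val s) * crd s w).
    by rewrite -coord_auto mulrA sg2 mul1r.
  rewrite [X in _ = _ * X]ca /e /f /= -/w; have s0 := sw_neq0 tau ts s.
  by field.
rewrite /e; have s0 := sw_neq0 tau ts s.
transitivity ((-1) ^+ bpar B s * (-1) ^+ bpar B s * ((- theta) ^+ size (val s) * qL0 B tau s)
  * (sw theta tau s)^-1 * G s); last by ring.
by rewrite sg2 qL0E; field.
Qed.
End TraceFunction.

(** * The trace functions as Pfaffians *)

Section PfaffianRegularity.
Variable R : realType.
Local Notation C := R[i].

Lemma mero_pfaffian n m (M : ('I_n -> C) -> 'M[C]_m) (a : 'I_n -> C) :
  (forall i j, mero_at (fun z => M z i j) a) -> mero_at (fun z => pfaffian (M z)) a.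
Proof.
move=> hM; apply: mero_sum => s _; apply: meroM; first exact: mero_const.
by apply: mero_prod => p _; exact: hM.
Qed.

Lemma analytic_pfaffian n m (M : ('I_n -> C) -> 'M[C]_m) (a : 'I_n -> C) :
  (forall i j, analytic_at (fun z => M z i j) a) ->
  analytic_at (fun z => pfaffian (M z)) a.
Proof.
move=> hM; apply: analytic_sum => s _; apply: analyticM; first exact: analytic_const.
by apply: analytic_prod => p _; exact: hM.
Qed.

(** The centres are equally spaced on the real axis with total spread below [L / 2], and a radius of
    a quarter of the spacing preserves all the strict inequalities. *)
Lemma trace_domain_ball n (tau : C) : 0 < complex.Im tau ->
  exists (a : 'I_n -> C) (r : R), 0 < r /\
    forall z, polydisc a r z -> trace_domain tau z.
Proof.
move=> ht; have L0 := period_gt0 ht; set L := period tau in L0.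
pose d := L / (2 * n.+1%:R); have n0 : 0 < n.+1%:R :> R by rewrite ltr0n.
have d0 : 0 < d by rewrite divr_gt0 // mulr_gt0.
have dL : d * n.+1%:R = L / 2 by rewrite /d invfM mulrA divfK // gt_eqF.
exists (fun i => (- (d * i%:R))%:C), (d / 4); split; first by lra.
move=> z /polydiscP hz.
have re (i : 'I_n) : - (d / 4) < complex.Re (z i) + d * i%:R < d / 4.
  rewrite -ltr_norml; apply: le_lt_trans (hz i).
  have -> : complex.Re (z i) + d * i%:R = complex.Re (z i - (- (d * i%:R))%:C).
    by case: (z i) => a b /=; rewrite opprK.
  exact: ncR_le.
split=> i j.
  move=> ij; rewrite !norm_nc ltcR !nc_cexp ltr_expR.
  have : (i : nat)%:R + 1 <= (j : nat)%:R :> R by rewrite natr1 ler_nat.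
  by move: (re i) (re j) => /andP[? ?] /andP[? ?]; nra.
move=> i0 jn; rewrite !norm_nc ltcR ncM -[two_pi_i R * tau]mulr1 (nc_q tau 1) !nc_cexp.
rewrite -expRD ltr_expR mulr1 -/L.
have : (j : nat)%:R + 1 <= n.+1%:R :> R.
  by rewrite natr1 ler_nat; have := ltn_ord j; lia.
move: (re i) (re j) => /andP[? ?] /andP[? ?]; move: dL.
have : (0 : R) <= (i : nat)%:R by rewrite ler0n.
by nra.
Qed.
End PfaffianRegularity.

Theorem proposition5p1 (R : realType) (V : vosa_data R) (hV : is_vosa V)
  (psi : V) (B : hbasis V fock_index) (hpsi : rank_one_fermion psi B)
  (n : nat) (hn : ~~ odd n)
  (g : {linear V -> V}) (theta : R[i])
  (hg : ((forall v : V, g v = v) /\ theta = 1)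
        \/ (parity_automorphism g /\ theta = -1))
  (tau : R[i]) (htau : 0 < complex.Im tau)
  (P1 : R[i] -> R[i]) (hP1 : twisted_weierstrass theta (-1) tau P1) :
  (exists G : ('I_n -> R[i]) -> R[i], is_G B g psi tau G) /\
  (forall G : ('I_n -> R[i]) -> R[i], is_G B g psi tau G ->
   forall z : 'I_n -> R[i],
     analytic_at G z ->
     (forall i j : 'I_n, i != j -> analytic1_at P1 (z i - z j)) ->
     (PP P1 z)^T = - PP P1 z
     /\ G z = pfaffian (PP P1 z) * Z_V B g tau).
Proof.
have ts := theta_sign hg.
(* Above the diagonal these entries are the values [pser (z j - z i)] on the trace domain; they
   become those of [PP] only through oddness. *)
pose N (z : 'I_n -> R[i]) : 'M[R[i]]_n :=
  \matrix_(i, j) if i == j then 0 else (-1) * P1 (z j - z i).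
pose F (z : 'I_n -> R[i]) := pfaffian (N z) * Z_V B g tau.
have FE z : trace_domain tau z -> F z = F_V B g (fun=> psi) z tau.
  move=> hz; rewrite (F_V_E hV hpsi hg htau hn hz); congr (_ * _).
  apply: pfaffian_ext => i j ij; rewrite !mxE.
  have -> : (i == j) = false by apply/eqP => e; rewrite e ltnn in ij.
  rewrite (P1_pser hP1) ?mulN1r ?opprK //.
  exact: (trace_domain_strip hz ij).
have mF : meromorphic F.
  move=> a; apply: meroM; last exact: mero_const.
  apply: mero_pfaffian => i j.
  rewrite (_ : (fun z => _) = fun z => if i == j then 0 else (-1) * P1 (z j - z i)); last first.
    by apply/funext => z; rewrite mxE.
  case: eqP => [_|/eqP ij]; first exact: mero_const.
  apply: meroM; first exact: mero_const.
  by apply: mero_comp_sub hP1.1; rewrite eq_sym.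
(* [F] agrees with the trace on its domain and is meromorphic everywhere, so it is itself a
   continuation. *)
split; first by exists F.
move=> G [mG GE] z aG aP.
have odd_P (i j : 'I_n) : i != j -> P1 (z j - z i) = - P1 (z i - z j).
  move=> ij; rewrite -opprB; apply: (P1_odd ts htau hP1); first exact: aP.
  by rewrite opprB; apply: aP; rewrite eq_sym.
split.
  apply/matrixP => i j; rewrite !mxE eq_sym; case: eqP => [_|/eqP ij]; first by rewrite oppr0.
  exact: odd_P.
(* The difference of two continuations vanishes on a ball of the trace domain, hence near [z] off
   some denominator; analyticity of both at [z] then gives the value there. *)
pose E (w : 'I_n -> R[i]) := G w + (-1) * F w.
have mE : meromorphic E.
  by move=> a; apply: meroD; [exact: mG | apply: meroM; [exact: mero_const|exact: mF]].
have [a [r [r0 ha]]] := trace_domain_ball n htau.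
have vE : vanishes_near E a.
  apply: (vanishes_nearW r0) => w /ha hw.
  by rewrite /E GE // FE // mulN1r subrr.
have aF : analytic_at F z.
  apply: analyticM; last exact: analytic_const.
  apply: analytic_pfaffian => i j.
  rewrite (_ : (fun z => _) = fun z => if i == j then 0 else (-1) * P1 (z j - z i)); last first.
    by apply/funext => w; rewrite mxE.
  case: eqP => [_|/eqP ij]; first exact: analytic_const.
  apply: analyticZ; apply: analytic_comp_sub; first by rewrite eq_sym.
  by apply: aP; rewrite eq_sym.
have aE : analytic_at E z by apply: analyticD => //; exact: analyticZ.
have := vanishes_near_analytic aE (vanishes_near_everywhere z mE vE).
rewrite /E mulN1r => /eqP; rewrite subr_eq0 => /eqP ->; congr (_ * _).
apply: pfaffian_ext => i j ij; rewrite !mxE.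
have ij' : i != j by apply/eqP => e; rewrite e ltnn in ij.
by rewrite (negPf ij') (odd_P _ _ ij') mulN1r opprK.
Qed.
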